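(* Let $T$ and $S$ be two proper m-towers of finite height. For every unital $*$-homomorphism $\Phi\colon C^*(T)\to C^*(S)$ there exists a unique morphism $\tau\colon S\to T$ such that $\Phi=\Phi_\tau$, where $$\Phi_\tau\colon C^*(T)\ni f\mapsto f\circ\tau\in C^*(S).$$ Conversely, if $\tau\colon S\to T$ is an arbitrary morphism, then this formula correctly defines a unital $*$-homomorphism $\Phi_\tau$.
   Context: Conventions. All topological spaces are Hausdorff; $\mathbb N=\{1,2,\ldots\}$. $M_n$ is the $C^*$-algebra of complex $n\times n$ matrices, $\mathcal U_n$ its unitary group, $I_n$ its unit. For $U\in\mathcal U_n$, $X\in M_n$: $U.X=UXU^{-1}$. For $X\in M_n$, $Y\in M_k$, $X\oplus Y\in M_{n+k}$ is the block-diagonal matrix. Towers. A tower is a topological space $T$ with a continuous function $d\colon T\to\mathbb N$, an operation $\oplus\colon T\times T\to T$ and functions $\mathcal U_n\times T_n\ni(U,x)\mapsto U.x\in T$ (where $T_n=d^{-1}(\{n\})$), such that: (T1) $\oplus$ is associative and continuous, and for each $n$ the map $T_n\times T\ni(x,y)\mapsto x\oplus y\in T$ is a closed embedding; (T2) $d(x\oplus y)=d(x)+d(y)$ and $d(U.x)=d(x)$; (T3) each $\mathcal U_n\times T_n\to T_n$ is a continuous group action; (T4) $U.x=x$ if $U\in\mathcal U_{d(x)}$ is a scalar multiple of the unit matrix; (T5) $(U\oplus V).(x\oplus y)=(U.x)\oplus(V.y)$ for $x\in T_n$, $y\in T_k$, $U\in\mathcal U_n$, $V\in\mathcal U_k$;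 (T6) $U_{d(x),d(y)}.(x\oplus y)=y\oplus x$, where $U_{p,q}\in\mathcal U_{p+q}$ is given by $(w_1,\ldots,w_q,z_1,\ldots,z_p)\cdot U_{p,q}=(z_1,\ldots,z_p,w_1,\ldots,w_q)$ (row vectors). The tower is proper if $d$ is a proper map, i.e. each $T_n$ is compact. Let $T$ be a tower. An element $x$ is reducible if $V.x=a\oplus b$ for some $a,b\in T$, $V\in\mathcal U_{d(x)}$; otherwise it is irreducible. $\operatorname{stab}(x)=\{U\in\mathcal U_{d(x)}: U.x=x\}$. $x\equiv y$ means $U.x=y$ for some $U\in\mathcal U_{d(x)}$; $x\preccurlyeq y$ means that $x\equiv y$ or there are $a,b\in T$ with $x\equiv a$, $y\equiv a\oplus b$; $x\perp y$ ($x,y$ disjoint) means there is no $a\in T$ with $a\preccurlyeq x$ and $a\preccurlyeq y$. The height of $T$ is the supremum of $d(x)$ over irreducible $x\in T$ ($\sup\varnothing=0$). A topological space $X$ has property $(\sigma)$ if there are sets $K_1\subset K_2\subset\cdots$ with union $X$, each compact Hausdorff in the subspace topology, such that $B\subset X$ is closed iff $B\cap K_n$ is closed for each $n$. An m-tower is a tower $T$ that has property $(\sigma)$ and satisfies for all $x,y,z\in T$: (mT1) if $z\perp x$ and $z\perp y$, then $z\perp x\oplus y$; (mT2) if $z\oplus x\equiv z\oplus y$, then $x\equiv y$; (mT3) if $x\perp y$, then $\operatorname{stab}(x\oplus y)=\{U\oplus V: U\in\operatorname{stab}(x),\ V\in\operatorname{stab}(y)\}$; (mT4) if $x$ is irreducible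 and $p=d(x)$, then for each $n>0$ the stabilizer of the $n$-fold sum $x\oplus\cdots\oplus x$ is $\{I_p\otimes U: U\in\mathcal U_n\}$, where $I_p\otimes[u_{jk}]$ is the block matrix $[u_{jk}I_p]$. A morphism of towers is a continuous function $v$ with $d(v(x))=d(x)$, $v(U.x)=U.v(x)$ for $U\in\mathcal U_{d(x)}$, and $v(x\oplus y)=v(x)\oplus v(y)$. $C^*(T)$ is the unital $C^*$-algebra (pointwise operations, supremum norm) of all functions $f$ on $T$ with $f(x)\in M_{d(x)}$, $f|_{T_n}\colon T_n\to M_n$ continuous for all $n$, $f(U.x)=U.f(x)$ for $U\in\mathcal U_{d(x)}$, $f(x\oplus y)=f(x)\oplus f(y)$, and $\|f\|=\sup_{x\in T}\|f(x)\|<\infty$. *)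

(* Defs.v *)
From HB Require Import structures.
From mathcomp Require Import all_boot all_order all_algebra.
From mathcomp Require Import all_classical all_reals all_analysis.
From mathcomp Require Import complex mxtens spectral.

Set Implicit Arguments.
Unset Strict Implicit.
Unset Printing Implicit Defensive.

Import Order.TTheory GRing.Theory Num.Theory.
Import numFieldNormedType.Exports.

Local Open Scope classical_set_scope.
Local Open Scope ring_scope.
Local Open Scope sesquilinear_scope.

(* The topology of the modulus on R[i], which the library provides only on
   R[i]^o; it induces the entrywise topology on 'M[R[i]]_n. *)
#[warnings="-redundant-canonical-projection"]
HB.instance Definition _ (R : realType) := NormedModule.copy R[i] R[i]^o.

Section Matrices.
Variable R : realType.

(* [as_mx n A] is A seen as an n x n matrix when A has size n (and 0
   otherwise); it replaces casts along provable equalities of dimensions. *)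
Definition as_mx (n m : nat) (A : 'M[R[i]]_m) : 'M[R[i]]_n :=
  conform_mx (0 : 'M[R[i]]_n) A.

Definition dsum_mx (n k : nat) (A : 'M[R[i]]_n) (B : 'M[R[i]]_k) :
  'M[R[i]]_(n + k) := block_mx A 0 0 B.

Definition swap_mx (p q : nat) : 'M[R[i]]_(p + q) :=
  castmx (addnC q p, erefl) (block_mx 0 1%:M 1%:M 0 : 'M[R[i]]_(q + p, p + q)).

Lemma swap_mxP (p q : nat) (w : 'rV[R[i]]_q) (z : 'rV[R[i]]_p) :
  castmx (erefl, addnC q p) (row_mx w z) *m swap_mx p q = row_mx z w.
Proof.
rewrite /swap_mx mulmx_cast castmx_comp castmx_id !castmx_id.
by rewrite mul_row_block !mulmx0 !mulmx1 add0r addr0.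
Qed.

Definition l2norm (n : nat) (v : 'cV[R[i]]_n) : R :=
  Num.sqrt (\sum_i Normc.normc (v i 0) ^+ 2).

Definition opnorm (n : nat) (A : 'M[R[i]]_n) : R :=
  sup [set l2norm (A *m v) | v in [set v : 'cV[R[i]]_n | l2norm v <= 1]].

End Matrices.

Section MatrixTheory.
Variable R : realType.
Local Notation C := R[i].
Local Notation normc := (@Normc.normc R).
Implicit Types (n m : nat).

Lemma as_mx_id n (A : 'M[C]_n) : as_mx n A = A.
Proof. exact: conform_mx_id. Qed.

Lemma as_mx0 n m : as_mx n (0 : 'M[C]_m) = 0.
Proof.
case: (eqVneq m n) => [->|mn]; first by rewrite as_mx_id.
by rewrite /as_mx nonconform_mx ?mn.
Qed.

Lemma as_mxD n m (A B : 'M[C]_m) : as_mx n (A + B) = as_mx n A + as_mx n B.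
Proof.
case: (eqVneq m n) A B => [->|mn] A B; first by rewrite !as_mx_id.
by rewrite /as_mx !nonconform_mx ?mn// addr0.
Qed.

Lemma as_mxZ n m a (A : 'M[C]_m) : as_mx n (a *: A) = a *: as_mx n A.
Proof.
case: (eqVneq m n) A => [->|mn] A; first by rewrite !as_mx_id.
by rewrite /as_mx !nonconform_mx ?mn// scaler0.
Qed.

Lemma as_mxM n m (A B : 'M[C]_m) : as_mx n (A *m B) = as_mx n A *m as_mx n B.
Proof.
case: (eqVneq m n) A B => [->|mn] A B; first by rewrite !as_mx_id.
by rewrite /as_mx !nonconform_mx ?mn// mulmx0.
Qed.

Lemma as_mx_adj n m (A : 'M[C]_m) : as_mx n (A^t*) = (as_mx n A)^t*.
Proof.
case: (eqVneq m n) A => [->|mn] A; first by rewrite !as_mx_id.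
by rewrite /as_mx !nonconform_mx ?mn// trmx0 map_mx0.
Qed.

Lemma as_mx1 n m : m = n -> as_mx n (1%:M : 'M[C]_m) = 1%:M.
Proof. by move=> ->; exact: as_mx_id. Qed.

Lemma dsum_mxD n k (A A' : 'M[C]_n) (B B' : 'M[C]_k) :
  dsum_mx (A + A') (B + B') = dsum_mx A B + dsum_mx A' B'.
Proof. by rewrite /dsum_mx add_block_mx !addr0. Qed.

Lemma dsum_mxZ n k a (A : 'M[C]_n) (B : 'M[C]_k) :
  dsum_mx (a *: A) (a *: B) = a *: dsum_mx A B.
Proof. by rewrite /dsum_mx scale_block_mx !scaler0. Qed.

Lemma dsum_mxM n k (A A' : 'M[C]_n) (B B' : 'M[C]_k) :
  dsum_mx (A *m A') (B *m B') = dsum_mx A B *m dsum_mx A' B'.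
Proof. by rewrite /dsum_mx mulmx_block !mulmx0 !mul0mx !addr0 add0r. Qed.

Lemma dsum_mx1 n k : dsum_mx (1%:M : 'M[C]_n) (1%:M : 'M[C]_k) = 1%:M.
Proof. by rewrite /dsum_mx -scalar_mx_block. Qed.

Lemma dsum_mx_adj n k (A : 'M[C]_n) (B : 'M[C]_k) :
  dsum_mx (A^t*) (B^t*) = (dsum_mx A B)^t*.
Proof. by rewrite /dsum_mx tr_block_mx map_block_mx !trmx0 !map_mx0. Qed.

Lemma normc_ge0 (z : C) : 0 <= normc z.
Proof. by case: z => a b; exact: sqrtr_ge0. Qed.

Lemma normcC (z : C) : (normc z)%:C%C = `|z|.
Proof. by case: z. Qed.

Lemma ler_normc_sum (I : finType) (F : I -> C) :
  normc (\sum_i F i) <= \sum_i normc (F i).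
Proof.
elim/big_ind2 : _ => [|x1 x2 y1 y2 h1 h2|//]; first by rewrite Normc.normc0.
exact: le_trans (le_normcD _ _) (lerD h1 h2).
Qed.

Lemma cauchy_schwarz_sum (I : finType) (a b : I -> R) :
  (\sum_i a i * b i) ^+ 2 <= (\sum_i a i ^+ 2) * (\sum_i b i ^+ 2).
Proof.
set ab := \sum_i a i * b i; set aa := \sum_i _; set bb := \sum_i _.
have aa0 : 0 <= aa by apply: sumr_ge0 => i _; exact: sqr_ge0.
have bb0 : 0 <= bb by apply: sumr_ge0 => i _; exact: sqr_ge0.
have key x : 0 <= aa - x * ab *+ 2 + x ^+ 2 * bb.
  suff -> : aa - x * ab *+ 2 + x ^+ 2 * bb = \sum_i (a i - x * b i) ^+ 2.
    by apply: sumr_ge0 => i _; exact: sqr_ge0.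
  rewrite /aa /ab /bb !mulr_sumr -sumrMnl -sumrB -big_split/=.
  by apply: eq_bigr => i _; rewrite sqrrB exprMn mulrCA.
have [bb0'|bb0'] := eqVneq bb 0.
  have b0 i : b i = 0.
    apply/eqP; rewrite -sqrf_eq0; apply/eqP.
    by move/psumr_eq0P : bb0'; apply => // j _; exact: sqr_ge0.
  rewrite /ab big1 ?expr0n ?mulr_ge0// => i _.
  by rewrite b0 mulr0.
have bbp : 0 < bb by rewrite lt_def bb0'.
have := key (ab / bb).
rewrite expr_div_n -(pmulr_lge0 _ bbp) mulrDl mulrBl => h.
rewrite -subr_ge0; apply: le_trans h _; rewrite le_eqVlt; apply/orP; left.
apply/eqP.
have -> : ab ^+ 2 / bb ^+ 2 * bb * bb = ab ^+ 2 by rewrite -mulrA -expr2 divfK ?expf_neq0.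
have -> : ab / bb * ab *+ 2 * bb = ab ^+ 2 *+ 2.
  by rewrite mulrnAl mulrAC divfK// expr2.
by rewrite mulr2n opprD addrA subrK.
Qed.

Lemma l2norm_ge0 n (v : 'cV[C]_n) : 0 <= l2norm v.
Proof. exact: sqrtr_ge0. Qed.

Lemma l2normE n (v : 'cV[C]_n) : l2norm v ^+ 2 = \sum_i normc (v i 0) ^+ 2.
Proof. by rewrite sqr_sqrtr// sumr_ge0// => i _; exact: sqr_ge0. Qed.

Lemma sum_normcM_le n (u v : 'cV[C]_n) :
  \sum_i normc (u i 0) * normc (v i 0) <= l2norm u * l2norm v.
Proof.
rewrite -ler_sqr ?nnegrE ?mulr_ge0 ?l2norm_ge0//; last first.
  by apply: sumr_ge0 => i _; rewrite mulr_ge0 ?normc_ge0.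
by rewrite exprMn !l2normE; exact: cauchy_schwarz_sum.
Qed.

Lemma l2normD n (u v : 'cV[C]_n) : l2norm (u + v) <= l2norm u + l2norm v.
Proof.
rewrite -ler_sqr ?nnegrE ?addr_ge0 ?l2norm_ge0//.
rewrite sqrrD !l2normE.
apply: (@le_trans _ _ (\sum_i (normc (u i 0) + normc (v i 0)) ^+ 2)).
  apply: ler_sum => i _; rewrite mxE ler_sqr ?nnegrE ?addr_ge0 ?normc_ge0//.
  exact: le_normcD.
under eq_bigr do rewrite sqrrD.
rewrite !big_split/= lerD2r lerD2l mulr2n.
by apply: lerD; exact: sum_normcM_le.
Qed.

Lemma l2normZ n a (v : 'cV[C]_n) : l2norm (a *: v) = normc a * l2norm v.
Proof.
rewrite /l2norm; under eq_bigr do rewrite mxE Normc.normcM exprMn.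
rewrite -mulr_sumr sqrtrM ?sqr_ge0// sqrtr_sqr ger0_norm//.
exact: normc_ge0.
Qed.

Lemma l2norm0 n : l2norm (0 : 'cV[C]_n) = 0.
Proof. by rewrite -(scale0r 0) l2normZ Normc.normc0 mul0r. Qed.

Lemma l2norm_eq0 n (v : 'cV[C]_n) : l2norm v = 0 -> v = 0.
Proof.
move=> /(congr1 (fun x => x ^+ 2)); rewrite l2normE expr0n/= => /psumr_eq0P v0.
apply/matrixP => i j; rewrite (ord1 j) mxE; apply: Normc.eq0_normc.
by apply/eqP; rewrite -sqrf_eq0; apply/eqP/v0 => // k _; exact: sqr_ge0.
Qed.

Lemma normc_le_l2norm n (v : 'cV[C]_n) i : normc (v i 0) <= l2norm v.
Proof.
rewrite -ler_sqr ?nnegrE ?normc_ge0 ?l2norm_ge0// l2normE (bigD1 i)//= lerDl.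
by apply: sumr_ge0 => j _; exact: sqr_ge0.
Qed.

Lemma l2norm_le_sum n (v : 'cV[C]_n) : l2norm v <= \sum_i normc (v i 0).
Proof.
have s0 : 0 <= \sum_i normc (v i 0).
  by apply: sumr_ge0 => i _; exact: normc_ge0.
rewrite -ler_sqr ?nnegrE ?l2norm_ge0// l2normE expr2 mulr_suml.
apply: ler_sum => i _; rewrite expr2 ler_wpM2l ?normc_ge0//.
rewrite (bigD1 i)//= lerDl; apply: sumr_ge0 => j _; exact: normc_ge0.
Qed.

Lemma opnorm_has_sup n (A : 'M[C]_n) :
  has_sup [set l2norm (A *m v) | v in [set v : 'cV[C]_n | l2norm v <= 1]].
Proof.
split; first by exists (l2norm (A *m 0)); exists 0; rewrite //= l2norm0 ler01.
exists (\sum_i \sum_j normc (A i j)) => _ [v /= v1 <-].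
apply: le_trans (l2norm_le_sum _) _; apply: ler_sum => i _.
rewrite mxE; apply: le_trans (ler_normc_sum _) _; apply: ler_sum => j _.
rewrite Normc.normcM ler_piMr ?normc_ge0//.
exact: le_trans (normc_le_l2norm _ _) v1.
Qed.

Lemma opnorm_ge0 n (A : 'M[C]_n) : 0 <= opnorm A.
Proof.
rewrite -(l2norm0 n) -(mulmx0 _ A).
by apply: sup_upper_bound; [exact: opnorm_has_sup|exists 0; rewrite //= l2norm0].
Qed.

Lemma l2norm_mul n (A : 'M[C]_n) (v : 'cV[C]_n) :
  l2norm (A *m v) <= opnorm A * l2norm v.
Proof.
have [v0|v0] := eqVneq (l2norm v) 0.
  by rewrite (l2norm_eq0 v0) mulmx0 l2norm0 mulr0.
have vp : 0 < l2norm v by rewrite lt_def v0 l2norm_ge0.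
have nv : normc ((l2norm v)^-1)%:C%C = (l2norm v)^-1.
  by rewrite /= expr0n addr0 sqrtr_sqr ger0_norm// invr_ge0 l2norm_ge0.
rewrite -ler_pdivrMr// mulrC -[X in X * _]nv -l2normZ scalemxAr.
apply: sup_upper_bound; first exact: opnorm_has_sup.
exists (((l2norm v)^-1)%:C%C *: v) => //=.
by rewrite l2normZ nv mulVf.
Qed.

Lemma opnorm_le n (A : 'M[C]_n) (c : R) : 0 <= c ->
  (forall v : 'cV[C]_n, l2norm (A *m v) <= c * l2norm v) -> opnorm A <= c.
Proof.
move=> c0 Ac; apply: ge_sup; first by have [] := opnorm_has_sup A.
move=> _ [v /= v1 <-]; apply: le_trans (Ac v) _.
by rewrite ler_piMr.
Qed.

Lemma opnormD n (A B : 'M[C]_n) : opnorm (A + B) <= opnorm A + opnorm B.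
Proof.
apply: opnorm_le => [|v]; first by rewrite addr_ge0 ?opnorm_ge0.
by rewrite mulmxDl mulrDl (le_trans (l2normD _ _))// lerD ?l2norm_mul.
Qed.

Lemma opnormZ n a (A : 'M[C]_n) : opnorm (a *: A) <= normc a * opnorm A.
Proof.
apply: opnorm_le => [|v]; first by rewrite mulr_ge0 ?normc_ge0 ?opnorm_ge0.
by rewrite -scalemxAl l2normZ -mulrA ler_wpM2l ?normc_ge0 ?l2norm_mul.
Qed.

Lemma opnormM n (A B : 'M[C]_n) : opnorm (A *m B) <= opnorm A * opnorm B.
Proof.
apply: opnorm_le => [|v]; first by rewrite mulr_ge0 ?opnorm_ge0.
rewrite -mulmxA (le_trans (l2norm_mul _ _))// -mulrA.
by rewrite ler_wpM2l ?opnorm_ge0 ?l2norm_mul.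
Qed.

Lemma opnorm1 n : opnorm (1%:M : 'M[C]_n) <= 1.
Proof. by apply: opnorm_le => // v; rewrite mul1mx mul1r. Qed.

Lemma opnorm_adj n (A : 'M[C]_n) : opnorm (A^t*) <= opnorm A.
Proof.
apply: opnorm_le => [|v]; first exact: opnorm_ge0.
set w := _ *m v.
have [->|w0] := eqVneq (l2norm w) 0; first by rewrite mulr_ge0 ?opnorm_ge0 ?l2norm_ge0.
have wp : 0 < l2norm w by rewrite lt_def w0 l2norm_ge0.
rewrite -(ler_pM2r wp) -expr2 mulrAC.
have Cw : (l2norm w ^+ 2)%:C%C = (v^t* *m (A *m w)) 0 0.
  have -> : v^t* *m (A *m w) = w^t* *m w.
    by rewrite mulmxA {2}/w trmx_mul map_mxM/= trmxCK.
  rewrite l2normE rmorph_sum/= mxE; apply: eq_bigr => i _.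
  by rewrite !mxE rmorphXn/= normcC normCK mulrC.
have -> : l2norm w ^+ 2 = normc ((v^t* *m (A *m w)) 0 0).
  by rewrite -Cw /= expr0n addr0 sqrtr_sqr ger0_norm// sqr_ge0.
apply: (@le_trans _ _ (l2norm v * l2norm (A *m w))).
  rewrite mxE; apply: le_trans (ler_normc_sum _) _.
  apply: le_trans (sum_normcM_le _ _); apply: ler_sum => i _.
  rewrite Normc.normcM !mxE.
  have -> // : normc (Num.conj (v i 0)) = normc (v i 0).
  by apply: complexI; rewrite !normcC norm_conjC.
rewrite mulrC; apply: le_trans (ler_wpM2r (l2norm_ge0 v) (l2norm_mul _ _)) _.
by rewrite mulrAC.
Qed.

Lemma mx_cvgP (T : Type) (F : set_system T) (FF : Filter F) m n
    (f : T -> 'M[C]_(m, n)) (M : 'M[C]_(m, n)) :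
  f @ F --> M <-> forall i j, (fun x => f x i j) @ F --> M i j.
Proof.
split=> [fM i j U /= MU|fM U [P MP PU]].
  apply: (fM [set N | U (N i j)]).
  exists (fun i' j' => [set z | (i', j') = (i, j) -> U z]).
    move=> i' j'; have [[-> ->]|ne] := pselect ((i', j') = (i, j)).
      by apply: filterS MU => z Uz _.
    by apply: filterS filterT => z _ /ne.
  by move=> N /(_ i j); exact.
apply: (@filterS _ F _ [set x | forall i j, P i j (f x i j)]).
  by move=> x /= Px; apply: PU => i j; exact: Px.
suff : F (\bigcap_(ij in [set` enum (('I_m * 'I_n)%type : finType)])
    [set x | P ij.1 ij.2 (f x ij.1 ij.2)]).
  by apply: filterS => x /= Px i j; apply: (Px (i, j)); rewrite /= mem_enum.
elim: (enum _) => [|[i j] s IHs].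
  by apply: filterS filterT => x _ k.
have Pij : F [set x | P i j (f x i j)] by exact: (fM i j _ (MP i j)).
apply: filterS2 IHs Pij => x /= Px Pij [i' j'] /=.
by rewrite in_cons => /orP[/eqP[-> ->]//|]; exact: Px.
Qed.

Lemma cvg_sum_fin (T : Type) (F : set_system T) (FF : Filter F) n
    (f : 'I_n -> T -> C) (l : 'I_n -> C) : (forall k, f k @ F --> l k) ->
  (fun x => \sum_k f k x) @ F --> \sum_k l k.
Proof.
move=> fl; apply: cvg_big => //; exact: (@add_continuous R[i]).
Qed.

Lemma conj_continuous : continuous (@Num.conj R[i]).
Proof.
move=> z; apply/(@cvgrPdist_lt _ _ _ (nbhs z)) => /= e e0.
apply: filterS (@cvgr_dist_lt _ _ _ (nbhs z) _ id z cvg_id e e0) => t /=.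
by rewrite -rmorphB/= norm_conjC.
Qed.

End MatrixTheory.

Definition closed_embedding_on (X Y : topologicalType) (A : set X)
    (f : X -> Y) : Prop :=
  [/\ {within A, continuous f}, set_inj A f,
      forall U, open U ->
        exists2 V, open V & f @` (A `&` U) = f @` A `&` V
    & closed (f @` A)].

(* The action of the n x n unitary group on the elements of dimension n is
   given by a total function of an n x n matrix and a point; its values at
   non-unitary matrices or at points of another dimension are irrelevant. *)
Record tower (R : realType) := Tower {
  tower_space :> topologicalType;
  tdim : tower_space -> nat;
  tsum : tower_space -> tower_space -> tower_space;
  tact : forall n : nat, 'M[R[i]]_n -> tower_space -> tower_space;
  tower_hausdorff : hausdorff_space tower_space;
  tdim_gt0 : forall x, (0 < tdim x)%N;
  tdim_continuous : continuous tdim;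
  tsumA : associative tsum;
  tsum_continuous :
    continuous (fun p : tower_space * tower_space => tsum p.1 p.2);
  tsum_closed_embedding : forall n,
    closed_embedding_on [set p : tower_space * tower_space | tdim p.1 = n]
      (fun p => tsum p.1 p.2);
  tdim_sum : forall x y, tdim (tsum x y) = (tdim x + tdim y)%N;
  tdim_act : forall x (U : 'M[R[i]]_(tdim x)), U \is unitarymx ->
    tdim (tact U x) = tdim x;
  tact_continuous : forall n,
    {within [set p : 'M[R[i]]_n * tower_space |
               p.1 \is unitarymx /\ tdim p.2 = n],
      continuous (fun p => tact p.1 p.2)};
  tact1 : forall x, tact (1%:M : 'M[R[i]]_(tdim x)) x = x;
  tactM : forall x (U V : 'M[R[i]]_(tdim x)),
    U \is unitarymx -> V \is unitarymx ->
    tact (U *m V) x = tact U (tact V x);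
  tact_scalar : forall x (U : 'M[R[i]]_(tdim x)),
    U \is unitarymx -> is_scalar_mx U -> tact U x = x;
  tact_sum : forall x y (U : 'M[R[i]]_(tdim x)) (V : 'M[R[i]]_(tdim y)),
    U \is unitarymx -> V \is unitarymx ->
    tact (dsum_mx U V) (tsum x y) = tsum (tact U x) (tact V y);
  tact_swap : forall x y,
    tact (swap_mx R (tdim x) (tdim y)) (tsum x y) = tsum y x
}.

Section TowerNotions.
Variables (R : realType) (T : tower R).
Implicit Types x y z a b : T.

Definition proper_tower : Prop := forall n, compact [set x : T | tdim x = n].

Definition reducible x : Prop :=
  exists (V : 'M[R[i]]_(tdim x)) a b, V \is unitarymx /\ tact V x = tsum a b.

Definition irreducible x : Prop := ~ reducible x.

(* Meaningful for n = tdim x only. *)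
Definition stab (n : nat) x : set 'M[R[i]]_n :=
  [set U | U \is unitarymx /\ tact U x = x].

Definition tequiv x y : Prop :=
  exists2 U : 'M[R[i]]_(tdim x), U \is unitarymx & tact U x = y.

Definition tprec x y : Prop :=
  tequiv x y \/ exists a b, tequiv x a /\ tequiv y (tsum a b).

Definition tdisjoint x y : Prop := ~ exists a, tprec a x /\ tprec a y.

Definition height : \bar R :=
  ereal_sup (0%E |` [set (tdim x)%:R%:E | x in irreducible]).

(* The n-fold sum of x, for n > 0 only. *)
Definition nfold (n : nat) x : T := iter n.-1 (tsum x) x.

End TowerNotions.

Arguments stab {R T} n x.

Definition property_sigma (X : topologicalType) : Prop :=
  exists K : nat -> set X,
    [/\ forall n, K n `<=` K n.+1,
        \bigcup_n K n = setT,
        forall n, compact (K n) /\ hausdorff_space (subspace (K n))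
      & forall B : set X, closed B <-> forall n, closed (B `&` K n)].

(* U *t 1%:M is the block matrix whose (j, k) block is U j k *: 1%:M. *)
Record m_tower (R : realType) (T : tower R) : Prop := MTower {
  m_tower_sigma : property_sigma T;
  m_tower_disjoint_sum : forall x y z : T,
    tdisjoint z x -> tdisjoint z y -> tdisjoint z (tsum x y);
  m_tower_cancel : forall x y z : T,
    tequiv (tsum z x) (tsum z y) -> tequiv x y;
  m_tower_stab_sum : forall x y : T, tdisjoint x y ->
    stab (tdim x + tdim y)%N (tsum x y) =
    [set dsum_mx U V | U in stab (tdim x) x & V in stab (tdim y) y];
  m_tower_stab_nfold : forall (x : T) (n : nat), irreducible x -> (0 < n)%N ->
    stab (n * tdim x)%N (nfold n x) =
    [set U *t (1%:M : 'M[R[i]]_(tdim x)) |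
       U in [set U : 'M[R[i]]_n | U \is unitarymx]]
}.

Record tower_morphism (R : realType) (S T : tower R) (v : S -> T) : Prop := {
  morph_continuous : continuous v;
  morph_dim : forall x, tdim (v x) = tdim x;
  morph_act : forall x (U : 'M[R[i]]_(tdim x)), U \is unitarymx ->
    v (tact U x) = tact U (v x);
  morph_sum : forall x y, v (tsum x y) = tsum (v x) (v y)
}.

Section CstarAlgebra.
Variables (R : realType) (T : tower R).

Definition mxfield : Type := forall x : T, 'M[R[i]]_(tdim x).

Definition cnorm (f : mxfield) : \bar R :=
  ereal_sup [set (opnorm (f x))%:E | x in [set: T]].

Record cstar_fun (f : mxfield) : Prop := {
  cstar_continuous : forall n,
    {within [set x : T | tdim x = n], continuous (fun x => as_mx n (f x))};
  cstar_act : forall x (U : 'M[R[i]]_(tdim x)), U \is unitarymx ->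
    as_mx (tdim x) (f (tact U x)) = U *m f x *m invmx U;
  cstar_sum : forall x y,
    as_mx (tdim x + tdim y)%N (f (tsum x y)) = dsum_mx (f x) (f y);
  cstar_bounded : (cnorm f < +oo)%E
}.

Record cstar : Type := Cstar {
  cstar_val :> forall x : T, 'M[R[i]]_(tdim x);
  cstarP : cstar_fun cstar_val
}.

Lemma cstar_eqP (f g : cstar) : (forall x, f x = g x) -> f = g.
Proof.
case: f g => [f Pf] [g Pg] /= fg.
have {}fg : f = g by apply: functional_extensionality_dep.
by case: g / fg Pg => Pg; congr Cstar; exact: Prop_irrelevance.
Qed.

HB.instance Definition _ := gen_eqMixin cstar.
HB.instance Definition _ := gen_choiceMixin cstar.

Lemma cnorm_ltP (f : mxfield) :
  (cnorm f < +oo)%E <-> exists c : R, forall x, opnorm (f x) <= c.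
Proof.
split=> [fb|[c fc]]; last first.
  apply: (@le_lt_trans _ _ c%:E); last exact: ltry.
  by apply: ge_ereal_sup => _ [x _ <-]; rewrite lee_fin.
exists (fine (cnorm f)) => x.
have fx : ((opnorm (f x))%:E <= cnorm f)%E.
  by apply: ereal_sup_ubound; exists x.
by move: fx fb; case: (cnorm f) => [r| |]//=; rewrite lee_fin.
Qed.

Lemma mx_continuousP (X : topologicalType) m n (f : X -> 'M[R[i]]_(m, n)) :
  continuous f <-> forall i j, continuous (fun x => f x i j).
Proof.
split=> [cf i j x|cf x]; last by apply/mx_cvgP => i j; exact: cf.
by move/mx_cvgP : (cf x); exact.
Qed.

Lemma cstar_zero_subproof : cstar_fun (fun x => 0).
Proof.
split=> /= [n|x U _|x y|].
- have -> : (fun x : T => as_mx n (0 : 'M[R[i]]_(tdim x))) = fun=> 0.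
    by apply/funext => x; exact: as_mx0.
  by move=> x; exact: cvg_cst.
- by rewrite as_mx0 mulmx0 mul0mx.
- by rewrite as_mx0 /dsum_mx block_mx0.
- by apply/cnorm_ltP; exists 0 => x; apply: opnorm_le => // v;
    rewrite mul0mx l2norm0 mul0r.
Qed.

Lemma cstar_one_subproof : cstar_fun (fun x => 1%:M).
Proof.
split=> /= [n|x U uU|x y|].
- have c1 : continuous
    ((fun=> 1%:M) : subspace [set x : T | tdim x = n] -> 'M[R[i]]_n).
    by move=> x; exact: cvg_cst.
  apply: subspace_eq_continuous c1 => x; rewrite inE => /= dx.
  exact/esym/as_mx1.
- by rewrite as_mx1 ?tdim_act// mulmx1 mulmxV// unitarymx_unit.
- by rewrite as_mx1 ?tdim_sum// dsum_mx1.
- by apply/cnorm_ltP; exists 1 => x; exact: opnorm1.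
Qed.

Lemma cstar_add_subproof (f g : mxfield) : cstar_fun f -> cstar_fun g ->
  cstar_fun (fun x => f x + g x).
Proof.
move=> [fc fa fs fb] [gc ga gs gb]; split=> /= [n|x U uU|x y|].
- have -> : (fun x => as_mx n (f x + g x)) =
      (fun x => as_mx n (f x) + as_mx n (g x)).
    by apply/funext => x; exact: as_mxD.
  apply/mx_continuousP => i j; rewrite (_ : (fun x => _) =
    (fun x => as_mx n (f x) i j + as_mx n (g x) i j)); last first.
    by apply/funext => x; rewrite mxE.
  move=> x; apply: cvgD; first by move/mx_continuousP: (fc n); exact.
  by move/mx_continuousP: (gc n); exact.
- by rewrite as_mxD fa// ga// mulmxDr mulmxDl.
- by rewrite as_mxD fs gs dsum_mxD.
- move/cnorm_ltP : fb => [c fb]; move/cnorm_ltP : gb => [d gb].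
  by apply/cnorm_ltP; exists (c + d) => x; rewrite (le_trans (opnormD _ _))// lerD.
Qed.

Lemma cstar_scale_subproof (a : R[i]) (f : mxfield) : cstar_fun f ->
  cstar_fun (fun x => a *: f x).
Proof.
move=> [fc fa fs fb]; split=> /= [n|x U uU|x y|].
- have -> : (fun x => as_mx n (a *: f x)) =
      (fun x => a *: as_mx n (f x)).
    by apply/funext => x; exact: as_mxZ.
  apply/mx_continuousP => i j; rewrite (_ : (fun x => _) =
    (fun x => a * as_mx n (f x) i j)); last first.
    by apply/funext => x; rewrite mxE.
  move=> x; apply: cvgM; first exact: cvg_cst.
  by move/mx_continuousP: (fc n); exact.
- by rewrite as_mxZ fa// -scalemxAr -scalemxAl.
- by rewrite as_mxZ fs dsum_mxZ.
- move/cnorm_ltP : fb => [c fb].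
  apply/cnorm_ltP; exists (Normc.normc a * c) => x.
  by rewrite (le_trans (opnormZ _ _))// ler_wpM2l ?normc_ge0.
Qed.

Lemma cstar_mul_subproof (f g : mxfield) : cstar_fun f -> cstar_fun g ->
  cstar_fun (fun x => f x *m g x).
Proof.
move=> [fc fa fs fb] [gc ga gs gb]; split=> /= [n|x U uU|x y|].
- have -> : (fun x => as_mx n (f x *m g x)) =
      (fun x => as_mx n (f x) *m as_mx n (g x)).
    by apply/funext => x; exact: as_mxM.
  apply/mx_continuousP => i j; rewrite (_ : (fun x => _) =
    (fun x => \sum_k as_mx n (f x) i k * as_mx n (g x) k j)); last first.
    by apply/funext => x; rewrite mxE.
  move=> x; apply: cvg_sum_fin => k; apply: cvgM.
    by move/mx_continuousP: (fc n); exact.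
  by move/mx_continuousP: (gc n); exact.
- by rewrite as_mxM fa// ga// !mulmxA mulmxKV ?unitarymx_unit.
- by rewrite as_mxM fs gs dsum_mxM.
- move/cnorm_ltP : fb => [c fb]; move/cnorm_ltP : gb => [d gb].
  apply/cnorm_ltP; exists (c * d) => x; rewrite (le_trans (opnormM _ _))//.
  by rewrite ler_pM ?opnorm_ge0.
Qed.

Lemma cstar_adj_subproof (f : mxfield) : cstar_fun f ->
  cstar_fun (fun x => (f x)^t*).
Proof.
move=> [fc fa fs fb]; split=> /= [n|x U uU|x y|].
- have -> : (fun x => as_mx n ((f x)^t*)) =
      (fun x => (as_mx n (f x))^t*).
    by apply/funext => x; exact: as_mx_adj.
  apply/mx_continuousP => i j; rewrite (_ : (fun x => _) =
    (fun x => Num.conj (as_mx n (f x) j i))); last first.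
    by apply/funext => x; rewrite !mxE.
  move=> x; have fx := (mx_continuousP _).1 (fc n) j i x.
  exact: (cvg_comp _ _ fx (@conj_continuous R _)).
- rewrite as_mx_adj fa// !invmx_unitary// !trmx_mul !map_mxM/= trmxCK.
  by rewrite mulmxA.
- by rewrite as_mx_adj fs dsum_mx_adj.
- move/cnorm_ltP : fb => [c fb].
  by apply/cnorm_ltP; exists c => x; rewrite (le_trans (opnorm_adj _)).
Qed.

Definition cstar_zero := Cstar cstar_zero_subproof.
Definition cstar_one := Cstar cstar_one_subproof.
Definition cstar_add (f g : cstar) :=
  Cstar (cstar_add_subproof (cstarP f) (cstarP g)).
Definition cstar_scale (a : R[i]) (f : cstar) :=
  Cstar (cstar_scale_subproof a (cstarP f)).
Definition cstar_opp (f : cstar) := cstar_scale (-1) f.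
Definition cstar_mul (f g : cstar) :=
  Cstar (cstar_mul_subproof (cstarP f) (cstarP g)).
Definition cstar_adj (f : cstar) := Cstar (cstar_adj_subproof (cstarP f)).

Let cstar_addA : associative cstar_add.
Proof. by move=> f g h; apply: cstar_eqP => x; exact: addrA. Qed.
Let cstar_addC : commutative cstar_add.
Proof. by move=> f g; apply: cstar_eqP => x; exact: addrC. Qed.
Let cstar_add0 : left_id cstar_zero cstar_add.
Proof. by move=> f; apply: cstar_eqP => x; exact: add0r. Qed.
Let cstar_addN : left_inverse cstar_zero cstar_opp cstar_add.
Proof.
by move=> f; apply: cstar_eqP => x /=; rewrite scaleN1r; exact: addNr.
Qed.

HB.instance Definition _ := GRing.isZmodule.Build cstar
  cstar_addA cstar_addC cstar_add0 cstar_addN.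

Let cstar_mulA : associative cstar_mul.
Proof. by move=> f g h; apply: cstar_eqP => x; exact: mulmxA. Qed.
Let cstar_mul1 : left_id cstar_one cstar_mul.
Proof. by move=> f; apply: cstar_eqP => x; exact: mul1mx. Qed.
Let cstar_mulr1 : right_id cstar_one cstar_mul.
Proof. by move=> f; apply: cstar_eqP => x; exact: mulmx1. Qed.
Let cstar_mulDl : left_distributive cstar_mul +%R.
Proof. by move=> f g h; apply: cstar_eqP => x; exact: mulmxDl. Qed.
Let cstar_mulDr : right_distributive cstar_mul +%R.
Proof. by move=> f g h; apply: cstar_eqP => x; exact: mulmxDr. Qed.

HB.instance Definition _ := GRing.Zmodule_isPzRing.Build cstar
  cstar_mulA cstar_mul1 cstar_mulr1 cstar_mulDl cstar_mulDr.

Let cstar_scaleA a b (f : cstar) :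
  cstar_scale a (cstar_scale b f) = cstar_scale (a * b) f.
Proof. by apply: cstar_eqP => x; exact: scalerA. Qed.
Let cstar_scale1 : left_id 1 cstar_scale.
Proof. by move=> f; apply: cstar_eqP => x; exact: scale1r. Qed.
Let cstar_scaleDr : right_distributive cstar_scale +%R.
Proof. by move=> a f g; apply: cstar_eqP => x; exact: scalerDr. Qed.
Let cstar_scaleDl f : {morph cstar_scale^~ f : a b / a + b}.
Proof. by move=> a b; apply: cstar_eqP => x; exact: scalerDl. Qed.

HB.instance Definition _ := GRing.Zmodule_isLmodule.Build R[i] cstar
  cstar_scaleA cstar_scale1 cstar_scaleDr cstar_scaleDl.

End CstarAlgebra.

Definition unital_star_hom (R : realType) (T S : tower R)
    (Phi : cstar T -> cstar S) : Prop :=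
  [/\ linear Phi, monoid_morphism Phi
    & {morph Phi : f / cstar_adj f}].

(* f \o tau, for tau preserving the dimension *)
Definition pullback (R : realType) (T S : tower R) (tau : S -> T)
    (f : mxfield T) : mxfield S :=
  fun y => as_mx (tdim y) (f (tau y)).

(* Main.v *)
(* Every unital *-representation of C*(T) on C^n with n > 0 is evaluation at
   exactly one point of T_n; the morphism tau then sends y to the point of
   f |-> Phi(f)(y), and its continuity follows from compactness of T_n.

   Many functions: by (mT1)-(mT4) the decomposition of a point into irreducibles
   is unique, and its stabilizer is as small as possible, so that any
   equivariant function on the irreducibles extends to an additive equivariant
   field.  Continuous fields are extended from T_1, ..., T_(n-1) to T_n by an
   equivariant Tietze theorem.  Traces and commutants then separate the points.

   Representations: if every v <> 0 were moved by the image of the ideal of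
   f vanishing at x, for each irreducible x, Cayley-Hamilton would give elements
   of ker pi equal to 1 at any given point, hence, by compactness, an invertible
   element of ker pi.  So ker ev_x kills some v <> 0 for some irreducible x, the
   orbit of v contains a copy of ev_x, and one splits it off. *)

Require Import Defs.
From mathcomp Require Import all_boot all_order all_algebra.
From mathcomp Require Import all_classical all_reals all_analysis.
From mathcomp Require Import complex mxtens spectral ring lra.

Set Implicit Arguments.
Unset Strict Implicit.
Unset Printing Implicit Defensive.

Import Order.TTheory GRing.Theory Num.Theory.
Import numFieldNormedType.Exports.

Local Open Scope classical_set_scope.
Local Open Scope ring_scope.
Local Open Scope sesquilinear_scope.

(** Additivity forces the value of a field at every reducible point, so continuity there cannot be
    arranged by choice. It comes from compactness: the reducible points of dimension n are a finite
    union of continuous images of compact sets of triples (U, a, b), and such images are quotients,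
    so continuity at lower dimensions passes upward. Only the irreducible points of each level leave
    freedom for Tietze.

    Finite height enters three times: a field is bounded once it is bounded on the finitely many
    levels that carry irreducibles; beyond these levels every point is reducible, so extension
    upward stops after finitely many choices; and finitely many elements of ker pi suffice to be
    invertible somewhere over each irreducible.

    Several elements are always combined through sums of g g^*: positivity rules out cancellation,
    so that kernels intersect and traces add. With h(x) = 0 and pi(h) invertible, the characteristic
    polynomial of pi(h), evaluated at h, lies in ker pi but has a nonzero scalar value at x. *)

Section UnitaryMatrices.
Variable R : realType.
Local Notation C := R[i].

(** * Unitary matrices, direct sums and tensor products *)

Lemma unitarymx1 n : (1%:M : 'M[C]_n) \is unitarymx.
Proof. by apply/unitarymxP; rewrite trmx1 map_mx1 mulmx1. Qed.

Lemma mulmx_unitarytc n (U : 'M[C]_n) : U \is unitarymx -> U^t* *m U = 1%:M.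
Proof. by move=> uU; rewrite -invmx_unitary// mulVmx// unitarymx_unit. Qed.

Lemma mulmx_unitaryct n (U : 'M[C]_n) : U \is unitarymx -> U *m U^t* = 1%:M.
Proof. by move/unitarymxP. Qed.

Lemma unitary_tc n (U : 'M[C]_n) : U \is unitarymx -> U^t* \is unitarymx.
Proof. by rewrite trmxC_unitary. Qed.

Lemma unitary_mul n (U V : 'M[C]_n) :
  U \is unitarymx -> V \is unitarymx -> U *m V \is unitarymx.
Proof.
move=> /unitarymxP uU /unitarymxP uV; apply/unitarymxP.
by rewrite trmx_mul map_mxM mulmxA -(mulmxA U) uV mulmx1.
Qed.

Lemma dsum_mx_unitary n m (U : 'M[C]_n) (V : 'M[C]_m) :
  U \is unitarymx -> V \is unitarymx -> dsum_mx U V \is unitarymx.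
Proof.
move=> uU uV; apply/unitarymxP.
by rewrite -dsum_mx_adj -dsum_mxM !mulmx_unitaryct// dsum_mx1.
Qed.

Lemma trmxC_mul m n p (A : 'M[C]_(m, n)) (B : 'M[C]_(n, p)) :
  (A *m B)^t* = B^t* *m A^t*.
Proof. by rewrite trmx_mul map_mxM. Qed.

Lemma trmxC1 n : ((1%:M : 'M[C]_n))^t* = 1%:M.
Proof. by rewrite trmx1 map_mx1. Qed.

(** The action U.A of a unitary [U], written with the adjoint instead of the inverse, so that it is
    visibly continuous in both arguments. *)
Definition conj_mx n (U A : 'M[C]_n) : 'M[C]_n := U *m A *m U^t*.

Lemma conj_mx1 n (A : 'M[C]_n) : conj_mx 1%:M A = A.
Proof. by rewrite /conj_mx trmxC1 mulmx1 mul1mx. Qed.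

Lemma conj_mxM n (U V A : 'M[C]_n) :
  conj_mx (U *m V) A = conj_mx U (conj_mx V A).
Proof. by rewrite /conj_mx trmxC_mul !mulmxA. Qed.

Lemma conj_mxK n (U A : 'M[C]_n) : U \is unitarymx ->
  conj_mx (U^t* ) (conj_mx U A) = A.
Proof. by move=> uU; rewrite -conj_mxM mulmx_unitarytc// conj_mx1. Qed.

Lemma conj_mxKV n (U A : 'M[C]_n) : U \is unitarymx ->
  conj_mx U (conj_mx (U^t* ) A) = A.
Proof. by move=> uU; rewrite -conj_mxM mulmx_unitaryct// conj_mx1. Qed.

Lemma conj_mx_mul n (U A B : 'M[C]_n) : U \is unitarymx ->
  conj_mx U (A *m B) = conj_mx U A *m conj_mx U B.
Proof.
move=> uU.
by rewrite /conj_mx -!mulmxA (mulmxA (U^t* ) U) (mulmx_unitarytc uU) mul1mx.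
Qed.

Lemma conj_mx_dsum n m (U A : 'M[C]_n) (V B : 'M[C]_m) :
  conj_mx (dsum_mx U V) (dsum_mx A B) = dsum_mx (conj_mx U A) (conj_mx V B).
Proof. by rewrite /conj_mx -dsum_mx_adj -!dsum_mxM. Qed.

Lemma conj_mx_commute n (U A : 'M[C]_n) : U \is unitarymx ->
  conj_mx U A = A <-> U *m A = A *m U.
Proof.
move=> uU; split=> [UA|UA].
  by rewrite -[in RHS]UA /conj_mx -!mulmxA mulmx_unitarytc// mulmx1.
by rewrite /conj_mx UA -mulmxA mulmx_unitaryct// mulmx1.
Qed.

Lemma dsum_mxA n m k (A : 'M[C]_n) (B : 'M[C]_m) (D : 'M[C]_k) :
  dsum_mx A (dsum_mx B D) =
  castmx (esym (addnA n m k), esym (addnA n m k)) (dsum_mx (dsum_mx A B) D).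
Proof.
rewrite /dsum_mx; have := @block_mxA _ n m k n m k A 0 0 0 B 0 0 0 D.
by rewrite /= !row_mx0 !col_mx0.
Qed.

Lemma conj_castmx m n (e : m = n) (S : 'M[C]_(m, n)) (D : 'M[C]_n) :
  conj_mx (castmx (e, erefl) S) D = castmx (e, e) (S *m D *m S^t* ).
Proof. by subst m; rewrite !castmx_id. Qed.

Let swap0 p q : 'M[C]_(q + p, p + q) := block_mx 0 1%:M 1%:M 0.

Let conj_swap0 p q (A : 'M[C]_p) (B : 'M[C]_q) :
  swap0 p q *m dsum_mx A B *m (swap0 p q)^t* = dsum_mx B A.
Proof.
rewrite /swap0 /dsum_mx tr_block_mx map_block_mx !trmx0 !trmx1 !map_mx0
  !map_mx1.
by rewrite !mulmx_block ?(mulmx0, mul0mx, mul1mx, mulmx1, addr0, add0r).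
Qed.

Lemma conj_swap_mx p q (A : 'M[C]_p) (B : 'M[C]_q) :
  conj_mx (swap_mx R p q) (dsum_mx A B) =
  castmx (addnC q p, addnC q p) (dsum_mx B A).
Proof. by rewrite /swap_mx conj_castmx conj_swap0. Qed.

Lemma swap_mx_unitary p q : swap_mx R p q \is unitarymx.
Proof.
apply/unitarymxP; have := @conj_swap_mx p q 1%:M 1%:M.
rewrite !dsum_mx1 /conj_mx mulmx1 => ->.
by move: (addnC q p) => e; move: (e); rewrite e => e'; rewrite castmx_id.
Qed.

(** Since [k.+1 * d] computes to [d + k * d], both sides have the same size without a cast. An index
    pair (a, b) falls in the first block exactly when a = 0. *)
Lemma tens1mxS k d (B : 'M[C]_d) :
  dsum_mx B ((1%:M : 'M[C]_k) *t B) = (1%:M : 'M[C]_k.+1) *t B.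
Proof.
have ix (a : 'I_k.+1) (b : 'I_d) :
    (mxtens_index (a, b) : 'I_(d + k * d)) =
    if unlift ord0 a is Some a' then rshift d (mxtens_index (a', b))
    else lshift (k * d) b.
  case: unliftP => [a' ->|->]; apply: val_inj => //=.
  by rewrite /bump leq0n add1n mulSn addnA.
apply/matrixP => i j.
case: (mxtens_indexP (i : 'I_(k.+1 * d))) => a b.
case: (mxtens_indexP (j : 'I_(k.+1 * d))) => a2 b2.
apply: etrans (esym (tensmxE _ _ _ _ _ _)); rewrite ix ix /dsum_mx [in RHS]mxE.
case: unliftP => [a' ->|->]; case: unliftP => [a2' ->|->];
  rewrite ?block_mxEul ?block_mxEur ?block_mxEdl ?block_mxEdr ?mxE.
- by rewrite !mxtens_indexK /= (inj_eq lift_inj).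
- by rewrite mul0r.
- by rewrite mul0r.
- by rewrite mul1r.
Qed.

Lemma tens1mx1 m n : (1%:M : 'M[C]_m) *t (1%:M : 'M[C]_n) = 1%:M.
Proof.
apply/matrixP => i j.
case: (mxtens_indexP i) => a b; case: (mxtens_indexP j) => a2 b2.
by rewrite tensmxE !mxE (inj_eq (can_inj (@mxtens_indexK m n))) -natrM mulnb.
Qed.

End UnitaryMatrices.

(** * Equivalence, order and irreducible points in a tower *)

Section TowerAction.
Variables (R : realType) (T : tower R).
Local Notation C := R[i].
Implicit Types (x y z a b p : T).

(** The tower axioms speak of matrices of size [tdim x]. The restatements here use a variable size
    with an equation, so that one matrix can act on several points of the same dimension without
    casts. *)
Lemma tdim_tact n x (U : 'M[C]_n) : tdim x = n -> U \is unitarymx ->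
  tdim (tact U x) = n.
Proof. by move=> dx; subst n; exact: tdim_act. Qed.

Lemma tact_id n x : tdim x = n -> tact (1%:M : 'M[C]_n) x = x.
Proof. by move=> <-; exact: tact1. Qed.

Lemma tact_comp n x (U V : 'M[C]_n) : tdim x = n ->
  U \is unitarymx -> V \is unitarymx -> tact (U *m V) x = tact U (tact V x).
Proof. by move=> dx; subst n; exact: tactM. Qed.

Lemma tactK n x (U : 'M[C]_n) : tdim x = n -> U \is unitarymx ->
  tact (U^t* ) (tact U x) = x.
Proof.
by move=> dx uU; rewrite -tact_comp ?unitary_tc// mulmx_unitarytc// tact_id.
Qed.

Lemma tact_dsum n m x y (U : 'M[C]_n) (V : 'M[C]_m) :
  tdim x = n -> tdim y = m -> U \is unitarymx -> V \is unitarymx ->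
  tact (dsum_mx U V) (tsum x y) = tsum (tact U x) (tact V y).
Proof. by move=> dx dy; subst n m; exact: tact_sum. Qed.

Lemma tact_swap_mx n m x y : tdim x = n -> tdim y = m ->
  tact (swap_mx R n m) (tsum x y) = tsum y x.
Proof. by move=> dx dy; subst n m; exact: tact_swap. Qed.

Lemma tequivP n x y : tdim x = n ->
  tequiv x y <-> exists2 U : 'M[C]_n, U \is unitarymx & tact U x = y.
Proof. by move=> <-. Qed.

Lemma tequiv_refl x : tequiv x x.
Proof. by exists 1%:M; [exact: unitarymx1|exact: tact1]. Qed.

Lemma tequiv_act n x (U : 'M[C]_n) : tdim x = n -> U \is unitarymx ->
  tequiv x (tact U x).
Proof. by move=> dx uU; subst n; exists U. Qed.

Lemma tequiv_dim x y : tequiv x y -> tdim x = tdim y.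
Proof. by move=> [U uU <-]; rewrite tdim_act. Qed.

Lemma tequiv_sym x y : tequiv x y -> tequiv y x.
Proof.
move=> xy; have dxy := tequiv_dim xy; case: xy => U uU Uxy.
apply/(tequivP _ (esym dxy)); exists (U^t* ); first exact: unitary_tc.
by rewrite -Uxy tactK.
Qed.

Lemma tequiv_trans y x z : tequiv x y -> tequiv y z -> tequiv x z.
Proof.
move=> xy yz; have dxy := tequiv_dim xy; case: xy => U uU Uxy.
move/(tequivP _ (esym dxy)) : yz => [V uV <-].
exists (V *m U); first exact: unitary_mul.
by rewrite (tact_comp erefl uV uU) Uxy.
Qed.

Lemma tequiv_sum x x' y y' :
  tequiv x x' -> tequiv y y' -> tequiv (tsum x y) (tsum x' y').
Proof.
move=> [U uU <-] [V uV <-]; rewrite -tact_sum//.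
by apply: tequiv_act; [exact: tdim_sum|exact: dsum_mx_unitary].
Qed.

Lemma tequiv_sumC x y : tequiv (tsum x y) (tsum y x).
Proof.
rewrite -[X in tequiv _ X]tact_swap.
by apply: tequiv_act; [exact: tdim_sum|exact: swap_mx_unitary].
Qed.

Lemma reducibleP x : reducible x <-> exists a b, tequiv x (tsum a b).
Proof.
split=> [[V [a [b [uV Vx]]]]|[a [b [V uV Vx]]]].
  by exists a, b; exists V.
by exists V, a, b.
Qed.

Lemma reducible_equiv x y : tequiv x y -> reducible x -> reducible y.
Proof.
move=> xy /reducibleP[a [b xab]]; apply/reducibleP; exists a, b.
exact: tequiv_trans (tequiv_sym xy) xab.
Qed.

Lemma tprec_refl x : tprec x x.
Proof. by left; exact: tequiv_refl. Qed.

Lemma tprec_suml x y : tprec x (tsum x y).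
Proof. by right; exists x, y; split; exact: tequiv_refl. Qed.

Lemma tprecP x y : tprec x y <-> tequiv y x \/ exists b, tequiv y (tsum x b).
Proof.
split=> [[xy|[a [b [xa yab]]]]|[yx|[b yb]]].
- by left; exact: tequiv_sym.
- right; exists b; apply: tequiv_trans yab _; apply: tequiv_sum.
    exact: tequiv_sym.
  exact: tequiv_refl.
- by left; exact: tequiv_sym.
- by right; exists x, b; split; [exact: tequiv_refl|].
Qed.

Lemma tprec_equiv x x' y y' :
  tequiv x x' -> tequiv y y' -> tprec x y -> tprec x' y'.
Proof.
move=> xx' yy' [xy|[a [b [xa yab]]]].
  left; apply: tequiv_trans (tequiv_sym xx') _; exact: tequiv_trans xy yy'.
right; exists a, b; split; first exact: tequiv_trans (tequiv_sym xx') xa.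
exact: tequiv_trans (tequiv_sym yy') yab.
Qed.

Lemma tprec_trans y x z : tprec x y -> tprec y z -> tprec x z.
Proof.
move=> /tprecP[yx|[b yb]] /tprecP[zy|[c zc]]; apply/tprecP.
- by left; exact: tequiv_trans zy yx.
- right; exists c; apply: tequiv_trans zc _.
  by apply: tequiv_sum => //; exact: tequiv_refl.
- by right; exists b; exact: tequiv_trans zy yb.
- right; exists (tsum b c); apply: tequiv_trans zc _; rewrite tsumA.
  by apply: tequiv_sum => //; exact: tequiv_refl.
Qed.

Lemma tprec_sumr x y : tprec y (tsum x y).
Proof.
by apply/tprecP; right; exists x; exact: tequiv_sumC.
Qed.

Lemma irreducible_prec p a : irreducible p -> tprec a p -> tequiv p a.
Proof.
move=> ip /tprecP[//|[b pab]]; exfalso; apply: ip; apply/reducibleP.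
by exists a, b.
Qed.

(** Anything below an irreducible point is equivalent to it, so a common part of [p] and [x] would
    be [p] itself. *)
Lemma tdisjoint_irr p x : irreducible p -> ~ tprec p x -> tdisjoint p x.
Proof.
move=> ip npx [a [ap ax]]; apply: npx; apply: tprec_equiv ax.
  exact/tequiv_sym/irreducible_prec.
exact: tequiv_refl.
Qed.

Lemma tdisjoint_sym x y : tdisjoint x y -> tdisjoint y x.
Proof. by move=> xy [a [ax ay]]; apply: xy; exists a. Qed.

(** Irreducibles behave like primes: otherwise [p] would be disjoint from both summands, hence by
    (mT1) from the sum, although [p] itself is a common part. *)
Lemma irreducible_prec_sum p x y : m_tower T -> irreducible p ->
  tprec p (tsum x y) -> tprec p x \/ tprec p y.
Proof.
move=> mT ip pxy; apply: contrapT => /not_orP[npx npy].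
apply: (m_tower_disjoint_sum mT (tdisjoint_irr ip npx) (tdisjoint_irr ip npy)).
by exists p; split=> //; exact: tprec_refl.
Qed.

Lemma exists_irreducible_prec x : exists2 p, irreducible p & tprec p x.
Proof.
have [n] := ubnP (tdim x); elim: n x => // n IHn x xn.
have [/reducibleP[a [b xab]]|ix] := pselect (reducible x); last first.
  by exists x => //; exact: tprec_refl.
have [|p ip pa] := IHn a.
  move: xn; rewrite (tequiv_dim xab) tdim_sum ltnS; apply: leq_trans.
  by rewrite -[X in (X < _)%N]addn0 ltn_add2l tdim_gt0.
exists p => //; apply: tprec_trans pa _; apply/tprecP; right; by exists b.
Qed.

Lemma tequiv_dim_sum x a b : tequiv x (tsum a b) ->
  (tdim a < tdim x)%N /\ (tdim b < tdim x)%N.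
Proof.
move=> xab; rewrite (tequiv_dim xab) tdim_sum; split.
  by rewrite -[X in (X < _)%N]addn0 ltn_add2l tdim_gt0.
by rewrite -[X in (X < _)%N]add0n ltn_add2r tdim_gt0.
Qed.

(** Both summands of a reducible point have smaller dimension, because dimensions are positive;
    hence every point is built from irreducibles by sums and unitaries. *)
Lemma tower_ind (P : T -> Prop) :
  (forall x, irreducible x -> P x) ->
  (forall n x (U : 'M[C]_n), tdim x = n -> U \is unitarymx ->
    P x -> P (tact U x)) ->
  (forall a b, P a -> P b -> P (tsum a b)) ->
  forall x, P x.
Proof.
move=> Pirr Pact Psum x.
have [n] := ubnP (tdim x); elim: n x => // n IHn x xn.
have [/reducibleP[a [b xab]]|ix] := pselect (reducible x); last exact: Pirr.
have [ax bx] := tequiv_dim_sum xab.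
have [U uU <-] := tequiv_sym xab.
apply: (Pact _ _ _ erefl uU); apply: Psum; apply: IHn.
  exact: leq_trans ax xn.
exact: leq_trans bx xn.
Qed.

End TowerAction.

(* The values of F n at the points of dimension other than n are irrelevant. *)
Record equivariant_field (R : realType) (T : tower R)
    (F : forall n : nat, T -> 'M[R[i]]_n) : Prop := {
  field_act : forall n x (U : 'M[R[i]]_n), tdim x = n -> U \is unitarymx ->
    F n (tact U x) = conj_mx U (F n x);
  field_sum : forall n m x y, tdim x = n -> tdim y = m ->
    F (n + m)%N (tsum x y) = dsum_mx (F n x) (F m y)
}.

(** * Extending an equivariant function from the irreducible points to all points *)

Section PointedMatrices.
Variables (R : realType) (T : tower R).
Local Notation C := R[i].
Implicit Types (x y z a b p : T).

(* The size n is kept as data, so that two sums whose sizes are only provably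
   equal can still be compared by Leibniz equality, as in pm_sumA. *)
Definition pmatrix := {n : nat & (T * 'M[C]_n)%type}.
Definition mkpm n x (A : 'M[C]_n) : pmatrix := existT _ n (x, A).
Definition pm_pt (u : pmatrix) : T := (tagged u).1.
Definition pm_mx (u : pmatrix) : 'M[C]_(tag u) := (tagged u).2.
Definition pm_act (u : pmatrix) (U : 'M[C]_(tag u)) : pmatrix :=
  mkpm (tact U (pm_pt u)) (conj_mx U (pm_mx u)).
Definition pm_sum (u v : pmatrix) : pmatrix :=
  mkpm (tsum (pm_pt u) (pm_pt v)) (dsum_mx (pm_mx u) (pm_mx v)).
Definition pm_wf (u : pmatrix) := tdim (pm_pt u) = tag u.
Definition pm_equiv (u v : pmatrix) : Prop :=
  exists2 U : 'M[C]_(tag u), U \is unitarymx & v = pm_act U.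

Lemma mkpm_cast n m (e : n = m) x (A : 'M[C]_n) :
  mkpm x A = mkpm x (castmx (e, e) A).
Proof. by subst m; rewrite castmx_id. Qed.

Lemma mkpm_inj n x (A B : 'M[C]_n) : mkpm x A = mkpm x B -> A = B.
Proof. by move/eqP; rewrite eq_Tagged => /eqP[]. Qed.

Lemma pm_sumA u v w : pm_sum u (pm_sum v w) = pm_sum (pm_sum u v) w.
Proof.
rewrite /pm_sum /= /pm_pt /pm_mx /= tsumA dsum_mxA.
by rewrite -mkpm_cast.
Qed.

Lemma pm_equiv_refl u : pm_wf u -> pm_equiv u u.
Proof.
case: u => n [x A] dx; exists 1%:M; first exact: unitarymx1.
by rewrite /pm_act conj_mx1 tact_id.
Qed.

Lemma pm_equiv_sym u v : pm_wf u -> pm_equiv u v -> pm_equiv v u.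
Proof.
case: u => n [x A] dx [/= U uU ->]; exists (U^t* );
  first exact: (unitary_tc uU).
by rewrite /pm_act /pm_mx /pm_pt/= (tactK dx uU) (conj_mxK _ uU).
Qed.

Lemma pm_equiv_trans v u w : pm_wf u ->
  pm_equiv u v -> pm_equiv v w -> pm_equiv u w.
Proof.
case: u => n [x A] dx [/= U uU ->] [/= V uV ->].
exists (V *m U); first exact: (unitary_mul uV uU).
by rewrite /pm_act /pm_mx /pm_pt/= (tact_comp dx uV uU) conj_mxM.
Qed.

Lemma pm_act_wf u (U : 'M[C]_(tag u)) : pm_wf u -> U \is unitarymx ->
  pm_wf (pm_act U).
Proof. by case: u U => n [x A] U dx uU; exact: (tdim_tact dx uU). Qed.

Lemma pm_sum_wf u v : pm_wf u -> pm_wf v -> pm_wf (pm_sum u v).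
Proof. by rewrite /pm_wf /= => <- <-; exact: tdim_sum. Qed.

Lemma pm_equiv_pt u v : pm_wf u -> pm_equiv u v -> tequiv (pm_pt u) (pm_pt v).
Proof. by move=> wu [U uU ->]; exact: (tequiv_act wu uU). Qed.

Lemma pm_equiv_sum u u' v v' : pm_wf u -> pm_wf v ->
  pm_equiv u u' -> pm_equiv v v' -> pm_equiv (pm_sum u v) (pm_sum u' v').
Proof.
case: u => n [x A] /= wu; case: v => m [y B] /= wv [/= U uU ->] [/= V uV ->].
exists (dsum_mx U V); first exact: (dsum_mx_unitary uU uV).
by rewrite /pm_act /pm_mx /pm_pt /= (tact_dsum wu wv uU uV) conj_mx_dsum.
Qed.

Lemma pm_equiv_sumC u v : pm_wf u -> pm_wf v ->
  pm_equiv (pm_sum u v) (pm_sum v u).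
Proof.
case: u => n [x A] /= wu; case: v => m [y B] /= wv.
exists (swap_mx R n m); first exact: swap_mx_unitary.
rewrite /pm_act /pm_mx /pm_pt /= (tact_swap_mx wu wv) conj_swap_mx.
exact: mkpm_cast.
Qed.

(** Exactly what makes the assignment of U.A to U.x well defined along the orbit of x. *)
Definition pm_stable (u : pmatrix) := forall U : 'M[C]_(tag u),
  stab (tag u) (pm_pt u) U -> conj_mx U (pm_mx u) = pm_mx u.

Lemma pm_stable_equiv u v : pm_wf u -> pm_equiv u v ->
  pm_stable u -> pm_stable v.
Proof.
case: u => n [x A] wu [/= W uW ->] su; rewrite /pm_stable/= => U [uU].
rewrite /pm_pt /pm_mx /= => UWx.
have uWUW := unitary_mul (unitary_tc uW) (unitary_mul uU uW).
have E : conj_mx (W^t* *m (U *m W)) A = A.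
  apply: su; split; first exact: uWUW.
  rewrite /= (tact_comp wu (unitary_tc uW) (unitary_mul uU uW)).
  by rewrite (tact_comp wu uU uW) UWx (tactK wu uW).
by rewrite -[in RHS]E -!conj_mxM !mulmxA (mulmx_unitaryct uW) mul1mx.
Qed.

Variable h : forall n, T -> 'M[C]_n.
Hypothesis h_act : forall n p (U : 'M[C]_n), irreducible p -> tdim p = n ->
  U \is unitarymx -> h n (tact U p) = conj_mx U (h n p).

Definition pm_irr p : pmatrix := mkpm p (h (tdim p) p).

Lemma pm_irr_wf p : pm_wf (pm_irr p).
Proof. by []. Qed.

(** The graph of the desired field: all pairs that equivariance and additivity force from the values
    of [h] at irreducibles. It has to be shown total ([generated_exists]) and single-valued
    ([generated_functional]). *)
Inductive generated : pmatrix -> Prop :=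
| generated_irr p : irreducible p -> generated (pm_irr p)
| generated_act u (U : 'M[C]_(tag u)) : U \is unitarymx ->
    generated u -> generated (pm_act U)
| generated_sum u v : generated u -> generated v -> generated (pm_sum u v).

Lemma generated_wf u : generated u -> pm_wf u.
Proof.
elim=> {u} [//|u U uU _ wu|u v _ wu _ wv]; first exact: (pm_act_wf wu uU).
exact: pm_sum_wf.
Qed.
Local Hint Resolve generated_wf pm_irr_wf : core.

Lemma generated_exists x : exists A : 'M[C]_(tdim x), generated (mkpm x A).
Proof.
suff : exists2 u, generated u & pm_pt u = x.
  move=> [[n [y A]] gu <-]; have /= wu := generated_wf gu.
  by exists (castmx (esym wu, esym wu) A); rewrite -mkpm_cast.
elim/tower_ind : x => [p ip|n x U dx uU [u gu ux]|a b [u gu <-] [v gv <-]].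
- by exists (pm_irr p) => //; exact: generated_irr.
- case: u gu ux => k [z B] gu; rewrite /pm_pt /= => zx.
  have e : k = n by rewrite -dx -zx; exact/esym/(generated_wf gu).
  subst k; exists (@pm_act (existT _ n (z, B)) U); first exact: generated_act.
  by rewrite /pm_act /pm_pt /= zx.
- by exists (pm_sum u v) => //; exact: generated_sum.
Qed.

Lemma pm_irr_equiv p q : irreducible p -> tequiv p q ->
  pm_equiv (pm_irr p) (pm_irr q).
Proof.
move=> ip pq; have dpq := tequiv_dim pq; case: pq => U uU Upq.
exists U => //; rewrite /pm_act /pm_irr /pm_mx /pm_pt/=.
by rewrite -h_act// Upq dpq.
Qed.

Hypothesis mT : m_tower T.

(** By induction on the derivation of [u]: primeness of [p] tells in which summand to continue, and
    associativity and commutativity bring the copy of [p], with its prescribed matrix, to the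
    front. *)
Lemma generated_extract u p : generated u -> irreducible p ->
  tprec p (pm_pt u) -> pm_equiv (pm_irr p) u \/
  exists2 v, generated v & pm_equiv (pm_sum (pm_irr p) v) u.
Proof.
move=> gu ip; elim: gu => {u} [q iq pq|u U uU gu IH pu|u v gu IHu gv IHv puv].
- by left; apply: pm_irr_equiv => //; exact/tequiv_sym/irreducible_prec.
- have uact : pm_equiv u (pm_act U) by exists U.
  have [|pmu|[v gv pvu]] := IH.
  + apply: tprec_equiv pu; first exact: tequiv_refl.
    exact: tequiv_sym (pm_equiv_pt (generated_wf gu) uact).
  + by left; exact: pm_equiv_trans uact.
  + right; exists v => //; apply: pm_equiv_trans pvu uact.
    by apply: pm_sum_wf => //; exact: generated_wf.
- have wu := generated_wf gu; have wv := generated_wf gv.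
  right; have [/IHu[pu|[w gw pwu]]|/IHv[pv|[w gw pwv]]] :=
    irreducible_prec_sum mT ip puv.
  + exists v => //; apply: pm_equiv_sum => //; exact: pm_equiv_refl.
  + have ww := generated_wf gw.
    exists (pm_sum w v); first exact: generated_sum.
    rewrite pm_sumA; apply: pm_equiv_sum => //; first exact: pm_sum_wf.
    exact: pm_equiv_refl.
  + exists u => //; apply: (pm_equiv_trans _ (pm_equiv_sumC _ _)) => //.
      exact: pm_sum_wf.
    apply: pm_equiv_sum => //; exact: pm_equiv_refl.
  + have ww := generated_wf gw.
    exists (pm_sum w u); first exact: generated_sum.
    rewrite pm_sumA.
    apply: (pm_equiv_trans (v := pm_sum v u)); first by do 2?apply: pm_sum_wf.
      apply: pm_equiv_sum => //; first exact: pm_sum_wf.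
      exact: pm_equiv_refl.
    exact: pm_equiv_sumC.
Qed.

(** Uniqueness of the decomposition into irreducibles, with matrices carried along. The same
    irreducible is split off from both sides and cancelled by (mT2), and the remainders are smaller;
    the mixed cases, where only one side is exhausted, contradict the equality of dimensions. *)
Lemma generated_conf u v : generated u -> generated v ->
  tequiv (pm_pt u) (pm_pt v) -> pm_equiv u v.
Proof.
have [n] := ubnP (tag u); elim: n u v => // n IHn u v un gu gv uv.
have [p ip pu] := exists_irreducible_prec (pm_pt u).
have pv : tprec p (pm_pt v) by apply: tprec_equiv pu => //; exact: tequiv_refl.
have wu := generated_wf gu; have wv := generated_wf gv.
have duv := tequiv_dim uv.
have dimD w w2 : generated w -> pm_equiv (pm_sum (pm_irr p) w) w2 ->
    tdim (pm_pt w2) = (tdim p + tag w)%N /\ (0 < tag w)%N.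
  move=> gw pwz; have ww := generated_wf gw; split; last first.
    by rewrite -[X in (_ < X)%N]ww tdim_gt0.
  have := pm_equiv_pt (pm_sum_wf (pm_irr_wf p) ww) pwz.
  by move/tequiv_dim => <-; exact: (pm_sum_wf (pm_irr_wf p) ww).
have dim1 w : pm_equiv (pm_irr p) w -> tdim (pm_pt w) = tdim p.
  by move/(pm_equiv_pt (pm_irr_wf p))/tequiv_dim.
have [pu1|[u' gu' pu1]] := generated_extract gu ip pu;
  have [pv1|[v' gv' pv1]] := generated_extract gv ip pv.
- apply: pm_equiv_trans pv1 => //.
  exact: pm_equiv_sym.
- have [d1 d2] := dimD _ _ gv' pv1; have d3 := dim1 _ pu1.
  by move: d2; rewrite -(ltn_add2l (tdim p)) -d1 -duv d3 addn0 ltnn.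
- have [d1 d2] := dimD _ _ gu' pu1; have d3 := dim1 _ pv1.
  by move: d2; rewrite -(ltn_add2l (tdim p)) -d1 duv d3 addn0 ltnn.
- have wu' := generated_wf gu'; have wv' := generated_wf gv'.
  have wpu' := pm_sum_wf (pm_irr_wf p) wu'.
  have wpv' := pm_sum_wf (pm_irr_wf p) wv'.
  have uv' : pm_equiv u' v'.
    apply: IHn => //.
      rewrite ltnS -[X in (X <= _)%N]wu (dimD _ _ gu' pu1).1 in un.
      apply: leq_trans un.
      by rewrite -[X in (X < _)%N]add0n ltn_add2r tdim_gt0.
    apply: (m_tower_cancel mT (z := p)).
    apply: tequiv_trans (pm_equiv_pt wpu' pu1) _.
    apply: tequiv_trans uv _; apply: tequiv_sym.
    exact: (pm_equiv_pt wpv' pv1).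
  apply: (pm_equiv_trans wu (pm_equiv_sym wpu' pu1)).
  apply: (pm_equiv_trans wpu' _ pv1).
  by apply: pm_equiv_sum => //; exact: pm_equiv_refl.
Qed.

Lemma tdisjoint_nfold k p x : tdisjoint p x -> tdisjoint (nfold k p) x.
Proof.
move=> px; rewrite /nfold; elim: k.-1 => //= m IHm.
apply/tdisjoint_sym; apply: (m_tower_disjoint_sum mT); exact: tdisjoint_sym.
Qed.

(** Collects all copies of [p]: their sum is governed by (mT4), and (mT3) applies to the whole
    because the rest is disjoint from [p]. *)
Lemma irreducible_decomp p x : irreducible p -> tprec p x ->
  exists2 k, (0 < k)%N & tequiv x (nfold k p) \/
    exists2 y, tdisjoint p y & tequiv x (tsum (nfold k p) y).
Proof.
move=> ip; have [n] := ubnP (tdim x); elim: n x => // n IHn x xn.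
move=> /tprecP[xp|[y xpy]]; first by exists 1%N => //; left.
have [py|npy] := pselect (tprec p y); last first.
  by exists 1%N => //; right; exists y => //; exact: tdisjoint_irr.
have [|[//|k] _ [yk|[z pz yz]]] := IHn y _ py.
- exact: leq_trans (tequiv_dim_sum xpy).2 xn.
- exists k.+2 => //; left; apply: tequiv_trans xpy _.
  by apply: tequiv_sum => //; exact: tequiv_refl.
- exists k.+2 => //; right; exists z => //; apply: tequiv_trans xpy _.
  rewrite /nfold /= -tsumA; apply: tequiv_sum => //; exact: tequiv_refl.
Qed.

Definition pm_nfold k p : pmatrix :=
  @mkpm (k * tdim p) (nfold k p) ((1%:M : 'M[C]_k) *t h (tdim p) p).

Lemma pm_nfold_generated k p : irreducible p -> (0 < k)%N ->
  generated (pm_nfold k p).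
Proof.
move=> ip; case: k => // k _; elim: k => [|k IHk].
  rewrite /pm_nfold tens_scalar1mx -mkpm_cast; exact: generated_irr.
have := generated_sum (generated_irr ip) IHk.
by rewrite /pm_sum /pm_mx /= (tens1mxS k.+1).
Qed.

(** By (mT4) the stabilizer consists of matrices [W *t 1], and these commute with every [1 *t A]. *)
Lemma pm_nfold_stable k p : irreducible p -> (0 < k)%N ->
  pm_stable (pm_nfold k p).
Proof.
move=> ip k0; rewrite /pm_stable /pm_pt /pm_mx /=.
rewrite (m_tower_stab_nfold mT ip k0) => U [W uW <-{U}].
have uW1 : (W *t (1%:M : 'M[C]_(tdim p))) \is unitarymx.
  apply/unitarymxP; rewrite trmx_tens map_mxT tensmx_mul.
  by rewrite trmx1 map_mx1 (mulmx_unitaryct uW) mul1mx tens1mx1.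
apply/(conj_mx_commute _ uW1).
by rewrite !tensmx_mul !mul1mx !mulmx1.
Qed.

Lemma pm_stable_sum u v : pm_wf u -> pm_wf v ->
  tdisjoint (pm_pt u) (pm_pt v) ->
  pm_stable u -> pm_stable v -> pm_stable (pm_sum u v).
Proof.
case: u => n [x A] /= wu; case: v => m [y B] /= wv; rewrite /pm_pt /= => xy.
have {wu} dx : tdim x = n by []. have {wv} dy : tdim y = m by [].
subst n m; rewrite /pm_stable /pm_mx /pm_pt /= => sA sB.
rewrite (m_tower_stab_sum mT xy) => U [U1 U1s [V1 V1s <-{U}]].
by rewrite conj_mx_dsum sA// sB.
Qed.

(** Stability is invariant under [pm_equiv], so by [generated_conf] it may be checked on one
    convenient pair: a multiple of an irreducible [p], possibly plus a rest disjoint from it and of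
    smaller dimension. *)
Lemma generated_stable u : generated u -> pm_stable u.
Proof.
have [n] := ubnP (tag u); elim: n u => // n IHn u un gu.
have wu := generated_wf gu.
have [p ip pu] := exists_irreducible_prec (pm_pt u).
have [k k0 [uk|[y py uky]]] := irreducible_decomp ip pu.
  have gk := pm_nfold_generated ip k0; have wk := generated_wf gk.
  apply: (pm_stable_equiv wk _ (pm_nfold_stable ip k0)).
  exact: generated_conf gk gu (tequiv_sym uk).
have gk := pm_nfold_generated ip k0; have wk := generated_wf gk.
have [A gA] := generated_exists y; have wA := generated_wf gA.
have gkA := generated_sum gk gA; have wkA := generated_wf gkA.
apply: (pm_stable_equiv wkA (generated_conf gkA gu (tequiv_sym uky))).
apply: pm_stable_sum => //.
- exact: tdisjoint_nfold.
- exact: pm_nfold_stable.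
- apply: IHn => //=; rewrite ltnS -[X in (X <= _)%N]wu in un.
  exact: leq_trans (tequiv_dim_sum uky).2 un.
Qed.

(** By [generated_conf] some unitary fixing [x] carries [A] to [B], and by stability such a unitary
    fixes [A]. *)
Lemma generated_functional n x (A B : 'M[C]_n) :
  generated (mkpm x A) -> generated (mkpm x B) -> A = B.
Proof.
move=> gA gB; have wA := generated_wf gA.
have [U uU E] := generated_conf gA gB (tequiv_refl x).
move: E; rewrite /pm_act /pm_pt /pm_mx /= => E.
have Ux : tact U x = x by have := congr1 pm_pt E.
by move: E; rewrite Ux (generated_stable gA) => [/mkpm_inj|].
Qed.

Lemma field_of_irreducibles : exists F : forall n, T -> 'M[C]_n,
  equivariant_field F /\
  forall p, irreducible p -> F (tdim p) p = h (tdim p) p.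
Proof.
pose A x := projT1 (cid (generated_exists x)).
have gA x : generated (mkpm x (A x)) := projT2 (cid (generated_exists x)).
pose F n x := as_mx n (A x); exists F.
have gF n x : tdim x = n -> generated (mkpm x (F n x)).
  by move=> dx; subst n; rewrite /F as_mx_id.
split; first split.
- move=> n x U dx uU; apply: generated_functional (gF _ _ _) _.
    exact: (tdim_tact dx uU).
  exact: (@generated_act (mkpm x (F n x)) U uU (gF _ _ dx)).
- move=> n m x y dx dy; apply: generated_functional (gF _ _ _) _.
    by rewrite tdim_sum dx dy.
  exact: generated_sum (gF _ _ dx) (gF _ _ dy).
- move=> p ip; apply: generated_functional (gF _ _ erefl) _.
  exact: generated_irr.
Qed.

End PointedMatrices.

(** * Topology of complex matrices and compactness of the unitary group *)

Section MatrixContinuity.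
Variable R : realType.
Local Notation C := R[i].
Context {X : Type} {F : set_system X} {FF : Filter F}.

Lemma cvg_mulmx m n p (f : X -> 'M[C]_(m, n)) (g : X -> 'M[C]_(n, p))
    (A : 'M[C]_(m, n)) (B : 'M[C]_(n, p)) :
  f @ F --> A -> g @ F --> B -> (fun x => f x *m g x) @ F --> A *m B.
Proof.
move=> /mx_cvgP fA /mx_cvgP gB; apply/mx_cvgP => i j.
under eq_fun do rewrite mxE; rewrite mxE.
by apply: cvg_sum_fin => k; apply: cvgM; [exact: fA|exact: gB].
Qed.

Lemma cvg_trmxC m n (f : X -> 'M[C]_(m, n)) (A : 'M[C]_(m, n)) :
  f @ F --> A -> (fun x => (f x)^t* ) @ F --> A^t*.
Proof.
move=> /mx_cvgP fA; apply/mx_cvgP => i j.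
under eq_fun do rewrite !mxE; rewrite !mxE.
by apply: (cvg_comp _ _ (fA j i)); exact: conj_continuous.
Qed.

Lemma cvg_conj_mx n (f g : X -> 'M[C]_n) (A B : 'M[C]_n) :
  f @ F --> A -> g @ F --> B ->
  (fun x => conj_mx (f x) (g x)) @ F --> conj_mx A B.
Proof.
move=> fA gB; apply: cvg_mulmx (cvg_trmxC fA).
exact: cvg_mulmx fA gB.
Qed.

Lemma cvg_dsum_mx n m (f : X -> 'M[C]_n) (g : X -> 'M[C]_m)
    (A : 'M[C]_n) (B : 'M[C]_m) :
  f @ F --> A -> g @ F --> B ->
  (fun x => dsum_mx (f x) (g x)) @ F --> dsum_mx A B.
Proof.
move=> /mx_cvgP fA /mx_cvgP gB; apply/mx_cvgP => i j.
rewrite /dsum_mx -(splitK i) -(splitK j).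
case: (fintype.split i) => i1; case: (fintype.split j) => j1 /=.
- by rewrite block_mxEul; under eq_fun do rewrite block_mxEul; exact: fA.
- rewrite block_mxEur; under eq_fun do rewrite block_mxEur; exact: cvg_cst.
- rewrite block_mxEdl; under eq_fun do rewrite block_mxEdl; exact: cvg_cst.
- by rewrite block_mxEdr; under eq_fun do rewrite block_mxEdr; exact: gB.
Qed.

End MatrixContinuity.

Section WithinContinuity.
Variables X Y Z : topologicalType.

Lemma within_cvgP (A : set X) (f : X -> Y) :
  {within A, continuous f} <->
  forall x, A x -> f @ (within A (nbhs x)) --> f x.
Proof.
rewrite continuous_subspace_in; split=> cf x.
  move=> Ax; have := cf x; rewrite inE => /(_ Ax).
  by rewrite /continuous_at; case: (nbhs_subspaceP A x).
rewrite inE => Ax; rewrite /continuous_at.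
by case: (nbhs_subspaceP A x) => // _; exact: cf.
Qed.

(** A continuous surjection from a compact space onto a Hausdorff one is a quotient map: it sends
    closed sets, being compact, to closed sets. *)
Lemma within_continuous_image (K : set X) (m : X -> Y) (F : Y -> Z) :
  compact K -> hausdorff_space Y -> {within K, continuous m} ->
  {within K, continuous (F \o m)} -> {within m @` K, continuous F}.
Proof.
move=> cK hY cm /continuous_closedP cFm; apply/continuous_closedP => D cD.
have /closed_subspaceP[W cW WK] := cFm _ cD.
apply/closed_subspaceP; exists (m @` (W `&` K)).
  apply: compact_closed => //; apply: continuous_compact.
    exact: continuous_subspaceW cm.
  by rewrite setIC; exact: compact_closedI.
rewrite WK; apply/seteqP; split=> [_ [[x [FDx Kx] <-] mx]|y [Dy [x Kx xy]]].
  by split.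
split; last by exists x.
by exists x => //; split=> //; rewrite /preimage /from_subspace /= xy.
Qed.

End WithinContinuity.

Section ComplexTopology.
Variable R : realType.
Local Notation C := R[i].
Local Notation normc := (@Normc.normc R).

Lemma cvg_normcP (X : Type) (F : set_system X) (FF : Filter F) (f : X -> C)
    (z : C) :
  f @ F --> z <-> forall e : R, 0 < e -> \forall x \near F, normc (z - f x) < e.
Proof.
split=> [fz e e0|fz].
  have e0' : 0 < e%:C%C :> C by rewrite ltcR.
  have := (@cvgr_dist_lt _ _ _ F FF f z fz _ e0').
  by apply: filterS => x; rewrite -normcC ltcR.
apply/(@cvgrPdist_lt _ _ _ F FF) => /= -[a b];
  rewrite ltcE/= => /andP[/eqP -> a0].
by apply: filterS (fz _ a0) => x; rewrite -normcC ltcR.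
Qed.

Lemma normcN (z : C) : normc (- z) = normc z.
Proof. by apply: complexI; rewrite !normcC normrN. Qed.

Lemma normc_real (x : R) : normc (x%:C%C) = `|x|.
Proof. by rewrite /= expr0n /= addr0 sqrtr_sqr. Qed.

Lemma normcE (z : C) :
  normc z = Num.sqrt (complex.Re z ^+ 2 + complex.Im z ^+ 2).
Proof. by case: z. Qed.

Lemma Re_le_normc (z : C) : `|complex.Re z| <= normc z.
Proof.
rewrite normcE -sqrtr_sqr ler_sqrt ?addr_ge0 ?sqr_ge0//.
by rewrite lerDl sqr_ge0.
Qed.

Lemma Im_le_normc (z : C) : `|complex.Im z| <= normc z.
Proof.
rewrite normcE -sqrtr_sqr ler_sqrt ?addr_ge0 ?sqr_ge0//.
by rewrite lerDr sqr_ge0.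
Qed.

Lemma Re_continuous : continuous (@complex.Re R).
Proof.
move=> z; apply/(@cvgrPdist_lt _ _ _ (nbhs z)) => /= e e0.
have := (cvg_normcP (nbhs_filter z) id z).1 cvg_id e e0.
apply: filterS => x; apply: le_lt_trans; rewrite -raddfB; exact: Re_le_normc.
Qed.

Lemma Im_continuous : continuous (@complex.Im R).
Proof.
move=> z; apply/(@cvgrPdist_lt _ _ _ (nbhs z)) => /= e e0.
have := (cvg_normcP (nbhs_filter z) id z).1 cvg_id e e0.
apply: filterS => x; apply: le_lt_trans; rewrite -raddfB; exact: Im_le_normc.
Qed.

Lemma normc_le_ReIm (z : C) : normc z <= `|complex.Re z| + `|complex.Im z|.
Proof.
rewrite normcE -ler_sqr ?nnegrE ?sqrtr_ge0 ?addr_ge0//.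
rewrite sqr_sqrtr ?addr_ge0 ?sqr_ge0// sqrrD !real_normK ?num_real//.
by rewrite lerD2r lerDl mulrn_wge0// mulr_ge0.
Qed.

Lemma cvg_complex (X : Type) (F : set_system X) (FF : Filter F) (a b : X -> R)
    (z : C) : a @ F --> complex.Re z -> b @ F --> complex.Im z ->
  (fun x => (a x +i* b x)%C) @ F --> z.
Proof.
move=> az bz; apply/cvg_normcP => e e0.
have e20 : 0 < e / 2 by rewrite divr_gt0.
have az' := @cvgr_dist_lt _ _ _ F FF a _ az _ e20.
have bz' := @cvgr_dist_lt _ _ _ F FF b _ bz _ e20.
apply: filterS2 az' bz' => x; move=> ha hb.
apply: le_lt_trans (normc_le_ReIm _) _; rewrite !raddfB /=; lra.
Qed.

Lemma hausdorff_complex : hausdorff_space C.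
Proof. exact: norm_hausdorff. Qed.

Lemma mx_continuous_entry m n (i : 'I_m) (j : 'I_n) :
  continuous (fun A : 'M[C]_(m, n) => A i j).
Proof. exact: coord_continuous. Qed.

Lemma hausdorff_matrix m n : hausdorff_space 'M[C]_(m, n).
Proof.
move=> A B clAB; apply/matrixP => i j; apply: hausdorff_complex => P Q PA QB.
have [M [PM QM]] := clAB _ _ (mx_continuous_entry PA)
  (mx_continuous_entry QB).
by exists (M i j).
Qed.

(** A continuous image of a product of two real cubes, one for the real and one for the imaginary
    parts; [mxtens_index] merely serves as a bijection from index pairs to positions in a row
    vector. *)
Lemma bounded_mx_compact m n (r : R) :
  compact [set A : 'M[C]_(m, n) | forall i j,
    `|complex.Re (A i j)| <= r /\ `|complex.Im (A i j)| <= r].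
Proof.
pose K := [set v : 'rV[R]_(m * n) | forall k, `[- r, r]%classic (v ord0 k)].
have cK : compact K by
  exact: (@rV_compact R (m * n) (fun=> `[- r, r]%classic)
    (fun=> @segment_compact R (- r) r)).
pose f (v : 'rV[R]_(m * n) * 'rV[R]_(m * n)) : 'M[C]_(m, n) :=
  \matrix_(i, j) (v.1 0 (mxtens_index (i, j)) +i*
    v.2 0 (mxtens_index (i, j)))%C.
have cf : continuous f.
  move=> v; apply/mx_cvgP => i j.
  have cfst : (fun w : 'rV[R]_(m * n) * 'rV[R]_(m * n) => w.1) @ v --> v.1.
    exact: cvg_fst.
  have csnd : (fun w : 'rV[R]_(m * n) * 'rV[R]_(m * n) => w.2) @ v --> v.2.
    exact: cvg_snd.
  rewrite mxE; under eq_fun do rewrite mxE.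
  apply: cvg_complex.
    exact: (cvg_comp _ _ cfst (@coord_continuous R _ _ 0 _ _)).
  exact: (cvg_comp _ _ csnd (@coord_continuous R _ _ 0 _ _)).
have : compact (f @` (K `*` K)).
  by apply: continuous_compact (compact_setX cK cK);
    exact: continuous_subspaceT.
congr compact; apply/seteqP; split=> [_ [[v w] [/= vK wK] <-] i j|A AK].
  by rewrite mxE /= !ler_norml; split; [exact: vK|exact: wK].
pose v : 'rV[R]_(m * n) := \row_k complex.Re (A (mxtens_unindex k).1
  (mxtens_unindex k).2).
pose w : 'rV[R]_(m * n) := \row_k complex.Im (A (mxtens_unindex k).1
  (mxtens_unindex k).2).
exists (v, w); last first.
  by apply/matrixP => i j; rewrite !mxE mxtens_indexK /=; case: (A i j).
split=> k; rewrite /= in_itv /= -ler_norml mxE.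
  exact: (AK _ _).1.
exact: (AK _ _).2.
Qed.

Definition unitary_set n : set 'M[C]_n := [set U | U \is unitarymx].

Lemma unitary_closed n : closed (@unitary_set n).
Proof.
have cf : continuous (fun U : 'M[C]_n => U *m U^t*).
  move=> U; have cid : (fun V : 'M[C]_n => V) @ U --> U by exact: cvg_id.
  exact: cvg_mulmx cid (cvg_trmxC cid).
rewrite (_ : @unitary_set n = (fun U : 'M[C]_n => U *m U^t* ) @^-1` [set 1%:M]).
  apply: preimage_closed (in1W cf) _.
  apply: compact_closed; last exact: compact_set1.
  exact: hausdorff_matrix.
by apply/seteqP; split=> U /unitarymxP.
Qed.

Lemma normc_unitary_le n (U : 'M[C]_n) i j : U \is unitarymx ->
  normc (U i j) <= 1.
Proof.
move=> /unitarymxP/matrixP/(_ i i); rewrite !mxE eqxx => e.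
have {}e : \sum_k normc (U i k) ^+ 2 = 1.
  apply: complexI; rewrite rmorph_sum /=; apply: etrans e.
  by apply: eq_bigr => k _; rewrite !mxE rmorphXn /= normcC normCK.
rewrite -ler_sqr ?nnegrE ?normc_ge0//.
rewrite expr1n -[leRHS]e (bigD1 j)//= lerDl.
by apply: sumr_ge0 => k _; exact: sqr_ge0.
Qed.

Lemma unitary_compact n : compact (@unitary_set n).
Proof.
apply: subclosed_compact (@unitary_closed n) (@bounded_mx_compact n n 1) _.
move=> U uU i j; have h := normc_unitary_le i j uU.
by split; apply: le_trans h; [exact: Re_le_normc|exact: Im_le_normc].
Qed.

Lemma compact_real_bounded (X : topologicalType) (K : set X) (f : X -> R) :
  compact K -> {within K, continuous f} ->
  exists2 M, 0 < M & forall x, K x -> `|f x| <= M.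
Proof.
move=> cK cf; have [M [_ Mb]] := compact_bounded (continuous_compact cf cK).
exists (`|M| + 1); first by rewrite ltr_wpDl.
move=> x Kx; apply: Mb; last by exists x.
by rewrite (le_lt_trans (ler_norm _))// ltrDl.
Qed.

End ComplexTopology.

Arguments unitary_set R n : clear implicits.

(** * Frobenius norm and Chebyshev centres *)

Section FrobeniusNorm.
Variable R : realType.
Local Notation C := R[i].
Local Notation normc := (@Normc.normc R).

(** The Frobenius norm. Unlike [opnorm] it comes from an inner product, and the parallelogram
    identity is what makes Chebyshev centres unique and stable. *)
Definition fnorm n (A : 'M[C]_n) : R := l2norm (mxvec A)^T.

Lemma fnorm_ge0 n (A : 'M[C]_n) : 0 <= fnorm A.
Proof. exact: l2norm_ge0. Qed.

Lemma fnormD n (A B : 'M[C]_n) : fnorm (A + B) <= fnorm A + fnorm B.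
Proof. by rewrite /fnorm linearD linearD; exact: l2normD. Qed.

Lemma fnormN n (A : 'M[C]_n) : fnorm (- A) = fnorm A.
Proof.
rewrite /fnorm linearN linearN -scaleN1r l2normZ.
by rewrite normcN Normc.normc1 mul1r.
Qed.

Lemma fnorm0 n : fnorm (0 : 'M[C]_n) = 0.
Proof. by rewrite /fnorm linear0 linear0 l2norm0. Qed.

Lemma fnorm_eq0 n (A : 'M[C]_n) : fnorm A = 0 -> A = 0.
Proof.
move=> /l2norm_eq0 A0; apply/eqP; rewrite -mxvec_eq0; apply/eqP.
by apply: trmx_inj; rewrite A0 trmx0.
Qed.

Lemma fnormB n (A B : 'M[C]_n) : fnorm (A - B) = fnorm (B - A).
Proof. by rewrite -fnormN opprB. Qed.

Lemma fnorm_sqr n (A : 'M[C]_n) :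
  fnorm A ^+ 2 = \sum_i \sum_j normc (A i j) ^+ 2.
Proof.
rewrite /fnorm l2normE (reindex (uncurry (@mxvec_index n n)))/=; last first.
  exact: curry_mxvec_bij.
rewrite pair_bigA /=; apply: eq_bigr => -[i j] _ /=.
by rewrite mxE mxvecE.
Qed.

Lemma normc_le_fnorm n (A : 'M[C]_n) i j : normc (A i j) <= fnorm A.
Proof.
by have := normc_le_l2norm (mxvec A)^T (mxvec_index i j); rewrite mxE mxvecE.
Qed.

Lemma fnorm_le_sum n (A : 'M[C]_n) : fnorm A <= \sum_i \sum_j normc (A i j).
Proof.
apply: le_trans (l2norm_le_sum _) _.
rewrite (reindex (uncurry (@mxvec_index n n)))/=; last exact: curry_mxvec_bij.
rewrite pair_bigA /= le_eqVlt; apply/orP; left; apply/eqP.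
by apply: eq_bigr => -[i j] _ /=; rewrite mxE mxvecE.
Qed.

Lemma fnorm_trace n (A : 'M[C]_n) : (fnorm A ^+ 2)%:C%C = \tr (A *m A^t* ).
Proof.
rewrite fnorm_sqr rmorph_sum /=; apply: eq_bigr => i _.
rewrite rmorph_sum /= mxE; apply: eq_bigr => j _.
by rewrite rmorphXn /= normcC normCK !mxE.
Qed.

Lemma fnorm_conj n (U A : 'M[C]_n) : U \is unitarymx ->
  fnorm (conj_mx U A) = fnorm A.
Proof.
move=> uU; apply/eqP; rewrite -(eqrXn2 (n := 2)) ?fnorm_ge0//.
apply/eqP/complexI; rewrite !fnorm_trace /conj_mx !trmxC_mul trmxCK.
rewrite -!mulmxA (mulmxA (U^t* )) (mulmx_unitarytc uU) mul1mx.
by rewrite mxtrace_mulC -!mulmxA (mulmx_unitarytc uU) mulmx1.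
Qed.

(** The parallelogram identity for [A - D] and [B - D]; the subtracted term is the gain in distance
    to [D] at the midpoint. *)
Lemma fnorm_midpoint n (A B D : 'M[C]_n) :
  fnorm ((2^-1)%:C%C *: (A + B) - D) ^+ 2 =
  (fnorm (A - D) ^+ 2 + fnorm (B - D) ^+ 2) / 2 - fnorm (A - B) ^+ 2 / 4.
Proof.
rewrite !fnorm_sqr mulrDl !mulr_suml -big_split -sumrB /=.
apply: eq_bigr => i _; rewrite !mulr_suml -big_split -sumrB /=.
apply: eq_bigr => j _; rewrite !mxE.
case: (A i j) (B i j) (D i j) => a1 a2 [b1 b2] [d1 d2] /=.
by rewrite !sqr_sqrtr ?addr_ge0 ?sqr_ge0//; field.
Qed.

Lemma cvg_fnormP (X : Type) (F : set_system X) (FF : Filter F) n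
    (f : X -> 'M[C]_n) (A : 'M[C]_n) :
  f @ F --> A <-> forall e : R, 0 < e -> \forall x \near F, fnorm (A - f x) < e.
Proof.
split=> [|fA]; last first.
  apply/mx_cvgP => i j; apply/cvg_normcP => e e0.
  apply: filterS (fA _ e0) => x; apply: le_lt_trans.
  by have := normc_le_fnorm (A - f x) i j; rewrite !mxE.
move=> /mx_cvgP fA e e0.
have s : (fun x => \sum_i \sum_j normc (A i j - f x i j)) @ F -->
    (\sum_(i < n) \sum_(j < n) (0 : R)).
  apply: cvg_big => [|i _]; first exact: add_continuous.
  apply: cvg_big => [|j _]; first exact: add_continuous.
  apply/(@cvgrPdist_lt _ _ _ F FF) => /= e1 e10.
  apply: filterS ((cvg_normcP _ _ _).1 (fA i j) _ e10) => x.
  by rewrite sub0r normrN ger0_norm ?normc_ge0.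
have e00 : \sum_(i < n) \sum_(j < n) (0 : R) = 0.
  by rewrite big1// => i _; rewrite big1.
rewrite e00 in s.
have := @cvgr_dist_lt _ _ _ F FF _ _ s _ e0.
apply: filterS => x; rewrite sub0r normrN; apply: le_lt_trans.
apply: le_trans (fnorm_le_sum _) _; apply: le_trans (ler_norm _).
by apply: ler_sum => i _; apply: ler_sum => j _; rewrite !mxE.
Qed.

Lemma cvg_fnorm (X : Type) (F : set_system X) (FF : Filter F) n
    (f : X -> 'M[C]_n) (A : 'M[C]_n) :
  f @ F --> A -> (fun x => fnorm (f x)) @ F --> fnorm A.
Proof.
move=> /cvg_fnormP fA; apply/(@cvgrPdist_lt _ _ _ F FF) => /= e e0.
apply: filterS (fA _ e0) => x; apply: le_lt_trans.
have h (M N : 'M[C]_n) : fnorm M - fnorm N <= fnorm (M - N).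
  by rewrite lerBlDr; have := fnormD (M - N) N; rewrite subrK.
have := h A (f x); have := h (f x) A.
by rewrite (fnormB (f x)) ler_norml; lra.
Qed.

End FrobeniusNorm.

Local Opaque fnorm.

Section ChebyshevCenter.
Variables (R : realType) (G : Type) (K : set G) (n : nat).
Local Notation C := R[i].
Hypothesis K0 : K !=set0.
Implicit Types (s t : G -> 'M[C]_n) (c : 'M[C]_n).

Definition fbounded s := exists M, forall g, K g -> fnorm (s g) <= M.

(** For bounded [s], the radius of the smallest closed ball about [c] that contains the family; a
    minimizing [c] is a Chebyshev centre. *)
Definition radius s c : R := sup [set fnorm (c - s g) | g in K].

Lemma radius_has_sup s c : fbounded s ->
  has_sup [set fnorm (c - s g) | g in K].
Proof.
move=> [M sM]; split; first by have [g Kg] := K0; exists (fnorm (c - s g)), g.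
exists (fnorm c + M) => _ [g Kg <-]; apply: le_trans (fnormD _ _) _.
by rewrite fnormN lerD2l sM.
Qed.

Lemma le_radius s c g : fbounded s -> K g -> fnorm (c - s g) <= radius s c.
Proof.
move=> bs Kg; apply: sup_upper_bound; first exact: radius_has_sup.
by exists g.
Qed.

Lemma radius_le s c r : (forall g, K g -> fnorm (c - s g) <= r) ->
  radius s c <= r.
Proof.
move=> sr; apply: ge_sup; first by
  have [g Kg] := K0; exists (fnorm (c - s g)), g.
by move=> _ [g Kg <-]; exact: sr.
Qed.

Lemma radius_ge0 s c : fbounded s -> 0 <= radius s c.
Proof.
move=> bs; have [g Kg] := K0.
exact: le_trans (fnorm_ge0 _) (le_radius c bs Kg).
Qed.

Lemma radius_perturb s t c c' (e e' : R) : fbounded t ->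
  (forall g, K g -> fnorm (s g - t g) <= e) -> fnorm (c - c') <= e' ->
  radius s c <= radius t c' + e + e'.
Proof.
move=> bt st cc; apply: radius_le => g Kg.
have -> : c - s g = (c' - t g) + (- (s g - t g) + (c - c')).
  by apply/matrixP => i j; rewrite !mxE; ring.
have h1 := le_radius c' bt Kg; have h2 := st g Kg.
have h3 := fnormD (c' - t g) (- (s g - t g) + (c - c')).
have h4 := fnormD (- (s g - t g)) (c - c'); rewrite fnormN in h4.
move: h1 h2 h3 h4 cc.
move: (fnorm (- (s g - t g) + (c - c'))) (fnorm (s g - t g)) (radius t c').
move: (fnorm (c - c')) (fnorm (c' - t g)) (fnorm (c' - t g + _)) => *; lra.
Qed.

(** [fnorm_midpoint] at each [g], followed by the supremum. Two points whose radii are both nearly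
    minimal are therefore close to each other, whence uniqueness and stability of the centre. *)
Lemma radius_midpoint s c c' : fbounded s ->
  fnorm (c - c') ^+ 2 <= 2 * (radius s c ^+ 2 + radius s c' ^+ 2)
    - 4 * radius s ((2^-1)%:C%C *: (c + c')) ^+ 2.
Proof.
move=> bs; set m := _ *: _.
have [g0 Kg0] := K0.
suff : radius s m ^+ 2 <= (radius s c ^+ 2 + radius s c' ^+ 2) / 2
    - fnorm (c - c') ^+ 2 / 4 by lra.
set D := (X in _ <= X).
have key g : K g -> fnorm (m - s g) ^+ 2 <= D.
  move=> Kg; rewrite fnorm_midpoint /D lerD2r ler_pM2r ?invr_gt0//.
  by rewrite lerD// ler_sqr ?nnegrE ?fnorm_ge0 ?radius_ge0// le_radius.
have D0 : 0 <= D := le_trans (sqr_ge0 _) (key _ Kg0).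
rewrite -(sqr_sqrtr D0) ler_sqr ?nnegrE ?sqrtr_ge0 ?radius_ge0//.
apply: radius_le => g Kg.
rewrite -ler_sqr ?nnegrE ?sqrtr_ge0 ?fnorm_ge0//.
by rewrite (sqr_sqrtr D0); exact: key.
Qed.

(** The near-minimizers [L e] form a filter base that meets a compact box; a cluster point attains
    the infimum because the radius is 1-Lipschitz in the centre. *)
Lemma center_exists s : fbounded s ->
  exists c, forall c', radius s c <= radius s c'.
Proof.
move=> bs; have [M sM] := bs; have [g0 Kg0] := K0.
pose I := [set radius s c | c in [set: 'M[C]_n]].
have hI : has_inf I.
  by split; [exists (radius s 0), 0|exists 0 => _ [c _ <-]; exact: radius_ge0].
pose L (e : R) := [set c | radius s c <= inf I + e].
have L0 e : 0 < e -> L e !=set0.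
  move=> e0; have [_ [c _ <-] /ltW ce] := inf_adherent e0 hI.
  by exists c.
pose F := filter_from [set e : R | 0 < e] L.
have PF : ProperFilter F.
  apply: filter_from_proper; last by move=> e; exact: L0.
  apply: filter_from_filter; first by exists 1 => /=.
  move=> e1 e2 /= e10 e20; exists (Num.min e1 e2);
    first by rewrite /= lt_min e10.
  by move=> c; rewrite /L /= => h; split; apply: le_trans h _;
    rewrite lerD2l ge_min lexx ?orbT.
(* A member of [L 1] is within [inf I + 1] of [s g0], whose norm is at most [M]. *)
have cB := @bounded_mx_compact R n n (M + (inf I + 1)).
have [|c [_ clc]] := cB F PF.
  exists 1 => //= c cL i j.
  have cn : fnorm c <= M + (inf I + 1).
    rewrite -[c](subrK (s g0)); apply: le_trans (fnormD _ _) _.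
    rewrite addrC lerD ?sM//; exact: le_trans (le_radius c bs Kg0) cL.
  have h := le_trans (normc_le_fnorm c i j) cn.
  by split; apply: le_trans h; [exact: Re_le_normc|exact: Im_le_normc].
exists c => c'.
have cI : radius s c <= inf I.
  apply/ler_addgt0Pr => e e0; have e20 : 0 < e / 2 by rewrite divr_gt0.
  have nc : nbhs c [set d | fnorm (c - d) < e / 2].
    by have := (cvg_fnormP (nbhs_filter c) id c).1 cvg_id _ e20.
  have FL : F (L (e / 2)) by exists (e / 2).
  have [d [dL cd]] := clc _ _ FL nc.
  have h g : K g -> fnorm (s g - s g) <= 0 by rewrite subrr fnorm0.
  have := radius_perturb bs h (ltW cd); move: dL; rewrite /L /=; lra.
apply: le_trans cI _; apply: ge_inf; last by exists c'.
by case: hI.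
Qed.

Lemma center_unique s c c' : fbounded s ->
  (forall d, radius s c <= radius s d) -> radius s c' <= radius s c -> c' = c.
Proof.
move=> bs cmin c'c; have mp := radius_midpoint c c' bs.
have h1 : radius s c ^+ 2 <= radius s ((2^-1)%:C%C *: (c + c')) ^+ 2.
  by rewrite ler_sqr ?nnegrE ?radius_ge0.
have h2 : radius s c' ^+ 2 <= radius s c ^+ 2.
  by rewrite ler_sqr ?nnegrE ?radius_ge0.
have h0 : fnorm (c - c') ^+ 2 = 0.
  by apply/eqP; rewrite eq_le sqr_ge0 andbT; lra.
apply/esym/subr0_eq/fnorm_eq0/eqP; rewrite -sqrf_eq0; exact/eqP.
Qed.

(** A change of the family by [e] changes each radius by at most [e], so with r = [radius s c] the
    radius of [s] about [d] is at most r + 2e. Then [radius_midpoint] bounds the square by 2r^2 +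
    2(r + 2e)^2 - 4r^2 = 8re + 8e^2. *)
Lemma center_stable s t c d (e : R) : fbounded s -> fbounded t -> 0 <= e ->
  (forall g, K g -> fnorm (s g - t g) <= e) ->
  (forall c', radius s c <= radius s c') ->
  (forall c', radius t d <= radius t c') ->
  fnorm (c - d) ^+ 2 <= 8 * radius s c * e + 8 * e ^+ 2.
Proof.
move=> bs bt e0 st cmin dmin.
have ts g : K g -> fnorm (t g - s g) <= e by rewrite fnormB; exact: st.
have z0 c0 : fnorm (c0 - c0 : 'M[C]_n) <= 0 by rewrite subrr fnorm0.
have h1 := radius_perturb bt st (z0 d).
have h2 := radius_perturb bs ts (z0 c).
have h3 := dmin c.
have h4 : radius s d <= radius s c + 2 * e.
  move: h1 h2 h3 => {bs bt cmin dmin st ts z0 e0}.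
  by move: (radius s d) (radius t d) (radius t c) (radius s c) => *; lra.
have mp := radius_midpoint c d bs.
have h5 : radius s c ^+ 2 <= radius s ((2^-1)%:C%C *: (c + d)) ^+ 2.
  by rewrite ler_sqr ?nnegrE ?radius_ge0.
have h6 : radius s d ^+ 2 <= (radius s c + 2 * e) ^+ 2.
  have r0 := radius_ge0 c bs.
  rewrite ler_sqr ?nnegrE ?radius_ge0//.
  by apply: addr_ge0 => //; apply: mulr_ge0.
move: mp h5 h6 => {h1 h2 h3 h4 bs bt cmin dmin st ts z0 e0}.
move: (radius s _) (radius s c) (radius s d) (fnorm (c - d)) => a b c1 d1.
by rewrite sqrrD; lra.
Qed.

End ChebyshevCenter.

(** * Levels of a proper tower and the equivariant Tietze theorem *)

Section TowerTopology.
Variables (R : realType) (T : tower R).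
Local Notation C := R[i].
Implicit Types (x y z a b : T) (B : set T).

Definition level n : set T := [set x | tdim x = n].

Lemma level_open n : open (level n).
Proof.
rewrite (_ : level n = @tdim R T @^-1` [set n]); last by [].
apply: open_comp => [x _|]; first exact: tdim_continuous.
exact: discrete_open.
Qed.

Lemma level_closed n : closed (level n).
Proof.
rewrite (_ : level n = @tdim R T @^-1` [set n]); last by [].
apply: preimage_closed => [x _|]; first exact: tdim_continuous.
exact: discrete_closed.
Qed.

Lemma level_nbhs n x : tdim x = n -> nbhs x (level n).
Proof. by move=> dx; apply: open_nbhs_nbhs; split=> //; exact: level_open. Qed.

Lemma within_levelP (Y : topologicalType) n (f : T -> Y) :
  {within level n, continuous f} <-> forall x, tdim x = n -> f @ x --> f x.
Proof.
rewrite (continuous_open_subspace _ (level_open n)).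
split=> cf x; first by move=> dx; apply: cf; rewrite inE.
by rewrite inE; exact: cf.
Qed.

Lemma tact_cvg n (U : 'M[C]_n) x : U \is unitarymx -> tdim x = n ->
  (fun p => tact p.1 p.2) @ within [set p : 'M[C]_n * T |
    p.1 \is unitarymx /\ tdim p.2 = n] (nbhs (U, x)) --> tact U x.
Proof.
move=> uU dx; have /within_cvgP := @tact_continuous R T n.
by move=> /(_ (U, x)); apply.
Qed.

Lemma cvg_tact (X : Type) (F : set_system X) (FF : Filter F) n
    (f : X -> 'M[C]_n) (g : X -> T) (U : 'M[C]_n) x :
  U \is unitarymx -> tdim x = n ->
  (\forall t \near F, f t \is unitarymx) ->
  (\forall t \near F, tdim (g t) = n) ->
  f @ F --> U -> g @ F --> x -> (fun t => tact (f t) (g t)) @ F --> tact U x.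
Proof.
move=> uU dx uf dg fU gx; have := tact_cvg uU dx.
move=> h P /h /= [[Q1 Q2] [/= UQ1 xQ2] Q12].
have FQ1 : F (fun t => Q1 (f t)) := fU _ UQ1.
have FQ2 : F (fun t => Q2 (g t)) := gx _ xQ2.
suff : F (fun t => P (tact (f t) (g t))) by [].
apply: filterS (filterI (filterI FQ1 FQ2) (filterI uf dg)).
by move=> t [[t1 t2] [t3 t4]];
  exact: (Q12 (f t, g t) (conj t1 t2) (conj t3 t4)).
Qed.

Lemma cvg_tsum (X : Type) (F : set_system X) (FF : Filter F)
    (f g : X -> T) x y :
  f @ F --> x -> g @ F --> y -> (fun t => tsum (f t) (g t)) @ F --> tsum x y.
Proof.
move=> fx gy; apply: (cvg_comp (fun t => (f t, g t))
  (fun p : T * T => tsum p.1 p.2) (G := nbhs (x, y))).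
  exact: cvg_pair.
exact: (@tsum_continuous R T (x, y)).
Qed.

Lemma orbit_map_continuous n x : tdim x = n ->
  {within unitary_set R n, continuous (fun U : 'M[C]_n => tact U x)}.
Proof.
move=> dx; apply/within_cvgP => U uU; apply: (cvg_tact _ uU dx).
- exact: withinT.
- by apply: filterS (withinT _ _) => V _.
- by apply: cvg_within_filter; exact: cvg_id.
- exact: cvg_cst.
Qed.

Lemma tequiv_closed x : closed [set y | tequiv x y].
Proof.
rewrite (_ : mkset _ = (fun U : 'M[C]_(tdim x) => tact U x) @`
    unitary_set R (tdim x)); last first.
  by apply/seteqP; split=> [y [U uU <-]|y [U uU <-]]; exists U.
apply: compact_closed; first exact: tower_hausdorff.
apply: continuous_compact (@unitary_compact _ _); exact: orbit_map_continuous.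
Qed.

Hypothesis properT : proper_tower T.

(** The levels are clopen and compact Hausdorff. Neighbourhoods are shrunk in each level separately,
    and the closure of their union is computed level by level. *)
Lemma proper_tower_normal : normal_space T.
Proof.
move=> A clA B AB; pose A' n := A `&` level n.
have clA' n : closed (A' n) by apply: closedI => //; exact: level_closed.
have AB' n : set_nbhs (A' n) B.
  case/set_nbhsP : AB => V [oV AV VB]; apply/set_nbhsP; exists V; split=> //.
  by move=> x [/AV].
have A'n n : A' n `<=` (level n)°.
  by move=> x [_ nx]; exact: level_nbhs.
have P n := compact_normal_local (@tower_hausdorff R T) (@properT n)
  (@A'n n) (clA' n) (AB' n).
have Q n : exists W, [/\ open W, A' n `<=` W & closure W `<=` B].
  have [V /set_nbhsP[W [oW AW WV]] clV] := P n.
  by exists W; split=> //; exact: subset_trans (closureS WV) clV.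
have [W WP] := choice Q.
exists (\bigcup_n (W n `&` level n)).
  apply/set_nbhsP; exists (\bigcup_n (W n `&` level n)); split=> //.
    apply: bigcup_open => n _; have [oW _ _] := WP n.
    by apply: openI => //; exact: level_open.
  move=> x Ax; exists (tdim x) => //; split=> //.
  by have [_ + _] := WP (tdim x); apply.
move=> x clx; have [_ _] := WP (tdim x); apply => V Vx.
have [y [[n _ [Wy ny]] [Vy xy]]] :=
  clx _ (filterI Vx (level_nbhs (erefl (tdim x)))).
by exists y; split=> //; rewrite -xy (ny : tdim y = n).
Qed.

(** By [split_levelE] a continuous image of a set of triples (U, a, b), compact in a proper tower.
    This gives closedness and, through [within_continuous_image], the continuity of any field that
    is continuous in dimensions [i] and [j]. *)
Definition split_level i j : set T :=
  [set x | exists a b, [/\ tdim a = i, tdim b = j & tequiv (tsum a b) x]].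

Lemma split_levelE i j : split_level i j =
  (fun p : 'M[C]_(i + j) * (T * T) => tact p.1 (tsum p.2.1 p.2.2)) @`
  (unitary_set R (i + j) `*` (level i `*` level j)).
Proof.
apply/seteqP; split=> [x [a [b [da db abx]]]|_ [[U [a b]] [/= uU [da db]] <-]].
  have dab : tdim (tsum a b) = (i + j)%N by rewrite tdim_sum da db.
  by have [U uU <-] := (tequivP _ dab).1 abx; exists (U, (a, b)).
exists a, b; split=> //; apply: (tequiv_act _ uU).
by rewrite tdim_sum da db.
Qed.

Lemma split_map_continuous i j :
  {within unitary_set R (i + j) `*` (level i `*` level j),
   continuous (fun p : 'M[C]_(i + j) * (T * T) => tact p.1 (tsum p.2.1 p.2.2))}.
Proof.
apply/within_cvgP => -[U [a b]] [/= uU [da db]].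
have c1 : (fun p : 'M[C]_(i + j) * (T * T) => p.1) @ (U, (a, b)) --> U.
  exact: cvg_fst.
have c2 : (fun p : 'M[C]_(i + j) * (T * T) => p.2) @ (U, (a, b)) --> (a, b).
  exact: cvg_snd.
have c3 : (fun p : 'M[C]_(i + j) * (T * T) => p.2.1) @ (U, (a, b)) --> a.
  by apply: (cvg_comp _ _ c2); exact: cvg_fst.
have c4 : (fun p : 'M[C]_(i + j) * (T * T) => p.2.2) @ (U, (a, b)) --> b.
  by apply: (cvg_comp _ _ c2); exact: cvg_snd.
apply: cvg_tact => //.
- by rewrite tdim_sum da db.
- by apply: filterS (withinT _ _) => -[V [x y]] [].
- apply: filterS (withinT _ _) => -[V [x y]] [/= _ [dx dy]].
  by rewrite tdim_sum dx dy.
- exact: cvg_within_filter c1.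
- by apply: cvg_within_filter; exact: cvg_tsum.
Qed.

Let split_domain_compact i j : compact (unitary_set R (i + j)
  `*` (level i `*` level j)).
Proof.
apply: compact_setX; first exact: unitary_compact.
by apply: compact_setX; exact: properT.
Qed.

Lemma split_level_closed i j : closed (split_level i j).
Proof.
rewrite split_levelE; apply: compact_closed; first exact: tower_hausdorff.
apply: continuous_compact; first exact: split_map_continuous.
exact: split_domain_compact.
Qed.

Lemma split_level_continuous (F : forall n, T -> 'M[C]_n) i j :
  equivariant_field F -> {within level i, continuous (F i)} ->
  {within level j, continuous (F j)} ->
  {within split_level i j, continuous (F (i + j)%N)}.
Proof.
move=> eF /within_levelP Fi /within_levelP Fj; rewrite split_levelE.
apply: within_continuous_image.
- exact: split_domain_compact.
- exact: tower_hausdorff.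
- exact: split_map_continuous.
apply/within_cvgP => -[U [a b]] [/= uU [da db]].
have E V x y : V \is unitarymx -> tdim x = i -> tdim y = j ->
    F (i + j)%N (tact V (tsum x y)) = conj_mx V (dsum_mx (F i x) (F j y)).
  move=> uV dx dy; rewrite (field_act eF _ uV) ?(field_sum eF dx dy)//.
  by rewrite tdim_sum dx dy.
rewrite E//.
have c1 : (fun p : 'M[C]_(i + j) * (T * T) => p.1) @ (U, (a, b)) --> U.
  exact: cvg_fst.
have c2 : (fun p : 'M[C]_(i + j) * (T * T) => p.2) @ (U, (a, b)) --> (a, b).
  exact: cvg_snd.
have c3 : (fun p : 'M[C]_(i + j) * (T * T) => F i p.2.1) @ (U, (a, b)) -->
    F i a.
  apply: (cvg_comp _ _ (cvg_comp _ _ c2 _) (Fi a da)); exact: cvg_fst.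
have c4 : (fun p : 'M[C]_(i + j) * (T * T) => F j p.2.2) @ (U, (a, b)) -->
    F j b.
  apply: (cvg_comp _ _ (cvg_comp _ _ c2 _) (Fj b db)); exact: cvg_snd.
apply: (cvg_trans _ (cvg_within_filter (unitary_set R (i + j) `*` _)
  (cvg_conj_mx c1 (cvg_dsum_mx c3 c4)))).
apply: near_eq_cvg.
apply: filterS (withinT _ _) => -[V [x y]] [/= uV [dx dy]].
by rewrite E.
Qed.

Definition red_level n : set T := level n `&` [set x | reducible x].

Lemma red_level_act n x (U : 'M[C]_n) : red_level n x -> U \is unitarymx ->
  red_level n (tact U x).
Proof.
move=> [dx rx] uU; split; first exact: (tdim_tact dx uU).
exact: reducible_equiv (tequiv_act dx uU) rx.
Qed.

Lemma red_levelE n :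
  red_level n = \big[setU/set0]_(i < n) split_level i (n - i).
Proof.
rewrite -(bigcup_mkord n (fun i => split_level i (n - i))).
apply/seteqP; split=> [x [nx /reducibleP[a [b xab]]]|].
  have d : (tdim a + tdim b)%N = n by rewrite -tdim_sum -(tequiv_dim xab).
  exists (tdim a) => /=.
    by rewrite -d -[X in (X < _)%N]addn0 ltn_add2l tdim_gt0.
  by exists a, b; rewrite -d addKn; split=> //; exact: tequiv_sym.
move=> x [i /= ni [a [b [da db abx]]]]; split.
  by rewrite /level /= -(tequiv_dim abx) tdim_sum da db subnKC// ltnW.
by apply/reducibleP; exists a, b; exact: tequiv_sym.
Qed.

Lemma red_level_closed n : closed (red_level n).
Proof.
rewrite red_levelE; apply: closed_bigsetU => i _; exact: split_level_closed.
Qed.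

(** The reducible points are covered by finitely many closed pieces [split_level i (n - i)], on each
    of which [F n] is determined by [F i] and [F (n - i)]. *)
Lemma red_level_continuous (F : forall n, T -> 'M[C]_n) n :
  equivariant_field F ->
  (forall i, (i < n)%N -> {within level i, continuous (F i)}) ->
  {within red_level n, continuous (F n)}.
Proof.
move=> eF Fc; rewrite red_levelE.
suff [] : closed (\big[setU/set0]_(i < n) split_level i (n - i)) /\
  {within \big[setU/set0]_(i < n) split_level i (n - i),
    continuous (F n)} by [].
apply: (big_ind (fun S => closed S /\ {within S, continuous (F n)})).
- by split; [exact: closed0|exact: continuous_subspace0].
- move=> A B [cA FA] [cB FB].
  by split; [exact: closedU|exact: withinU_continuous].
move=> i _; split; first exact: split_level_closed.
(* Index 0 gives an empty piece, as no point has dimension 0; for i > 0 both i and n - i are below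
   n. *)
have [i0|i0] := posnP i.
  have -> : split_level i (n - i) = set0; last exact: continuous_subspace0.
  apply/seteqP; split=> // x [a [b [da _ _]]].
  by have := tdim_gt0 a; rewrite da i0.
have e : (i + (n - i))%N = n by rewrite subnKC// ltnW.
have := split_level_continuous eF (Fc _ (ltn_ord i)) (Fc (n - i)%N _).
rewrite e; apply; by rewrite ltn_subrL i0 (leq_ltn_trans _ (ltn_ord i)).
Qed.

Lemma tietze_matrix n B (g : T -> 'M[C]_n) : closed B -> B `<=` level n ->
  {within B, continuous g} ->
  exists2 H : T -> 'M[C]_n, continuous H & forall x, B x -> H x = g x.
Proof.
move=> clB Bn cg.
have cB : compact B by exact: subclosed_compact clB (@properT n) Bn.
have ext (f : C -> R) : continuous f -> forall ij : 'I_n * 'I_n,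
    exists h : T -> R, continuous h /\ forall x, B x -> h x = f (g x ij.1 ij.2).
  move=> cf [i j].
  have cfg : {within B, continuous (fun x => f (g x i j))}.
    move=> x; have /mx_cvgP/(_ i j) cgx := cg x.
    exact: (cvg_comp (fun x => g x i j) f cgx (cf _)).
  have [M M0 fM] := compact_real_bounded cB cfg.
  have [h [fh ch _]] :=
    continuous_bounded_extension proper_tower_normal clB M0 cfg fM.
  by exists h; split=> // x Bx; rewrite -fh// inE.
have [hr hrP] := choice (ext _ (@Re_continuous R)).
have [hi hiP] := choice (ext _ (@Im_continuous R)).
exists (fun x => \matrix_(i, j) (hr (i, j) x +i* hi (i, j) x)%C).
  move=> x; apply/mx_cvgP => i j; under eq_fun do rewrite mxE.
  rewrite mxE; apply: cvg_complex => /=; first exact: (hrP (i, j)).1.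
  exact: (hiP (i, j)).1.
move=> x Bx; apply/matrixP => i j; rewrite mxE (hrP _).2// (hiP _).2//=.
by case: (g x i j).
Qed.

(* Averaging over the unitary group is replaced by taking the Chebyshev centre
   of the set of all U^-1.H(U.x), which is equivariant by uniqueness. *)
Lemma equivariant_tietze n B (g : T -> 'M[C]_n) : closed B -> B `<=` level n ->
  {within B, continuous g} ->
  (forall x (U : 'M[C]_n), B x -> U \is unitarymx ->
    B (tact U x) /\ g (tact U x) = conj_mx U (g x)) ->
  exists h : T -> 'M[C]_n, [/\ {within level n, continuous h},
    forall x (U : 'M[C]_n), tdim x = n -> U \is unitarymx ->
      h (tact U x) = conj_mx U (h x)
    & forall x, B x -> h x = g x].
Proof.
move=> clB Bn cg gU; have [H cH HB] := tietze_matrix clB Bn cg.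
pose K := unitary_set R n.
have K0 : K !=set0 by exists 1%:M; exact: unitarymx1.
pose phi x (U : 'M[C]_n) := conj_mx (U^t* ) (H (tact U x)).
have bphi x : tdim x = n -> fbounded K (phi x).
  move=> dx.
  have cfH : {within level n, continuous (fun x => fnorm (H x))}.
    by apply/within_levelP => y _; apply: cvg_fnorm; exact: cH.
  have [M _ HM] := compact_real_bounded (@properT n) cfH.
  exists M => U uU; rewrite /phi (fnorm_conj _ (unitary_tc uU)).
  exact: le_trans (ler_norm _) (HM _ (tdim_tact dx uU)).
have cen x : exists c, tdim x = n ->
    forall c', radius K (phi x) c <= radius K (phi x) c'.
  have [dx|dx] := pselect (tdim x = n); last by exists 0.
  by have [c cP] := center_exists K0 (bphi _ dx); exists c.
have [h hP] := choice cen.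
exists h; split.
- apply/within_levelP => x dx; apply/cvg_fnormP => e e0.
  set r := radius K (phi x) (h x).
  have r0 : 0 <= r := radius_ge0 K0 _ (bphi _ dx).
  (* As d <= 1, one has d^2 <= d, so 8rd + 8d^2 <= 8(r + 1)d <= e^2 / 2, which turns [center_stable]
     into a bound by e. *)
  pose d := Num.min 1 (e ^+ 2 / (16 * (r + 1))).
  have d0 : 0 < d.
    by rewrite lt_min ltr01 divr_gt0 ?exprn_gt0 ?mulr_gt0// ltr_wpDl.
  have de : 8 * r * d + 8 * d ^+ 2 < e ^+ 2.
    have d1 : d <= 1 by rewrite ge_min lexx.
    have d2 : d * (16 * (r + 1)) <= e ^+ 2.
      rewrite -ler_pdivlMr ?mulr_gt0 ?ltr_wpDl//.
      by rewrite ge_min lexx orbT.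
    have d3 : d ^+ 2 <= d by rewrite expr2 ler_piMl// ltW.
    have e20 : 0 < e ^+ 2 by rewrite exprn_gt0.
    move: d2 d3 e20; clear; move: (e ^+ 2) (d ^+ 2) => e2 dd.
    rewrite mulrCA mulrDr mulr1 (mulrC d r) -(mulrA 8); lra.
  (* The families at [x] and at nearby [y] are close uniformly in [U]: joint continuity and
     compactness of the unitary group (tube lemma). *)
  have unif : \forall y \near x, tdim y = n ->
      forall U, K U -> fnorm (phi x U - phi y U) <= d.
    have /compact_near_coveringP cov : compact K := @unitary_compact R n.
    have := cov _ (nbhs x) (fun y U => K U -> tdim y = n ->
      fnorm (phi x U - phi y U) <= d) (nbhs_filter x).
    move=> covx; have {}covx : \forall y \near x, forall U, K U ->
        K U -> tdim y = n -> fnorm (phi x U - phi y U) <= d.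
      apply: covx => U0 uU0.
      pose A := [set p : 'M[C]_n * T | p.1 \is unitarymx /\ tdim p.2 = n].
      have c1 : (fun p : 'M[C]_n * T => p.1) @ within A (nbhs (U0, x)) --> U0.
        by apply: cvg_within_filter; exact: cvg_fst.
      have c2 : (fun p : 'M[C]_n * T => phi p.2 p.1) @
          within A (nbhs (U0, x)) --> phi x U0.
        apply: (cvg_conj_mx (cvg_trmxC c1)).
        apply: (cvg_comp _ _ (tact_cvg uU0 dx)); exact: cH.
      have c3 : (fun p : 'M[C]_n * T => phi x p.1) @
          within A (nbhs (U0, x)) --> phi x U0.
        apply: (cvg_conj_mx (cvg_trmxC c1)).
        have c4 : (fun p : 'M[C]_n * T => tact p.1 x) @
            within A (nbhs (U0, x)) --> tact U0 x.
          apply: (cvg_tact _ uU0 dx _ _ c1).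
          - by apply: filterS (withinT _ _) => p [].
          - by apply: filterS filterT => p _.
          - exact: cvg_cst.
        exact: (cvg_comp _ _ c4 (cH _)).
      have d20 : 0 < d / 2 by rewrite divr_gt0.
      have FA : Filter (within A (nbhs (U0, x))) by exact: within_filter.
      have n2 := (cvg_fnormP FA _ _).1 c2 _ d20.
      have n3 := (cvg_fnormP FA _ _).1 c3 _ d20.
      have n23 : nbhs (U0, x) (fun p : 'M[C]_n * T => A p ->
          fnorm (phi x U0 - phi p.2 p.1) < d / 2 /\
          fnorm (phi x U0 - phi x p.1) < d / 2) :=
        @filterI _ _ FA _ _ n2 n3.
      suff : nbhs (U0, x) (fun p : 'M[C]_n * T => K p.1 -> tdim p.2 = n ->
        fnorm (phi x p.1 - phi p.2 p.1) <= d) by [].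
      apply: (@filterS _ _ (nbhs_filter (U0, x))) n23 => -[U y] /= h23 uU dy.
      have [h2 h3] := h23 (conj uU dy).
      have -> : phi x U - phi y U = (phi x U0 - phi y U) - (phi x U0 - phi x U).
        move: (phi x U) (phi y U) (phi x U0) => M1 M2 M3.
        by apply/matrixP => i j; rewrite !mxE; ring.
      apply: le_trans (fnormD _ _) _; rewrite fnormN.
      apply: le_trans (lerD (ltW h2) (ltW h3)) _; by rewrite -splitr.
    by apply: filterS covx => y hy dy U KU; exact: (hy U KU KU dy).
  apply: (@filterS2 _ (nbhs x) _ _ _ _ _ unif (level_nbhs dx)) => y hy dy.
  have hxy := center_stable K0 (bphi _ dx) (bphi _ dy) (ltW d0) (hy dy)
    (hP _ dx) (hP _ dy).
  rewrite -ltr_sqr ?nnegrE ?fnorm_ge0 ?(ltW e0)//.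
  exact: le_lt_trans hxy de.
- move=> x U dx uU; have dUx := tdim_tact dx uU.
  (* Passing from y to V.y reindexes the family by W -> WV and conjugates it by [V], an isometry, so
     radii do not grow; applying this to [U] and to its adjoint gives equality. *)
  have rE c : radius K (phi (tact U x)) (conj_mx U c) = radius K (phi x) c.
    have le V y c1 : V \is unitarymx -> tdim y = n ->
        radius K (phi (tact V y)) (conj_mx V c1) <= radius K (phi y) c1.
      move=> uV dy; apply: (radius_le K0) => W uW.
      have -> : conj_mx V c1 - phi (tact V y) W =
          conj_mx V (c1 - phi y (W *m V)).
        rewrite /phi (tact_comp dy uW uV) trmxC_mul !conj_mxM.
        rewrite /conj_mx mulmxBr mulmxBl -!/(conj_mx _ _).
        by rewrite (conj_mxKV _ uV).
      rewrite (fnorm_conj _ uV); apply: (le_radius K0 _ (bphi _ dy)).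
      exact: (unitary_mul uW uV).
    have le1 := le U x c uU dx.
    have le2 := le (U^t* ) (tact U x) (conj_mx U c) (unitary_tc uU) dUx.
    rewrite (tactK dx uU) (conj_mxK _ uU) in le2.
    exact: (le_anti (introT andP (conj le1 le2))).
  apply/esym/(center_unique K0 (bphi _ dUx) (hP _ dUx)).
  rewrite rE -[h (tact U x)](conj_mxKV _ uU) rE; exact: (hP _ dx).
(* On [B] the extension [H] is already equivariant, so the family is constantly [g x], which is its
   centre with radius 0. *)
- move=> x Bx; have dx := Bn _ Bx; apply/esym.
  apply: (center_unique K0 (bphi _ dx) (hP _ dx)).
  apply: le_trans (radius_ge0 K0 _ (bphi _ dx)).
  apply: (radius_le K0) => U uU; have [BU gUx] := gU _ _ Bx uU.
  by rewrite /phi (HB _ BU) gUx (conj_mxK _ uU) subrr fnorm0.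
Qed.

End TowerTopology.

(** * Norm bounds and the construction of elements of C*(T) from fields *)

Section OperatorNorm.
Variable R : realType.
Local Notation C := R[i].
Local Notation normc := (@Normc.normc R).

(** The crude factor is enough: the estimate only transfers boundedness on a compact level. *)
Lemma opnorm_le_fnorm n (A : 'M[C]_n) : opnorm A <= (n * n)%:R * fnorm A.
Proof.
apply: opnorm_le => [|v]; first by rewrite mulr_ge0 ?fnorm_ge0.
apply: le_trans (l2norm_le_sum _) _.
apply: (@le_trans _ _ (\sum_(i < n) \sum_(j < n) fnorm A * l2norm v)).
  apply: ler_sum => i _; rewrite mxE; apply: le_trans (ler_normc_sum _) _.
  apply: ler_sum => j _; rewrite Normc.normcM ler_pM ?normc_ge0//.
    exact: normc_le_fnorm.
  exact: normc_le_l2norm.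
rewrite (eq_bigr (fun=> (fnorm A * l2norm v) *+ n)) => [|i _].
  by rewrite sumr_const card_ord -mulrnA -[leRHS]mulrA mulr_natl.
by rewrite sumr_const card_ord.
Qed.

Lemma l2norm_dot n (v : 'cV[C]_n) : (l2norm v ^+ 2)%:C%C = (v^t* *m v) 0 0.
Proof.
rewrite l2normE rmorph_sum /= mxE; apply: eq_bigr => i _.
by rewrite rmorphXn /= normcC normCK !mxE mulrC.
Qed.

Lemma opnorm_unitary n (U : 'M[C]_n) : U \is unitarymx -> opnorm U <= 1.
Proof.
move=> uU; apply: opnorm_le => // v; rewrite mul1r.
rewrite -ler_sqr ?nnegrE ?l2norm_ge0// -lecR !l2norm_dot.
by rewrite trmxC_mul -mulmxA (mulmxA (U^t* )) (mulmx_unitarytc uU) mul1mx.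
Qed.

Lemma opnorm_conj n (U A : 'M[C]_n) (c : R) : U \is unitarymx ->
  opnorm A <= c -> opnorm (conj_mx U A) <= c.
Proof.
move=> uU Ac; apply: le_trans (opnormM _ _) _.
apply: (@le_trans _ _ (opnorm (U *m A))).
  by rewrite ler_piMr ?opnorm_ge0//; exact: opnorm_unitary (unitary_tc uU).
apply: le_trans (opnormM _ _) (le_trans _ Ac).
by rewrite ler_piMl ?opnorm_ge0//; exact: opnorm_unitary uU.
Qed.

Lemma opnorm_dsum n m (A : 'M[C]_n) (B : 'M[C]_m) (c : R) :
  opnorm A <= c -> opnorm B <= c -> opnorm (dsum_mx A B) <= c.
Proof.
move=> Ac Bc; have c0 : 0 <= c := le_trans (opnorm_ge0 A) Ac.
apply: opnorm_le => // v; rewrite -[v]vsubmxK.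
set v1 := usubmx v; set v2 := dsubmx v.
have sq (p q : nat) (w1 : 'cV[C]_p) (w2 : 'cV[C]_q) :
    l2norm (col_mx w1 w2) ^+ 2 = l2norm w1 ^+ 2 + l2norm w2 ^+ 2.
  rewrite !l2normE big_split_ord /=; congr (_ + _).
    by apply: eq_bigr => i _; rewrite col_mxEu.
  by apply: eq_bigr => i _; rewrite col_mxEd.
rewrite /dsum_mx mul_block_col !mul0mx addr0 add0r.
rewrite -ler_sqr ?nnegrE ?mulr_ge0 ?l2norm_ge0// exprMn !sq mulrDr.
rewrite -!exprMn lerD// ler_sqr ?nnegrE ?mulr_ge0 ?l2norm_ge0//.
  by apply: le_trans (l2norm_mul _ _) _; rewrite ler_wpM2r ?l2norm_ge0.
by apply: le_trans (l2norm_mul _ _) _; rewrite ler_wpM2r ?l2norm_ge0.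
Qed.

End OperatorNorm.

Section ContinuousFields.
Variables (R : realType) (T : tower R).
Local Notation C := R[i].
Implicit Types (x y z a b p : T)
  (F : forall n : nat, T -> 'M[C]_n) (f : cstar T).

Definition cstar_eval f n x : 'M[C]_n := as_mx n (f x).

Lemma cstar_evalE f x : cstar_eval f (tdim x) x = f x.
Proof. exact: as_mx_id. Qed.

Lemma cstar_eval_field f : equivariant_field (cstar_eval f).
Proof.
split=> [n x U dx uU|n m x y dx dy].
  subst n; rewrite /cstar_eval as_mx_id (cstar_act (cstarP f) uU).
  by rewrite invmx_unitary.
by subst n m; rewrite /cstar_eval !as_mx_id (cstar_sum (cstarP f)).
Qed.

Lemma cstar_eval_continuous f n : {within level n, continuous (cstar_eval f n)}.
Proof. exact: (cstar_continuous (cstarP f)). Qed.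

Lemma finite_height : (height T < +oo)%E ->
  exists N, forall x, irreducible x -> (tdim x <= N)%N.
Proof.
rewrite /height; set h := ereal_sup _ => hoo.
(* The adjoined 0 keeps the supremum from being -oo when there are no irreducibles. *)
have h0 : (0%E <= h)%E by apply: ereal_sup_ubound; left.
have [r hr] : exists r : R, h = r%:E.
  by move: h0 hoo; case: h => [r| |] //; exists r.
exists (Num.bound r) => x ix; rewrite -(ler_nat R).
have : ((tdim x)%:R%:E <= h)%E by apply: ereal_sup_ubound; right; exists x.
rewrite hr lee_fin => /le_trans; apply; apply: ltW.
by apply: archi_boundP; rewrite -lee_fin -hr.
Qed.

Hypotheses (properT : proper_tower T) (heightT : (height T < +oo)%E).

(** A bound common to two summands holds for their direct sum, and conjugation preserves it; so it
    suffices to bound the irreducibles, which live on finitely many compact levels. *)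
Lemma field_bounded F : equivariant_field F ->
  (forall n, {within level n, continuous (F n)}) ->
  exists c : R, forall x, opnorm (F (tdim x) x) <= c.
Proof.
move=> eF Fc; have [N irrN] := finite_height heightT.
have bk k : exists c : R, forall x, tdim x = k -> opnorm (F k x) <= c.
  have cfF : {within level k, continuous (fun x => fnorm (F k x))}.
    move=> x; apply: cvg_fnorm; exact: (Fc k x).
  have [M _ FM] := compact_real_bounded (@properT k) cfF.
  exists ((k * k)%:R * M) => x dx; apply: le_trans (opnorm_le_fnorm _) _.
  by rewrite ler_wpM2l//; apply: le_trans (ler_norm _) (FM _ dx).
have [c cP] := choice bk.
exists (\sum_(k < N.+1) `|c k|).
elim/tower_ind => [x ix|n x U dx uU IH|a b IHa IHb].
- have xN : (tdim x < N.+1)%N by rewrite ltnS irrN.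
  apply: (le_trans (cP _ x erefl)); apply: le_trans (ler_norm _) _.
  by rewrite (bigD1 (Ordinal xN))//= lerDl; apply: sumr_ge0.
- have -> : opnorm (F (tdim (tact U x)) (tact U x)) = opnorm (F n (tact U x)).
    by rewrite (tdim_tact dx uU).
  rewrite (field_act eF dx uU); subst n; exact: opnorm_conj.
- by rewrite tdim_sum (field_sum eF erefl erefl); exact: opnorm_dsum.
Qed.

Lemma cstar_of_field F : equivariant_field F ->
  (forall n, {within level n, continuous (F n)}) ->
  exists f, forall n x, tdim x = n -> cstar_eval f n x = F n x.
Proof.
move=> eF Fc.
have FE n x : tdim x = n -> as_mx n (F (tdim x) x) = F n x.
  by move=> dx; subst n; exact: as_mx_id.
suff fP : cstar_fun (fun x => F (tdim x) x) by exists (Cstar fP); exact: FE.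
split=> [n|x U uU|x y|].
- apply: subspace_eq_continuous (Fc n) => x; rewrite inE => dx.
  exact/esym/FE.
- by rewrite FE ?tdim_act// (field_act eF erefl uU) invmx_unitary.
- by rewrite FE ?tdim_sum// (field_sum eF erefl erefl).
- by apply/cnorm_ltP; exact: field_bounded.
Qed.

Hypothesis mT : m_tower T.

Lemma stab_castmx n m (e : n = m) x (U : 'M[C]_n) :
  stab n x U -> stab m x (castmx (e, e) U).
Proof. by subst m; rewrite castmx_id. Qed.

(** (mT4) for a single copy: a 1 x 1 matrix tensored with the unit is a scalar matrix, so the
    stabilizer of an irreducible is scalar. *)
Lemma stab_irreducible n p (U A : 'M[C]_n) : irreducible p -> tdim p = n ->
  stab n p U -> conj_mx U A = A.
Proof.
move=> ip dp; subst n => pU; have [uU _] := pU; apply/(conj_mx_commute _ uU).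
have := stab_castmx (esym (mul1n (tdim p))) pU.
rewrite (m_tower_stab_nfold mT ip (ltn0Sn 0)) => -[V _].
rewrite [V]mx11_scalar tens_scalar_mx => /(can_inj (castmxK _ _)) <-.
by rewrite -scalemxAl -scalemxAr mulmx1 mul1mx.
Qed.

Lemma eq_field_below F F' k : equivariant_field F -> equivariant_field F' ->
  (forall p, irreducible p -> (tdim p < k)%N -> F (tdim p) p = F' (tdim p) p) ->
  forall n x, tdim x = n -> (n < k)%N -> F n x = F' n x.
Proof.
move=> eF eF' irr n x dx; subst n.
elim/tower_ind : x => [//|n x U dx uU IH|a b IHa IHb].
  rewrite (tdim_tact dx uU) => nk.
  rewrite (field_act eF dx uU) (field_act eF' dx uU).
  by subst n; rewrite IH.
rewrite tdim_sum => abk.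
rewrite (field_sum eF erefl erefl) (field_sum eF' erefl erefl).
by rewrite (IHa (leq_ltn_trans (leq_addr _ _) abk))
  (IHb (leq_ltn_trans (leq_addl _ _) abk)).
Qed.

(** The equivariant Tietze theorem gives [h] on level [k]. The new field is regenerated from the
    irreducibles, with value [h] at those of dimension [k] and [F] at the others. Above [k] it may
    differ from [F], since summands of dimension [k] have changed. *)
Lemma extension_step F k (B : set T) (g : T -> 'M[C]_k) :
  equivariant_field F -> closed B -> red_level k `<=` B -> B `<=` level k ->
  {within B, continuous g} ->
  (forall x (U : 'M[C]_k), B x -> U \is unitarymx ->
    B (tact U x) /\ g (tact U x) = conj_mx U (g x)) ->
  (forall x, red_level k x -> g x = F k x) ->
  exists F', [/\ equivariant_field F', {within level k, continuous (F' k)},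
    forall n x, tdim x = n -> (n < k)%N -> F' n x = F n x
    & forall x, B x -> F' k x = g x].
Proof.
move=> eF clB redB Bk cg gU gF.
have [h [hc hU hg]] := equivariant_tietze properT clB Bk cg gU.
pose H n x : 'M[C]_n := if tdim x == k then as_mx n (h x) else F n x.
have HU n p (U : 'M[C]_n) : irreducible p -> tdim p = n -> U \is unitarymx ->
    H n (tact U p) = conj_mx U (H n p).
  move=> ip dp uU; rewrite /H (tdim_tact dp uU) dp.
  have [e|_] := eqVneq n k; last exact: (field_act eF dp uU).
  by subst k; rewrite !as_mx_id; exact: hU.
have [F' [eF' F'H]] := field_of_irreducibles HU mT.
have F'F n x : tdim x = n -> (n < k)%N -> F' n x = F n x.
  apply: eq_field_below => // p ip pk.
  by rewrite F'H// /H (ltn_eqF pk).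
(* At a reducible point both sides are forced by lower levels, where [F'] agrees with [F]. *)
have F'h x : tdim x = k -> F' k x = h x.
  move=> dx; have [rx|ix] := pselect (reducible x).
    have redx : red_level k x by split.
    rewrite (hg _ (redB _ redx)) (gF _ redx).
    have /reducibleP[a [b xab]] := rx.
    have [ax bx] := tequiv_dim_sum xab.
    have dab : tdim (tsum a b) = k by rewrite -(tequiv_dim xab).
    have /(tequivP _ dab)[U uU <-] := tequiv_sym xab.
    rewrite (field_act eF' dab uU) (field_act eF dab uU); congr conj_mx.
    rewrite dx in ax bx.
    have : F' (tdim a + tdim b)%N (tsum a b) = F (tdim a + tdim b)%N (tsum a b).
      rewrite (field_sum eF erefl erefl) (field_sum eF' erefl erefl).
      by rewrite (F'F _ _ erefl ax) (F'F _ _ erefl bx).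
    by rewrite -tdim_sum dab.
  by subst k; rewrite F'H// /H eqxx as_mx_id.
exists F'; split.
- exact: eF'.
- by apply: subspace_eq_continuous hc => x; rewrite inE => dx; exact/esym/F'h.
- exact: F'F.
- by move=> x Bx; rewrite (F'h _ (Bk _ Bx)) hg.
Qed.

(** Each step prescribes on the next level only the forced values at reducible points. [N] steps
    reach at least level [N]; above it every point is reducible and continuity is inherited from
    lower levels. *)
Lemma cstar_extension F k : equivariant_field F ->
  (forall n, (n <= k)%N -> {within level n, continuous (F n)}) ->
  exists f, forall n x, tdim x = n -> (n <= k)%N -> cstar_eval f n x = F n x.
Proof.
move=> eF Fc; have [N irrN] := finite_height heightT.
have ext m : exists F', [/\ equivariant_field F',
    forall n, (n <= k + m)%N -> {within level n, continuous (F' n)}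
    & forall n x, tdim x = n -> (n <= k)%N -> F' n x = F n x].
  elim: m => [|m [F' [eF' F'c F'F]]]; first by exists F; rewrite addn0; split.
  pose Rd := red_level (T := T) (k + m).+1.
  have clR : closed Rd by exact: red_level_closed.
  have cR : {within Rd, continuous (F' (k + m).+1)}.
    by apply: red_level_continuous => // i ik; exact: F'c.
  have RU x (U : 'M[C]_((k + m).+1)) : Rd x -> U \is unitarymx ->
      Rd (tact U x) /\ F' (k + m).+1 (tact U x) = conj_mx U (F' (k + m).+1 x).
    move=> rx uU; split; first exact: red_level_act.
    exact: (field_act eF' rx.1 uU).
  have [F2 [eF2 F2c F2F' _]] := extension_step eF' clR (fun _ => id)
    (@subIsetl _ _ _) cR RU (fun _ _ => erefl).
  exists F2; split; first exact: eF2.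
    move=> n; rewrite addnS leq_eqVlt => /orP[/eqP ->|nkm]; first exact: F2c.
    apply: subspace_eq_continuous (F'c n nkm) => x; rewrite inE => dx.
    exact/esym/(F2F' _ _ dx nkm).
  move=> n x dx nk; rewrite -(F'F _ _ dx nk); apply: (F2F' _ _ dx).
  by rewrite ltnS (leq_trans nk)// leq_addr.
have [F' [eF' F'c F'F]] := ext N.
have F'C n : {within level n, continuous (F' n)}.
  have [m] := ubnP n; elim: m n => // m IHm n nm.
  have [nN|Nn] := leqP n (k + N); first exact: F'c.
  have -> : level (T := T) n = red_level n.
    apply/seteqP; split=> [x dx|x []//]; split=> //.
    apply: contrapT => ix; move: Nn; rewrite -(dx : tdim x = n).
    by rewrite ltnNge (leq_trans (irrN x ix))// leq_addl.
  apply: red_level_continuous => // i iN; apply: IHm.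
  exact: leq_trans iN nm.
have [f fF'] := cstar_of_field eF' F'C.
by exists f => n x dx nk; rewrite fF'// F'F.
Qed.

Lemma zero_equivariant_field : equivariant_field (fun n (_ : T) => 0 : 'M[C]_n).
Proof.
split=> [n x U _ _|n m x y _ _]; first by rewrite /conj_mx mulmx0 mul0mx.
by rewrite /dsum_mx block_mx0.
Qed.

(** The value at U.x is U.A, well defined because the stabilizer of an irreducible is scalar; on
    [Z], disjoint from the orbit by invariance, it is 0. The zero field serves on lower levels,
    consistently with the value 0 at reducible points. *)
Lemma cstar_prescribed n x (A : 'M[C]_n) (Z : set T) :
  irreducible x -> tdim x = n -> closed Z -> red_level n `<=` Z ->
  Z `<=` level n ->
  (forall z (U : 'M[C]_n), Z z -> U \is unitarymx -> Z (tact U z)) ->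
  ~ Z x -> exists f, [/\ cstar_eval f n x = A,
    forall z, Z z -> cstar_eval f n z = 0
    & forall z, (tdim z < n)%N -> f z = 0].
Proof.
move=> ix dx clZ redZ Zn ZU nZx.
pose m (U : 'M[C]_n) := tact U x.
pose O := m @` unitary_set R n.
have mc : {within unitary_set R n, continuous m} by exact: orbit_map_continuous.
have clO : closed O.
  apply: compact_closed; first exact: tower_hausdorff.
  by apply: continuous_compact mc _; exact: unitary_compact.
have ZO z : Z z -> O z -> False.
  move=> Zz [U uU Uz]; apply: nZx; rewrite -(tactK dx uU).
  by apply: ZU (unitary_tc uU); rewrite /m in Uz; rewrite Uz.
have gex z : exists B : 'M[C]_n,
    (forall U, U \is unitarymx -> m U = z -> B = conj_mx U A) /\
    (~ O z -> B = 0).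
  have [[U uU Uz]|nOz] := pselect (O z); last first.
    exists 0; split=> // U uU Uz; exfalso; apply: nOz; exists U => //.
  exists (conj_mx U A); split=> [V uV Vz|nOz]; last first.
    by exfalso; apply: nOz; exists U.
  have uVU := unitary_mul (unitary_tc uV) uU.
  have sVU : stab n x (V^t* *m U).
    split; first exact: uVU.
    by rewrite (tact_comp dx (unitary_tc uV) uU) -/(m U) Uz -Vz /m
      (tactK dx uV).
  have := stab_irreducible A ix dx sVU.
  by rewrite conj_mxM => /(congr1 (conj_mx V)); rewrite (conj_mxKV _ uV).
have [g gP] := choice gex.
have gm U : U \is unitarymx -> g (m U) = conj_mx U A.
  by move=> uU; exact: (gP _).1.
have gZ z : Z z -> g z = 0 by move=> Zz; apply: (gP z).2; exact: ZO.
have cg : {within Z `|` O, continuous g}.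
  apply: withinU_continuous => //.
    have c0 : {within Z, continuous (fun _ : T => 0 : 'M[C]_n)}.
      by apply: continuous_subspaceT => z; exact: cvg_cst.
    by apply: subspace_eq_continuous c0 => z; rewrite inE => /gZ.
  apply: (within_continuous_image (@unitary_compact R n)) => //.
    exact: tower_hausdorff.
  have c1 : {within unitary_set R n, continuous (fun U => conj_mx U A)}.
    apply: continuous_subspaceT => U.
    have cU : (fun V : 'M[C]_n => V) @ U --> U by exact: cvg_id.
    by apply: (cvg_conj_mx cU); exact: cvg_cst.
  by apply: subspace_eq_continuous c1 => U; rewrite inE => uU; exact/esym/gm.
have On z : O z -> level n z by move=> [U uU <-]; exact: tdim_tact.
have gU z (U : 'M[C]_n) : (Z `|` O) z -> U \is unitarymx ->
    (Z `|` O) (tact U z) /\ g (tact U z) = conj_mx U (g z).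
  move=> [Zz|[V uV <-]] uU.
    have ZUz := ZU _ _ Zz uU; split; first by left.
    by rewrite (gZ _ Zz) (gZ _ ZUz) /conj_mx mulmx0 mul0mx.
  have E : tact U (m V) = m (U *m V) by rewrite /m (tact_comp dx uU uV).
  rewrite E (gm _ (unitary_mul uU uV)) (gm _ uV) conj_mxM; split=> //.
  right; exact: (imageP m (unitary_mul uU uV : unitary_set R n (U *m V))).
have [F [eF Fc F0 Fg]] := extension_step zero_equivariant_field
  (closedU clZ clO) (subset_trans redZ (@subsetUl _ _ _))
  (fun z => fun h => match h with or_introl a => Zn z a | or_intror b => On z b
    end)
  cg gU (fun z rz => gZ z (redZ z rz)).
have Fc' k : (k <= n)%N -> {within level k, continuous (F k)}.
  rewrite leq_eqVlt => /orP[/eqP ->|kn]; first exact: Fc.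
  have c0 : {within level k, continuous (fun _ : T => 0 : 'M[C]_k)}.
    by apply: continuous_subspaceT => z; exact: cvg_cst.
  apply: subspace_eq_continuous c0 => z; rewrite inE => dz.
  exact/esym/(F0 _ _ dz kn).
have [f fF] := cstar_extension eF Fc'.
exists f; split.
- rewrite fF// Fg; last by right; exists 1%:M;
  [exact: unitarymx1|exact: tact_id].
  by rewrite -[x in LHS](tact_id dx) gm ?conj_mx1//; exact: unitarymx1.
- by move=> z Zz; rewrite fF ?Fg ?gZ//; [left|exact: Zn].
- move=> z zn; rewrite -cstar_evalE fF ?(ltnW zn)//; exact: F0.
Qed.

End ContinuousFields.

(** * Commutants, and separation of points by C*(T) *)

Section MatrixCommutants.
Variable R : realType.
Local Notation C := R[i].

(** Commutation with the matrix unit at (c, j0) tensored by 1, read at row (a, b) and column (a',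
    j0), says that the entry of [W] at (a, b), (a', c) is U(a, a') if b = c and 0 otherwise. *)
Lemma commutant_tens k d (W : 'M[C]_(k * d)) : (0 < d)%N ->
  (forall A : 'M[C]_d, W *m ((1%:M : 'M[C]_k) *t A) = (1%:M *t A) *m W) ->
  exists U : 'M[C]_k, W = U *t 1%:M.
Proof.
move=> d0 WA; pose j0 := Ordinal d0.
pose U : 'M[C]_k := \matrix_(a, a')
  W (mxtens_index (a, j0)) (mxtens_index (a', j0)).
have sumE (f : 'I_(k * d) -> C) :
    \sum_r f r = \sum_a \sum_b f (mxtens_index (a, b)).
  rewrite pair_bigA (reindex (@mxtens_index k d)) /=; last first.
    by exists (@mxtens_unindex k d) => i _;
      rewrite ?mxtens_indexK ?mxtens_unindexK.
  by apply: eq_bigr => -[a b].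
exists U; apply/matrixP => r s.
case: (mxtens_indexP r) => a b; case: (mxtens_indexP s) => a' c.
rewrite tensmxE !mxE.
have := congr1 (fun M : 'M[C]_(k * d) =>
  M (mxtens_index (a, b)) (mxtens_index (a', j0)))
  (WA (delta_mx c j0)).
rewrite !mxE !sumE.
rewrite (bigD1 a') //= [X in _ + X]big1 ?addr0; last first.
  move=> a'' /negPf na; apply: big1 => b' _.
  by rewrite tensmxE !mxE na mul0r mulr0.
rewrite (bigD1 c) //= [X in _ + X]big1 ?addr0; last first.
  by move=> b' /negPf nb; rewrite tensmxE !mxE nb mulr0 mulr0.
rewrite tensmxE !mxE !eqxx !mulr1 => ->.
rewrite (bigD1 a) //= [X in _ + X]big1 ?addr0; last first.
  move=> a'' /negPf na; apply: big1 => b' _.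
  by rewrite tensmxE !mxE eq_sym na mul0r mul0r.
rewrite (bigD1 j0) //= [X in _ + X]big1 ?addr0; last first.
  by move=> b' /negPf nb; rewrite tensmxE !mxE nb andbF mulr0 mul0r.
by rewrite tensmxE !mxE !eqxx andbT mul1r mulrC.
Qed.

Lemma tens1_unitary k d (U : 'M[C]_k) : (0 < d)%N ->
  (U *t (1%:M : 'M[C]_d)) \is unitarymx -> U \is unitarymx.
Proof.
move=> d0 /unitarymxP; rewrite trmx_tens map_mxT tensmx_mul trmx1 map_mx1
  mulmx1.
rewrite -(tens1mx1 _ k d) => E; apply/unitarymxP/matrixP => a b.
have := congr1 (fun M : 'M[C]_(k * d) => M (mxtens_index (a, Ordinal d0))
  (mxtens_index (b, Ordinal d0))) E.
by rewrite !tensmxE !mxE eqxx !mulr1.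
Qed.

Lemma dsum_mx_inj n m (A A' : 'M[C]_n) (B B' : 'M[C]_m) :
  dsum_mx A B = dsum_mx A' B' -> A = A' /\ B = B'.
Proof. by move=> /eq_block_mx[]. Qed.

Lemma dsum_unitary_inv n m (A : 'M[C]_n) (B : 'M[C]_m) :
  dsum_mx A B \is unitarymx -> A \is unitarymx /\ B \is unitarymx.
Proof.
move=> /unitarymxP; rewrite -dsum_mx_adj -dsum_mxM -dsum_mx1.
by move=> /dsum_mx_inj[/unitarymxP uA /unitarymxP uB].
Qed.

Lemma commute_dsum10 n m (W : 'M[C]_(n + m)) :
  W *m dsum_mx 1%:M 0 = dsum_mx 1%:M 0 *m W ->
  W = dsum_mx (ulsubmx W) (drsubmx W).
Proof.
rewrite -[W]submxK /dsum_mx !mulmx_block ?(mulmx0, mul0mx, mulmx1, mul1mx,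
  addr0, add0r).
move=> /eq_block_mx[_ e1 e2 _].
by rewrite !block_mxKul !block_mxKdr e2 -e1.
Qed.

Lemma mxtrace_dsum n m (A : 'M[C]_n) (B : 'M[C]_m) :
  \tr (dsum_mx A B) = \tr A + \tr B.
Proof. exact: mxtrace_block. Qed.

Lemma mxtrace_conj n (U A : 'M[C]_n) : U \is unitarymx ->
  \tr (conj_mx U A) = \tr A.
Proof.
by move=> uU; rewrite /conj_mx mxtrace_mulC mulmxA (mulmx_unitarytc uU) mul1mx.
Qed.

End MatrixCommutants.

Section Separation.
Variables (R : realType) (T : tower R).
Local Notation C := R[i].
Implicit Types (x y z a b p : T) (f : cstar T).

Lemma cstar_eval_act f n x (U : 'M[C]_n) : tdim x = n -> U \is unitarymx ->
  cstar_eval f n (tact U x) = conj_mx U (cstar_eval f n x).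
Proof. exact: field_act (cstar_eval_field f) _ _ _. Qed.

Lemma cstar_eval_sum f n m x y : tdim x = n -> tdim y = m ->
  cstar_eval f (n + m)%N (tsum x y) =
  dsum_mx (cstar_eval f n x) (cstar_eval f m y).
Proof. exact: field_sum (cstar_eval_field f) _ _ _ _. Qed.

Lemma mxtrace_cstar_equiv f x y : tequiv x y -> \tr (f x) = \tr (f y).
Proof.
move=> [U uU <-]; rewrite -!cstar_evalE (tdim_act uU).
by rewrite (cstar_eval_act f erefl uU) mxtrace_conj.
Qed.

Lemma mxtrace_cstar_sum f x y : \tr (f (tsum x y)) = \tr (f x) + \tr (f y).
Proof.
by rewrite -!cstar_evalE tdim_sum (cstar_eval_sum f erefl erefl) mxtrace_dsum.
Qed.

Hypotheses (properT : proper_tower T) (heightT : (height T < +oo)%E).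
Hypothesis mT : m_tower T.

Lemma cstar_irr_surj p (A : 'M[C]_(tdim p)) : irreducible p ->
  exists f, f p = A.
Proof.
move=> ip; have [|f [fA _ _]] :=
  @cstar_prescribed R T properT heightT mT _ p A _ ip erefl
  (@red_level_closed R T properT (tdim p)) (fun _ => id) (@subIsetl _ _ _)
  (@red_level_act R T _); first by case.
by exists f; rewrite -cstar_evalE.
Qed.

(** A function equal to 1 at the point of larger dimension can be made 0 on all lower levels and,
    for equal dimensions, on the orbit of the other point; if [y] is the larger one, [1 - f] is
    taken. *)
Lemma cstar_separates_irr x y : irreducible x -> irreducible y ->
  ~ tequiv x y -> exists f, f x = 1%:M /\ f y = 0.
Proof.
have main a b : irreducible a -> irreducible b -> (tdim b <= tdim a)%N ->
    ~ tequiv b a -> exists f, f a = 1%:M /\ f b = 0.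
  move=> ia ib; rewrite leq_eqVlt => /orP[/eqP dba|dba] nba; last first.
    have [|f [fa _ f0]] :=
      @cstar_prescribed R T properT heightT mT _ a 1%:M _ ia erefl
      (@red_level_closed R T properT (tdim a)) (fun _ => id) (@subIsetl _ _ _)
      (@red_level_act R T _); first by case.
    by exists f; rewrite -cstar_evalE fa f0.
  pose Z := red_level (T := T) (tdim a) `|` [set z | tequiv b z].
  have clZ : closed Z.
    by apply: closedU; [exact: red_level_closed|exact: tequiv_closed].
  have Zn : Z `<=` level (tdim a).
    by move=> z [[]//|bz]; rewrite /level /= -(tequiv_dim bz).
  have ZU z (U : 'M[C]_(tdim a)) : Z z -> U \is unitarymx -> Z (tact U z).
    move=> Zz uU; have dz := Zn _ Zz; have zUz := tequiv_act dz uU.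
    case: Zz => [rz|bz]; [left|right]; last exact: tequiv_trans bz zUz.
    exact: red_level_act.
  have nZa : ~ Z a by case=> [[_ /ia]|/nba].
  have [f [fa fZ _]] := @cstar_prescribed R T properT heightT mT _ a 1%:M Z ia
    erefl clZ (@subsetUl _ _ _) Zn ZU nZa.
  exists f; split; first by rewrite -cstar_evalE.
  by rewrite -cstar_evalE dba; apply: fZ; right; exact: tequiv_refl.
move=> ix iy nxy; have [dyx|/ltnW dxy] := leqP (tdim y) (tdim x).
  by apply: main => // /tequiv_sym.
have [f [fy fx]] := main _ _ iy ix dxy nxy.
exists (cstar_add (cstar_one T) (cstar_opp f)); split=> /=.
  by rewrite fx scaler0 addr0.
by rewrite fy scaleN1r subrr.
Qed.

(** At a sum, the product of functions vanishing at either summand vanishes, while it is still the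
    unit at [p]. *)
Lemma cstar_separates p y : irreducible p -> ~ tprec p y ->
  exists f, f p = 1%:M /\ f y = 0.
Proof.
move=> ip; elim/tower_ind : y => [y iy npy|n x U dx uU IH npx|a b IHa IHb npab].
- by apply: cstar_separates_irr => // py; apply: npy; left.
- have [|f [fp fx]] := IH.
    move=> px; apply: npx; apply: tprec_equiv px; first exact: tequiv_refl.
    exact: tequiv_act dx uU.
  exists f; split=> //; rewrite -cstar_evalE (tdim_tact dx uU).
  rewrite cstar_eval_act// /cstar_eval fx as_mx0.
  by rewrite /conj_mx mulmx0 mul0mx.
- have [|f [fp fa]] := IHa.
    by move=> pa; apply: npab; apply: tprec_trans pa (tprec_suml _ _).
  have [|g [gp gb]] := IHb.
    by move=> pb; apply: npab; apply: tprec_trans pb (tprec_sumr _ _).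
  exists (cstar_mul f g); split; first by rewrite /= fp gp mulmx1.
  rewrite -cstar_evalE tdim_sum (cstar_eval_sum _ erefl erefl) !cstar_evalE /=.
  by rewrite fa gb mulmx0 mul0mx /dsum_mx block_mx0.
Qed.

(** The analogue of characters determining a representation. If [p] occurs in [x] but not in [y],
    take [f] equal to 1 at [p] and 0 at [y]: as f f^* is positive, its trace at [x] is at least that
    at [p], hence nonzero. So [p] occurs in both and can be split off. *)
Lemma mxtrace_cstar_inj x y : (forall f, \tr (f x) = \tr (f y)) -> tequiv x y.
Proof.
have [n] := ubnP (tdim x); elim: n x y => // n IHn x y xn trE.
have dxy : tdim x = tdim y.
  have := trE (cstar_one T); rewrite /= !mxtrace1 => /eqP.
  by rewrite eqr_nat => /eqP.
have [p ip px] := exists_irreducible_prec x.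
have py : tprec p y.
  apply: contrapT => npy; have [f [fp fy]] := cstar_separates ip npy.
  pose g := cstar_mul f (cstar_adj f).
  have gp : \tr (g p) = (tdim p)%:R by rewrite /g /= fp trmxC1 mulmx1 mxtrace1.
  have gy : \tr (g y) = 0 by rewrite /g /= fy mul0mx mxtrace0.
  have : \tr (g x) != 0.
    move/tprecP : px => [xp|[b xpb]].
      by rewrite (mxtrace_cstar_equiv g xp) gp pnatr_eq0 -lt0n tdim_gt0.
    rewrite (mxtrace_cstar_equiv g xpb) mxtrace_cstar_sum gp.
    rewrite gt_eqF// ltr_pwDl ?ltr0n ?tdim_gt0//.
    by rewrite -fnorm_trace lecR sqr_ge0.
  by rewrite trE gy eqxx.
move/tprecP : px => [xp|[b xpb]]; move/tprecP : py => [yp|[c ypc]].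
- exact: tequiv_trans xp (tequiv_sym yp).
- have [] := tequiv_dim_sum ypc.
  by rewrite -dxy (tequiv_dim xp) ltnn.
- have [] := tequiv_dim_sum xpb.
  by rewrite dxy (tequiv_dim yp) ltnn.
- apply: (tequiv_trans xpb (tequiv_trans _ (tequiv_sym ypc))).
  apply: tequiv_sum; first exact: tequiv_refl.
  apply: IHn; first exact: leq_trans (tequiv_dim_sum xpb).2 xn.
  move=> f; have := trE f.
  rewrite (mxtrace_cstar_equiv f xpb) (mxtrace_cstar_equiv f ypc).
  by rewrite !mxtrace_cstar_sum => /addrI.
Qed.

Lemma tdim_nfold k p : (0 < k)%N -> tdim (nfold k p) = (k * tdim p)%N.
Proof.
case: k => // k _; elim: k => [|k IHk]; first by rewrite mul1n.
by rewrite mulSn -IHk; exact: tdim_sum.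
Qed.

Lemma cstar_eval_nfold f k p : (0 < k)%N ->
  cstar_eval f (k * tdim p)%N (nfold k p) = (1%:M : 'M[C]_k) *t f p.
Proof.
case: k => // k _; elim: k => [|k IHk].
  rewrite tens_scalar1mx /nfold /=.
  move: (esym (mul1n _)); rewrite mul1n => e.
  by rewrite castmx_id cstar_evalE.
have := cstar_eval_sum f (erefl (tdim p)) (@tdim_nfold k.+1 p isT).
rewrite IHk cstar_evalE => E.
by apply: etrans E _; exact: (tens1mxS k.+1).
Qed.

(** Equivariance puts the stabilizer of [x] into the commutant of all values at [x]; this is the
    converse for unitaries, proved along the decomposition into multiples of irreducibles. *)
Let commutant_in_stab n x := forall W : 'M[C]_n, W \is unitarymx ->
  (forall f, W *m cstar_eval f n x = cstar_eval f n x *m W) -> tact W x = x.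

Let commutant_in_stab_equiv n x y : tdim x = n -> tequiv x y ->
  commutant_in_stab n y -> commutant_in_stab n x.
Proof.
move=> dx /(tequivP _ dx)[U uU <-] cy W uW Wf.
have uWU := unitary_mul uW (unitary_tc uU); have uV := unitary_mul uU uWU.
have := cy _ uV => H.
have {H} : tact (U *m (W *m U^t* )) (tact U x) = tact U x.
  apply: H => f; apply/(conj_mx_commute _ uV).
  rewrite (cstar_eval_act f dx uU) !conj_mxM (conj_mxK _ uU).
  by rewrite ((conj_mx_commute _ uW).2 (Wf f)).
have dUx := tdim_tact dx uU.
rewrite (tact_comp dUx uU uWU) (tact_comp dUx uW (unitary_tc uU)) (tactK dx uU).
move=> /(congr1 (tact (U^t* ))).
by rewrite (tactK (tdim_tact dx uW) uU) (tactK dx uU).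
Qed.

(** The values are [1 *t A] with arbitrary [A], so their commutant consists of the [U *t 1], which
    stabilize by (mT4). *)
Let commutant_in_stab_nfold k p : irreducible p -> (0 < k)%N ->
  commutant_in_stab (k * tdim p) (nfold k p).
Proof.
move=> ip k0 W uW Wf.
have [A|U WU] := @commutant_tens R k (tdim p) W (tdim_gt0 p).
  by have [f fA] := cstar_irr_surj A ip; have := Wf f;
    rewrite cstar_eval_nfold// fA.
have uU : U \is unitarymx.
  by apply: (tens1_unitary (tdim_gt0 p)); rewrite -WU.
suff [_ ->] : stab (k * tdim p) (nfold k p) W by [].
by rewrite (m_tower_stab_nfold mT ip k0) WU; exists U.
Qed.

(** The function [e] evaluates to the projection onto the first block, which forces [W] to be block
    diagonal. *)
Let commutant_in_stab_sum n m x y : tdim x = n -> tdim y = m ->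
  (exists e, cstar_eval e n x = 1%:M /\ cstar_eval e m y = 0) ->
  commutant_in_stab n x -> commutant_in_stab m y ->
  commutant_in_stab (n + m) (tsum x y).
Proof.
move=> dx dy [e [ex ey]] cx cy W uW Wf.
have := Wf e; rewrite (cstar_eval_sum e dx dy) ex ey => /commute_dsum10 WE.
rewrite WE in uW; have [uW1 uW2] := dsum_unitary_inv uW.
rewrite WE (tact_dsum dx dy uW1 uW2).
have W12 f : ulsubmx W *m cstar_eval f n x = cstar_eval f n x *m ulsubmx W /\
    drsubmx W *m cstar_eval f m y = cstar_eval f m y *m drsubmx W.
  have := Wf f; rewrite (cstar_eval_sum f dx dy) [in X in X -> _]WE -!dsum_mxM.
  exact: dsum_mx_inj.
by rewrite (cx _ uW1 (fun f => (W12 f).1)) (cy _ uW2 (fun f => (W12 f).2)).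
Qed.

Lemma commutant_stab x : commutant_in_stab (tdim x) x.
Proof.
have [m] := ubnP (tdim x); elim: m x => // m IHm x xm.
have [p ip px] := exists_irreducible_prec x.
have [k k0 [xk|[y py xky]]] := irreducible_decomp ip px.
  apply: (commutant_in_stab_equiv erefl xk).
  rewrite (tequiv_dim xk) tdim_nfold//; exact: commutant_in_stab_nfold.
apply: (commutant_in_stab_equiv erefl xky).
rewrite (tequiv_dim xky) tdim_sum (tdim_nfold _ k0).
apply: commutant_in_stab_sum => //; first exact: tdim_nfold.
- have [|e [ep ey]] := @cstar_separates p y ip.
    by move=> npy; apply: py; exists p; split=> //; exact: tprec_refl.
  exists e; rewrite (cstar_eval_nfold _ _ k0) ep tens1mx1; split=> //.
  by rewrite cstar_evalE.
- exact: commutant_in_stab_nfold.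
- apply: IHm; exact: leq_trans (tequiv_dim_sum xky).2 xm.
Qed.

(** Equal traces give a unitary [W] with W.x = y; as all values at [x] and [y] agree, [W] commutes
    with those at [x] and hence fixes [x]. *)
Lemma cstar_eval_inj n x y : tdim x = n -> tdim y = n ->
  (forall f, cstar_eval f n x = cstar_eval f n y) -> x = y.
Proof.
move=> dx dy E.
have : tequiv x y.
  apply: mxtrace_cstar_inj => f; rewrite -!cstar_evalE.
  by subst n; rewrite dy E.
move/(tequivP _ dx) => [W uW Wx]; rewrite -Wx.
subst n; apply/esym/commutant_stab => // f; apply/(conj_mx_commute _ uW).
by rewrite -(cstar_eval_act f erefl uW) Wx E.
Qed.

End Separation.

(** * Inverses, and representations that kill no point *)

Section InverseContinuity.
Variable R : realType.
Local Notation C := R[i].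
Context {X : Type} {F : set_system X} {FF : Filter F}.

Lemma cvg_det n (f : X -> 'M[C]_n) (A : 'M[C]_n) :
  f @ F --> A -> (fun x => \det (f x)) @ F --> \det A.
Proof.
move=> /mx_cvgP fA; rewrite /determinant.
apply: cvg_big => [|s _]; first exact: (@add_continuous R[i]).
apply: cvgM; first exact: cvg_cst.
by apply: cvg_big => [|i _]; [exact: (@mul_continuous R[i])|exact: fA].
Qed.

Lemma cvg_invmx n (f : X -> 'M[C]_n) (A : 'M[C]_n) : A \in unitmx ->
  (\forall x \near F, f x \in unitmx) ->
  f @ F --> A -> (fun x => invmx (f x)) @ F --> invmx A.
Proof.
move=> uA uf fA.
have dA := cvg_det fA.
have adjA : (fun x => (\det (f x))^-1 *: \adj (f x)) @ F --> invmx A.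
  have dA0 : \det A != 0 by rewrite -unitfE -unitmxE.
  have c1 : (fun x => (\det (f x))^-1) @ F --> (\det A)^-1.
    exact: cvgV dA0 dA.
  rewrite /invmx uA; apply/mx_cvgP => i j.
  have E (M : 'M[C]_n) : ((\det M)^-1 *: \adj M) i j =
      (\det M)^-1 * ((-1) ^+ (j + i) * \det (row' j (col' i M))).
    by rewrite !mxE.
  have Ef : (fun x => ((\det (f x))^-1 *: \adj (f x)) i j) = (fun x =>
      (\det (f x))^-1 * ((-1) ^+ (j + i) * \det (row' j (col' i (f x))))).
    by apply/funext => x; exact: E.
  have c0 : (fun x => row' j (col' i (f x))) @ F --> row' j (col' i A).
    apply/mx_cvgP => a b; rewrite !mxE.
    have -> : (fun x => row' j (col' i (f x)) a b) =
      (fun x => f x (lift j a) (lift i b)) by apply/funext => x; rewrite !mxE.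
    by move/mx_cvgP : fA; apply.
  have c2 := cvg_det c0.
  have c3 : (fun x => (-1) ^+ (j + i) * \det (row' j (col' i (f x)))) @ F -->
      (-1) ^+ (j + i) * \det (row' j (col' i A)).
    exact: cvgM (cvg_cst _) c2.
  have c4 : (fun x =>
      (\det (f x))^-1 * ((-1) ^+ (j + i) * \det (row' j (col' i (f x))))) @ F
        -->
      (\det A)^-1 * ((-1) ^+ (j + i) * \det (row' j (col' i A))).
    exact: cvgM c1 c3.
  by rewrite Ef (E A).
apply: cvg_trans adjA; apply: near_eq_cvg.
by apply: filterS uf => x ux; rewrite /invmx ux.
Qed.

End InverseContinuity.

Section UnitaryCompletion.
Variable R : realType.
Local Notation C := R[i].

Lemma unitary_completion d n (V : 'M[C]_(d, n)) : V *m V^t* = 1%:M ->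
  exists m (W : 'M[C]_(m, n)),
    [/\ n = (d + m)%N, W *m W^t* = 1%:M & V *m W^t* = 0].
Proof.
move=> /unitarymxP uV.
set O := (orthomx Num.Def.conjC (hermitian1mx n) V).
have rO : \rank O = (n - d)%N by rewrite rank_ortho mxrank_unitary.
have dn : (d <= n)%N by rewrite -(mxrank_unitary uV) rank_leq_col.
exists (\rank O), (schmidt (row_base O)); split.
- by rewrite rO subnKC.
- by apply/unitarymxP/schmidt_unitarymx; exact: rank_leq_col.
have sO : (schmidt (row_base O) <= O)%MS.
  rewrite (eqmx_schmidt_free (row_base_free _)); by rewrite eq_row_base.
have /orthomx1P := sO.
move=> /(congr1 (fun M => M^t* )); rewrite trmxC_mul trmxCK => ->.
by rewrite trmx0 map_mx0.
Qed.

Lemma row_dot_eq0 n (u : 'rV[C]_n) : (u *m u^t* ) 0 0 = 0 -> u = 0.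
Proof.
have -> : (u *m u^t* ) 0 0 = (l2norm (u^t* ) ^+ 2)%:C%C.
  by rewrite l2norm_dot trmxCK.
move/complexI/eqP; rewrite sqrf_eq0 => /eqP/l2norm_eq0 u0.
by rewrite -[u]trmxCK u0 trmx0 map_mx0.
Qed.

Lemma row_dot_ge0 n (u : 'rV[C]_n) : 0 <= (u *m u^t* ) 0 0.
Proof.
have -> : (u *m u^t* ) 0 0 = (l2norm (u^t* ) ^+ 2)%:C%C.
  by rewrite l2norm_dot trmxCK.
by rewrite lecR sqr_ge0.
Qed.

(** Multiplied by the adjoint of [u], the hypothesis says that the squared lengths of the rows
    [u *m A g] sum to 0. *)
Lemma sum_mul_trmxC_kernel (I : eqType) (s : seq I) n (A : I -> 'M[C]_n)
    (u : 'rV[C]_n) :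
  u *m (\sum_(g <- s) A g *m (A g)^t* ) = 0 ->
  forall g, g \in s -> u *m A g = 0.
Proof.
move=> E g gs; apply: row_dot_eq0.
have : \sum_(g <- s) ((u *m A g) *m (u *m A g)^t* ) 0 0 = 0.
  transitivity ((u *m (\sum_(g <- s) A g *m (A g)^t* ) *m u^t* ) 0 0);
    last first.
    by rewrite E mul0mx mxE.
  rewrite mulmx_sumr mulmx_suml summxE; apply: eq_bigr => k _.
  by rewrite trmxC_mul !mulmxA.
rewrite (big_rem g gs) /= => /eqP; rewrite paddr_eq0 ?row_dot_ge0//.
  by move=> /andP[/eqP].
by apply: sumr_ge0 => k _; exact: row_dot_ge0.
Qed.

Lemma unitmx_rowP n (A : 'M[C]_n) :
  A \in unitmx <-> forall u : 'rV[C]_n, u *m A = 0 -> u = 0.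
Proof.
split=> [uA u uA0|inj]; first by rewrite -(mulmxK uA u) uA0 mul0mx.
rewrite -row_free_unit -kermx_eq0; apply/negP => /negP/rowV0Pn[v].
by move=> /sub_kermxP/inj ->; rewrite eqxx.
Qed.

End UnitaryCompletion.

Record star_representation (R : realType) (T : tower R) n
    (pi : cstar T -> 'M[R[i]]_n) : Prop := {
  rep_linear : forall a f g, pi (a *: f + g) = a *: pi f + pi g;
  rep1 : pi 1 = 1%:M;
  repM : forall f g, pi (f * g) = pi f *m pi g;
  rep_adj : forall f, pi (cstar_adj f) = (pi f)^t*
}.

Lemma castmx_unit (R : realType) n m (e : n = m) (A : 'M[R[i]]_n) :
  (castmx (e, e) A \in unitmx) = (A \in unitmx).
Proof. by subst m; rewrite castmx_id. Qed.

Lemma castmx_mulDZ1 (R : realType) n m (e : n = m) (A B : 'M[R[i]]_n) c :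
  castmx (e, e) (A *m B + c *: 1%:M) =
  castmx (e, e) A *m castmx (e, e) B + c%:M.
Proof. by subst m; rewrite !castmx_id scalemx1. Qed.

Section Representations.
Variables (R : realType) (T : tower R).
Local Notation C := R[i].
Implicit Types (x y z a b p : T) (f g h : cstar T) (s : seq (cstar T)).

Lemma cstar_sumE s (F : cstar T -> cstar T) x :
  (\sum_(g <- s) F g) x = \sum_(g <- s) F g x.
Proof. by elim/big_rec2: _ => //= g u v _ <-. Qed.

Variables (n : nat) (pi : cstar T -> 'M[C]_n).
Hypothesis rpi : star_representation pi.

Lemma repD f g : pi (f + g) = pi f + pi g.
Proof. by rewrite -[f]scale1r (rep_linear rpi) !scale1r. Qed.

Lemma rep0 : pi 0 = 0.
Proof. by apply: (addrI (pi 0)); rewrite -repD !addr0. Qed.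

Lemma repZ c f : pi (c *: f) = c *: pi f.
Proof. by rewrite -[c *: f]addr0 (rep_linear rpi) rep0 addr0. Qed.

Lemma repN f : pi (- f) = - pi f.
Proof. by rewrite -scaleN1r repZ scaleN1r. Qed.

Lemma rep_sum s (F : cstar T -> cstar T) :
  pi (\sum_(g <- s) F g) = \sum_(g <- s) pi (F g).
Proof. by elim/big_rec2: _ => [|g u v _ <-]; [exact: rep0|exact: repD]. Qed.

(** Take [s] with image of largest rank. The kernel of that image is the common kernel of the
    [pi g], so a nonzero vector in it is moved by some [h], and adding [h] to [s] would shrink the
    kernel. *)
Lemma rep_invertible_sum (P : cstar T -> Prop) :
  (forall u : 'rV[C]_n, u != 0 -> exists2 h, P h & u *m pi h != 0) ->
  exists2 s, forall h, h \in s -> P h &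
    pi (\sum_(g <- s) g * cstar_adj g) \in unitmx.
Proof.
move=> ex; pose a s := pi (\sum_(g <- s) g * cstar_adj g).
have aE s : a s = \sum_(g <- s) pi g *m (pi g)^t*.
  by rewrite /a rep_sum; apply: eq_bigr => g _;
    rewrite (repM rpi) (rep_adj rpi).
pose Q k := `[< exists2 s, forall h, h \in s -> P h & \rank (a s) = k >].
have Q0 : exists k, Q k by exists (\rank (a [::])); apply/asboolP; exists [::].
have Qn k : Q k -> (k <= n)%N by move=> /asboolP[s _ <-]; exact: rank_leq_row.
case: (ex_maxnP Q0 Qn) => k /asboolP[s sP sk] kmax.
exists s => //; rewrite -/(a s); apply/unitmx_rowP => u uas.
apply/eqP; apply: contrapT => /negP u0.
have [h Ph uh] := ex u u0.
have : (\rank (a (h :: s)) <= k)%N.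
  apply: kmax; apply/asboolP; exists (h :: s) => // h'.
  by rewrite inE => /predU1P[->|/sP].
rewrite leqNgt -sk => /negP; apply.
have lt : (kermx (a (h :: s)) < kermx (a s))%MS.
  rewrite ltmxE; apply/andP; split.
    apply/rV_subP => v /sub_kermxP va; apply/sub_kermxP.
    rewrite aE in va; rewrite aE mulmx_sumr big_seq big1// => g gs.
    by rewrite mulmxA (sum_mul_trmxC_kernel va) ?mul0mx// inE gs orbT.
  apply/negP => sub; move: uh;
    rewrite (@sum_mul_trmxC_kernel R _ (h :: s)) ?eqxx//.
    by rewrite -aE; apply/sub_kermxP/(submx_trans _ sub); exact/sub_kermxP.
  by rewrite inE eqxx.
move/rank_ltmx : lt; rewrite (mxrank_ker (a s)) (mxrank_ker (a (h :: s))) => lt.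
by rewrite ltnNge; apply: contraL lt => le; rewrite -leqNgt leq_sub2l.
Qed.

(** Here [f] is q(h); at [x], where [h] vanishes, only the constant term survives. The cast is there
    because [horner_mx] wants a size of the form [m.+1]. *)
Lemma rep_horner h x : h x = 0 -> forall (q : {poly C}) m (e : n = m.+1),
  exists2 f : cstar T, f x = (q.[0])%:M &
    castmx (e, e) (pi f) = horner_mx (castmx (e, e) (pi h)) q.
Proof.
move=> hx; elim/poly_ind => [|q c IHq] m e.
  exists 0; first by rewrite horner0 -scalemx1 scale0r.
  by rewrite rep0 rmorph0 castmx_const.
have [f fx pf] := IHq m e.
exists (f * h + c *: (1 : cstar T)).
  rewrite hornerMXaddC mulr0 add0r /= hx mulmx0 add0r.
  by rewrite scalemx1.
rewrite repD (repM rpi) repZ (rep1 rpi) castmx_mulDZ1 pf.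
by rewrite rmorphD rmorphM /= horner_mx_X horner_mx_C.
Qed.

(** For q the characteristic polynomial of [pi h], Cayley-Hamilton puts q(h) into the kernel of
    [pi], while its value at [x] is the scalar q(0), up to sign the determinant of [pi h]; dividing
    by it gives the unit. *)
Lemma rep_kernel_one h x : (0 < n)%N -> h x = 0 -> pi h \in unitmx ->
  exists2 f : cstar T, pi f = 0 & f x = 1%:M.
Proof.
move=> n0 hx uh; have e : n = n.-1.+1 by rewrite prednK.
have [f fx] := rep_horner hx (char_poly (castmx (e, e) (pi h))) e.
rewrite Cayley_Hamilton => pf.
have {}pf : pi f = 0 by rewrite -[pi f](castmxK e e) pf castmx_const.
have c0 : (char_poly (castmx (e, e) (pi h))).[0] != 0.
  rewrite horner_coef0 char_poly_det mulf_eq0 signr_eq0 /=.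
  by rewrite -unitfE -unitmxE castmx_unit.
exists (((char_poly (castmx (e, e) (pi h))).[0])^-1 *: f).
  by rewrite repZ pf scaler0.
by rewrite /= fx -scalemx1 scalerA mulVf// scale1r.
Qed.

End Representations.

Section KernelVector.
Variables (R : realType) (T : tower R).
Local Notation C := R[i].
Implicit Types (x y z p : T) (f g h : cstar T) (s : seq (cstar T)).
Hypotheses (properT : proper_tower T) (heightT : (height T < +oo)%E).

Lemma invmx_conj n (U A : 'M[C]_n) : U \is unitarymx -> A \in unitmx ->
  invmx (conj_mx U A) = conj_mx U (invmx A).
Proof.
move=> uU uA.
have E : conj_mx U A *m conj_mx U (invmx A) = 1%:M.
  by rewrite -(conj_mx_mul _ _ uU) mulmxV// /conj_mx mulmx1 mulmx_unitaryct.
by rewrite -[RHS](mulKmx (mulmx1_unit E).1) E mulmx1.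
Qed.

Lemma dsum_mx_unit n m (A : 'M[C]_n) (B : 'M[C]_m) :
  A \in unitmx -> B \in unitmx ->
  dsum_mx A B \in unitmx /\
  invmx (dsum_mx A B) = dsum_mx (invmx A) (invmx B).
Proof.
move=> uA uB.
have E : dsum_mx A B *m dsum_mx (invmx A) (invmx B) = 1%:M.
  by rewrite -dsum_mxM !mulmxV// dsum_mx1.
split; first exact: (mulmx1_unit E).1.
by rewrite -[RHS](mulKmx (mulmx1_unit E).1) E mulmx1.
Qed.

(** Invertibility passes from irreducibles to orbits and sums, and the pointwise inverse is again a
    continuous field; [cstar_of_field] supplies its boundedness. *)
Lemma cstar_inverse f : (forall x, irreducible x -> f x \in unitmx) ->
  exists g, f * g = 1.
Proof.
move=> uf; pose G n x := invmx (cstar_eval f n x).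
have uF x : cstar_eval f (tdim x) x \in unitmx.
  elim/tower_ind : x => [x ix|n x U dx uU ux|a b ua ub].
  - by rewrite cstar_evalE; exact: uf.
  - rewrite (tdim_tact dx uU) (cstar_eval_act f dx uU); subst n.
    rewrite /conj_mx !unitmx_mul ux (unitarymx_unit uU).
    by rewrite (unitarymx_unit (unitary_tc uU)).
  - rewrite tdim_sum (cstar_eval_sum f erefl erefl).
    by have [] := dsum_mx_unit ua ub.
have uFn n x : tdim x = n -> cstar_eval f n x \in unitmx.
  by move=> dx; subst n.
have eG : equivariant_field G.
  split=> [n x U dx uU|n m x y dx dy]; rewrite /G.
    by rewrite (cstar_eval_act f dx uU) invmx_conj//; exact: uFn.
  rewrite (cstar_eval_sum f dx dy).
  by have [] := dsum_mx_unit (uFn _ _ dx) (uFn _ _ dy).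
have cG n : {within level n, continuous (G n)}.
  apply/within_levelP => x dx; apply: cvg_invmx; first exact: uFn.
    by apply: filterS (level_nbhs dx) => y dy; exact: uFn.
  by have /within_levelP := @cstar_eval_continuous R T f n; apply.
have [g gG] := cstar_of_field properT heightT eG cG.
exists g; apply: cstar_eqP => x /=.
by rewrite -[g x]cstar_evalE gG// /G cstar_evalE mulmxV// -cstar_evalE.
Qed.

(** Compactness of a level in filter form: if no finite [s] works, the sets where all members of [s]
    are singular form a filter base; at a cluster point some [f] is the unit, so it is invertible
    nearby. *)
Lemma finite_unit_cover (P : cstar T -> Prop) :
  (forall z, exists2 f : cstar T, P f & f z = 1%:M) ->
  forall N, exists2 s : seq (cstar T), forall f, f \in s -> P f &
    forall z, (tdim z <= N)%N -> exists2 f : cstar T, f \in s & f z \in unitmx.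
Proof.
move=> ex.
have level_cover k : exists2 s : seq (cstar T), forall f, f \in s -> P f &
    forall z, tdim z = k -> exists2 f : cstar T, f \in s & f z \in unitmx.
  apply: contrapT => no.
  pose good s := forall f, f \in s -> P f.
  pose bad s : set T := [set z | tdim z = k /\
    forall f, f \in s -> f z \notin unitmx].
  pose F := filter_from [set s | good s] bad.
  have PF : ProperFilter F.
    apply: filter_from_proper; last first.
      move=> s gs; apply: contrapT => /set0P/negP; rewrite negbK => /eqP b0.
      apply: no; exists s => // z dz; apply: contrapT => nz.
      suff : bad s z by rewrite b0.
      by split=> // f fs; apply/negP => uf; apply: nz; exists f.
    apply: filter_from_filter; first by exists [::].
    move=> s1 s2 g1 g2; exists (s1 ++ s2).
      by move=> f; rewrite mem_cat => /orP[/g1|/g2].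
    by move=> z [dz zb]; split; split=> // f fs; apply: zb;
      rewrite mem_cat fs ?orbT.
  have [|z0 [dz0 clz0]] := @properT k F PF.
    by exists [::] => // z [].
  have [f Pf fz0] := ex z0.
  have ubad : F (bad [:: f]).
    by exists [:: f] => // g; rewrite inE => /eqP ->.
  have unear : \forall z \near z0, \det (cstar_eval f k z) != 0.
    have /within_levelP/(_ _ dz0) fc := @cstar_eval_continuous R T f k.
    have d1 : \det (cstar_eval f k z0) != 0.
      by rewrite -(dz0 : tdim z0 = k) cstar_evalE fz0 det1 oner_eq0.
    have dc : (fun z => \det (cstar_eval f k z)) @ z0 -->
        \det (cstar_eval f k z0) by exact: cvg_det.
    have d2 : 0 < `|\det (cstar_eval f k z0)| by rewrite normr_gt0.
    apply: filterS (@cvgr_dist_lt _ _ _ (nbhs z0) _ _ _ dc _ d2) => z.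
    by apply: contraTneq => ->; rewrite subr0 ltxx.
  have [z [[dz zb] dz0']] := clz0 _ _ ubad unear.
  have := zb f; rewrite inE eqxx => /(_ isT).
  by rewrite unitmxE unitfE -cstar_evalE dz dz0'.
elim=> [|N [s sP sc]].
  by exists [::] => // z; rewrite leqNgt tdim_gt0.
have [s' s'P s'c] := level_cover N.+1.
exists (s ++ s').
  by move=> f; rewrite mem_cat => /orP[/sP|/s'P].
move=> z; rewrite leq_eqVlt => /orP[/eqP/s'c[f fs uf]|/sc[f fs uf]].
  by exists f => //; rewrite mem_cat fs orbT.
by exists f => //; rewrite mem_cat fs.
Qed.

Variables (n : nat) (pi : cstar T -> 'M[C]_n).
Hypothesis rpi : star_representation pi.

Lemma rep_kernel_vector : (0 < n)%N -> exists x, irreducible x /\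
  exists2 v : 'rV[C]_n, v != 0 & forall h, h x = 0 -> v *m pi h = 0.
Proof.
move=> n0; apply: contrapT => no.
have irr1 x : irreducible x -> exists2 f : cstar T, pi f = 0 & f x = 1%:M.
  move=> ix; have [|s sx us] := @rep_invertible_sum R T n pi rpi
    (fun h => h x = 0).
    move=> u u0; apply: contrapT => nu; apply: no; exists x; split=> //.
    exists u => // h hx; apply: contrapT => /eqP uh; apply: nu; by exists h.
  apply: (rep_kernel_one rpi n0 _ us);
    rewrite cstar_sumE big_seq big1// => g gs.
  by rewrite /= (sx _ gs) mul0mx.
have all1 z : exists2 f : cstar T, pi f = 0 & f z = 1%:M.
  elim/tower_ind : z => [z /irr1//|k x U dx uU [f pf fx]|a b
    [f pf fa] [g pg gb]].
    exists f => //; rewrite -cstar_evalE (tdim_tact dx uU).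
    rewrite (cstar_eval_act f dx uU); subst k.
    by rewrite cstar_evalE fx /conj_mx mulmx1 mulmx_unitaryct.
  (* This is 1 - (1 - f)(1 - g): it is the unit wherever [f] or [g] is, and it stays in the kernel
     of [pi]. *)
  exists (f + g - f * g).
    by rewrite !(repD rpi) (repN rpi) (repM rpi) pf pg mulmx0 subr0 addr0.
  rewrite -cstar_evalE tdim_sum (cstar_eval_sum _ erefl erefl) !cstar_evalE /=.
  have E1 (M : 'M[C]_(tdim a)) : 1%:M + M + -1 *: (1%:M *m M) = 1%:M.
    by rewrite mul1mx scaleN1r addrK.
  have E2 (M : 'M[C]_(tdim b)) : M + 1%:M + -1 *: (M *m 1%:M) = 1%:M.
    by rewrite mulmx1 scaleN1r addrC addKr.
  by rewrite fa gb E1 E2 dsum_mx1.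
have [N irrN] := finite_height heightT.
have [s sJ sc] := finite_unit_cover all1 N.
(* The sum is invertible at every irreducible, hence in the algebra, yet [pi] kills it; so [pi]
   would kill the unit, impossible for n > 0. *)
have [|g Fg] := @cstar_inverse (\sum_(g <- s) g * cstar_adj g).
  move=> x ix; apply/unitmx_rowP => u; rewrite cstar_sumE => uF.
  have [f fs uf] := sc x (irrN x ix).
  have := sum_mul_trmxC_kernel uF fs.
  exact: (unitmx_rowP _).1 uf u.
have := rep1 rpi; rewrite -Fg (repM rpi) (rep_sum rpi) big_seq big1.
  rewrite mul0mx => /matrixP/(_ (Ordinal n0) (Ordinal n0)).
  by rewrite !mxE eqxx => /eqP; rewrite eq_sym oner_eq0.
by move=> h hs; rewrite (repM rpi) sJ// mul0mx.
Qed.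

End KernelVector.

(** * Every representation is the evaluation at a point *)

Section PointOfRepresentation.
Variables (R : realType) (T : tower R).
Local Notation C := R[i].
Implicit Types (x y z p : T) (f g h : cstar T).
Hypotheses (properT : proper_tower T) (heightT : (height T < +oo)%E).
Hypothesis mT : m_tower T.

(** Since [v0 *m pi f] depends only on the value of [f] at [x], the orbit of [v0] is a module over
    the full matrix algebra. A diagonal matrix unit E_ii yields a unit vector [u] fixed by it, and
    the translates of [u] by the E_ij are an orthonormal basis of a copy of the evaluation at
    [x]. *)
Lemma rep_isometry n (pi : cstar T -> 'M[C]_n) : star_representation pi ->
  (0 < n)%N -> exists x (V : 'M[C]_(tdim x, n)),
    V *m V^t* = 1%:M /\ forall f, V *m pi f = f x *m V.
Proof.
move=> rpi n0; have [x [ix [v0 v00 vK]]] :=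
  rep_kernel_vector properT heightT rpi n0.
have vE f g : f x = g x -> v0 *m pi f = v0 *m pi g.
  move=> fg; apply/eqP; rewrite -subr_eq0 -mulmxBr -(repN rpi) -(repD rpi).
  by apply/eqP/vK => /=; rewrite fg scaleN1r subrr.
(* An arbitrary choice of lifts; as [v0] sees only values at [x], the lifts act on it like the
   matrices themselves. *)
pose L (A : 'M[C]_(tdim x)) : cstar T :=
  projT1 (cid (cstar_irr_surj properT heightT mT A ix)).
have LE A : L A x = A.
  exact: (projT2 (cid (cstar_irr_surj properT heightT mT A ix))).
(* The diagonal matrix units sum to the unit, so they cannot all kill [v0]. *)
have [i vi0] : exists i, v0 *m pi (L (delta_mx i i)) != 0.
  apply: contrapT => /forallNP no; move/eqP : v00; apply.
  transitivity (v0 *m pi (\sum_i L (delta_mx i i))).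
    rewrite -[LHS]mulmx1 -(rep1 rpi); apply: vE => /=.
    rewrite (big_morph (fun f : cstar T => f x) (id1 := 0) (op1 := +%R))//.
    by rewrite (eq_bigr (fun i => delta_mx i i)) // -mx1_sum_delta.
  rewrite (big_morph pi (id1 := 0) (op1 := +%R)) ?mulmx_sumr//; last first.
  - exact: rep0.
  - exact: repD.
  by apply: big1 => i _; apply/eqP; apply: contrapT => /negP; exact: no.
pose w := v0 *m pi (L (delta_mx i i)).
have wE f g : f x = g x -> w *m pi f = w *m pi g.
  move=> fg; rewrite /w -!mulmxA -!(repM rpi); apply: vE.
  by rewrite /= fg.
have wi : w *m pi (L (delta_mx i i)) = w.
  rewrite /w -mulmxA -(repM rpi); apply: vE.
  by rewrite /= !LE mul_delta_mx.
pose c : C := ((l2norm (w^t* ))^-1)%:C%C.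
have wn : l2norm (w^t* ) != 0.
  apply/eqP => /l2norm_eq0 w0; move/eqP : vi0; apply.
  by rewrite -/w -[w]trmxCK w0 trmx0 map_mx0.
pose u := c *: w.
have uE f g : f x = g x -> u *m pi f = u *m pi g.
  by move=> fg; rewrite /u -!scalemxAl (wE _ _ fg).
have ui : u *m pi (L (delta_mx i i)) = u by rewrite /u -scalemxAl wi.
have uu : u *m u^t* = 1%:M.
  rewrite [LHS]mx11_scalar; congr (_%:M).
  have := l2norm_dot (u^t* ); rewrite trmxCK => <-.
  have -> : u^t* = c *: w^t*.
    apply/matrixP => a b; rewrite !mxE rmorphM; congr (_ * _).
    exact: conjc_real.
  by rewrite l2normZ normc_real ger0_norm ?invr_ge0 ?l2norm_ge0// mulVf//
    expr1n.
(* Row j times the adjoint of row k is u pi(E_ij E_ki) u^*, which is u u^* = 1 if j = k and 0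
   otherwise. *)
pose V : 'M[C]_(tdim x, n) := \matrix_j (u *m pi (L (delta_mx i j))).
exists x, V; split.
  apply/matrixP => j k.
  have -> : (V *m V^t* ) j k = (row j V *m (row k V)^t* ) 0 0.
    by rewrite !mxE; apply: eq_bigr => l _; rewrite !mxE.
  rewrite !rowK trmxC_mul mulmxA -(rep_adj rpi) -(mulmxA u) -(repM rpi).
  have -> : u *m pi (L (delta_mx i j) * cstar_adj (L (delta_mx i k))) =
      u *m pi (L ((j == k)%:R *: delta_mx i i)).
    apply: uE => /=; rewrite !LE trmx_delta map_delta_mx mul_delta_mx_cond.
    by rewrite scaler_nat.
  case: eqVneq => [->|jk]; rewrite ?scale1r ?scale0r.
    by rewrite ui uu !mxE !eqxx.
  have -> : u *m pi (L 0) = 0.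
    by rewrite (uE _ 0) ?LE// (rep0 rpi) mulmx0.
  by rewrite mul0mx !mxE (negPf jk).
move=> f; apply/row_matrixP => j; rewrite !row_mul rowK.
rewrite -mulmxA -(repM rpi).
transitivity (u *m pi (\sum_k f x j k *: L (delta_mx i k))).
  apply: uE; rewrite (big_morph (fun f : cstar T => f x) (id1 := 0)
    (op1 := +%R))//=.
  rewrite LE; apply/matrixP => a b; rewrite !mxE summxE.
  rewrite (bigD1 j)//= [X in _ + X]big1 ?addr0; last first.
    by move=> k /negPf jk; rewrite mxE jk andbF mul0r.
  rewrite [RHS](bigD1 b)//= [X in _ = _ + X]big1 ?addr0; last first.
    by move=> k kb; rewrite LE !mxE [b == k]eq_sym (negPf kb) andbF mulr0.
  by rewrite LE !mxE !eqxx !andbT mulrC.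
rewrite (big_morph pi (id1 := 0) (op1 := +%R)); last first.
- exact: rep0.
- exact: repD.
rewrite mulmx_sumr mulmx_sum_row; apply: eq_bigr => k _.
by rewrite (repZ rpi) rowK mxE scalemxAr.
Qed.

Lemma point_of_representation n (pi : cstar T -> 'M[C]_n) :
  star_representation pi -> (0 < n)%N ->
  exists2 x, tdim x = n & forall f, pi f = cstar_eval f n x.
Proof.
have [k] := ubnP n; elim: k n pi => // k IHk n pi nk rpi n0.
have [x [V [VV Vpi]]] := rep_isometry rpi n0.
have [m [W [e WW VW]]] := unitary_completion VV.
(* No point has dimension 0, so an empty complement is treated apart: then [V] itself is unitary. *)
have [m0|m0] := posnP m.
  subst m; rewrite addn0 in e; subst n.
  have uV : V \is unitarymx by apply/unitarymxP.
  exists (tact (V^t* ) x) => [|f]; first exact: tdim_tact (unitary_tc uV).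
  rewrite (cstar_eval_act f erefl (unitary_tc uV)) cstar_evalE.
  by rewrite /conj_mx trmxCK -mulmxA -Vpi mulmxA (mulmx_unitarytc uV) mul1mx.
subst n; have WV : W *m V^t* = 0.
  by rewrite -[W]trmxCK -trmxC_mul VW trmx0 map_mx0.
pose U : 'M[C]_(tdim x + m) := col_mx V W.
have uU : U \is unitarymx.
  apply/unitarymxP; rewrite /U tr_col_mx map_row_mx mul_col_row VV VW WV WW.
  by rewrite -scalar_mx_block.
pose rho f := W *m pi f *m W^t*.
have conjU f : conj_mx U (pi f) = dsum_mx (f x) (rho f).
  have VfW : V *m pi f *m W^t* = 0 by rewrite Vpi -mulmxA VW mulmx0.
  (* The complement is invariant too: the intertwining relation is used for the adjoint of [f], and
     then adjoints are taken. *)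
  have WfV : W *m pi f *m V^t* = 0.
    rewrite -mulmxA -[pi f]trmxCK -(rep_adj rpi) -trmxC_mul Vpi trmxC_mul
      mulmxA.
    by rewrite WV mul0mx.
  rewrite /conj_mx /U tr_col_mx map_row_mx mul_col_mx mul_col_row.
  by rewrite VfW WfV Vpi -mulmxA VV mulmx1.
have rrho : star_representation rho.
  split.
  - move=> a f g.
    by rewrite /rho (rep_linear rpi) mulmxDr mulmxDl -scalemxAr -scalemxAl.
  - by rewrite /rho (rep1 rpi) mulmx1 WW.
  - move=> f g; have := conjU (f * g); rewrite (repM rpi).
    rewrite (conj_mx_mul _ _ uU).
    by rewrite !conjU -dsum_mxM => /dsum_mx_inj[_ <-].
  - by move=> f; rewrite /rho (rep_adj rpi) !trmxC_mul trmxCK mulmxA.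
have [|y dy rhoE] := IHk m rho _ rrho m0.
  by move: nk; rewrite ltnS; apply: leq_trans; rewrite -[X in (X < _)%N]add0n
    ltn_add2r tdim_gt0.
have dxy : tdim (tsum x y) = (tdim x + m)%N by rewrite tdim_sum dy.
exists (tact (U^t* ) (tsum x y)) => [|f];
  first exact: (tdim_tact dxy (unitary_tc uU)).
rewrite (cstar_eval_act f dxy (unitary_tc uU)) (cstar_eval_sum f erefl dy).
by rewrite cstar_evalE -rhoE -conjU (conj_mxK _ uU).
Qed.

End PointOfRepresentation.

(** * Morphisms of towers and unital *-homomorphisms *)

Section Morphisms.
Variables (R : realType) (T S : tower R).
Local Notation C := R[i].

Lemma pullback_eval (tau : S -> T) (f : cstar T) n (y : S) : tdim y = n ->
  as_mx n (pullback tau f y) = cstar_eval f n (tau y).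
Proof. by move=> dy; subst n; exact: as_mx_id. Qed.

Lemma pullback_cstar_fun (tau : S -> T) (f : cstar T) : tower_morphism tau ->
  cstar_fun (pullback tau f).
Proof.
move=> [ctau dtau atau stau]; split=> [n|y U uU|y z|].
- have c : {within level n, continuous (fun y => cstar_eval f n (tau y))}.
    apply/within_levelP => y dy.
    have /within_levelP fc := @cstar_eval_continuous R T f n.
    have dty : tdim (tau y) = n by rewrite dtau.
    exact: (cvg_comp _ _ (ctau y) (fc _ dty)).
  apply: subspace_eq_continuous c => y; rewrite inE => dy.
  exact/esym/pullback_eval.
- rewrite pullback_eval ?tdim_act// atau// (cstar_eval_act f (dtau y) uU).
  by rewrite invmx_unitary.
- by rewrite pullback_eval ?tdim_sum// stau
    (cstar_eval_sum f (dtau y) (dtau z)).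
- have /cnorm_ltP[c fc] := cstar_bounded (cstarP f).
  apply/cnorm_ltP; exists c => y;
    rewrite /pullback -/(cstar_eval f (tdim y) (tau y)).
  by rewrite -(dtau y) cstar_evalE.
Qed.

Lemma pullback_unital_star_hom (tau : S -> T) : tower_morphism tau ->
  exists Phi : cstar T -> cstar S, unital_star_hom Phi /\
    forall (f : cstar T) (y : S), Phi f y = pullback tau f y.
Proof.
move=> mtau; exists (fun f => Cstar (pullback_cstar_fun f mtau)); split=> //.
have dtau := morph_dim mtau; split.
- move=> a f g; apply: cstar_eqP => y /=.
  by rewrite /pullback as_mxD as_mxZ.
- split; first by apply: cstar_eqP => y /=; rewrite /pullback as_mx1.
  by move=> f g; apply: cstar_eqP => y /=; rewrite /pullback as_mxM.
- by move=> f; apply: cstar_eqP => y /=; rewrite /pullback as_mx_adj.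
Qed.

Hypotheses (properT : proper_tower T) (heightT : (height T < +oo)%E).
Hypothesis mT : m_tower T.

(** All identities are tested on C*(T), which separates points. For continuity, points near [y0] are
    sent into one compact level, where a cluster point must have the same values as [tau y0] and so
    equals it. *)
Lemma morphism_of_eval (tau : S -> T) (Phi : cstar T -> cstar S) :
  (forall y, tdim (tau y) = tdim y) ->
  (forall f y, Phi f y = pullback tau f y) -> tower_morphism tau.
Proof.
move=> dtau PhiE.
have evE f n y : tdim y = n -> cstar_eval f n (tau y) = cstar_eval (Phi f) n y.
  by move=> dy; rewrite -pullback_eval// -PhiE.
split=> //.
- move=> y0; set n := tdim y0.
  have nearn : \forall y \near y0, tdim y = n := level_nbhs (erefl n).
  have tF : (tau @ y0) (level n).
    by apply: filterS nearn => y dy; rewrite /level /= dtau.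
  have clu z : cluster (tau @ y0) z -> z = tau y0.
    move=> clz.
    have dz : tdim z = n.
      have [w [dw zw]] := clz _ _ tF (level_nbhs (erefl (tdim z))).
      by rewrite -[RHS]dw.
    apply: (cstar_eval_inj properT heightT mT dz (dtau y0)) => f.
    apply: (@hausdorff_matrix R n n) => A B zA yB.
    have /within_levelP fz := @cstar_eval_continuous R T f n.
    have /within_levelP fy := @cstar_eval_continuous R S (Phi f) n.
    have nA : nbhs z [set w | A (cstar_eval f n w)] := fz z dz _ zA.
    have nB : (tau @ y0) [set w | B (cstar_eval f n w)].
      rewrite evE// in yB; have := fy y0 erefl _ yB => yB'.
      have : \forall y \near y0, B (cstar_eval (Phi f) n y) by [].
      apply: filterS2 nearn => y dy By.
      by rewrite /= evE.
    by have [w [Bw Aw]] := clz _ _ nB nA; exists (cstar_eval f n w).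
  apply: (@compact_cluster_set1 T (tau y0) _ (level n)).
  + exact: tower_hausdorff.
  + exact: properT.
  + exact: level_nbhs (dtau y0).
  + exact: tF.
  + have [z [_ clz]] := @properT n (tau @ y0) _ tF.
    apply/seteqP; split=> [w /clu //|w ->]; by rewrite -(clu _ clz).
- move=> y U uU; have dUy := tdim_act uU.
  apply: (cstar_eval_inj properT heightT mT (n := tdim y)).
  + by rewrite dtau.
  + exact: (tdim_tact (dtau y) uU).
  move=> f; rewrite evE// (cstar_eval_act _ erefl uU).
  by rewrite (cstar_eval_act f (dtau y) uU) evE.
- move=> y z; apply: (cstar_eval_inj properT heightT mT (n := tdim y + tdim z)).
  + by rewrite dtau tdim_sum.
  + by rewrite tdim_sum !dtau.
  move=> f; rewrite evE ?tdim_sum// (cstar_eval_sum _ erefl erefl).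
  by rewrite (cstar_eval_sum f (dtau y) (dtau z)) !evE.
Qed.

Lemma morphism_of_star_hom (Phi : cstar T -> cstar S) : unital_star_hom Phi ->
  exists tau : S -> T, tower_morphism tau /\
    forall (f : cstar T) (y : S), Phi f y = pullback tau f y.
Proof.
move=> [linP [P1 PM] Padj].
have pt y : exists x : T, tdim x = tdim y /\
    forall f, Phi f y = cstar_eval f (tdim y) x.
  have rP : star_representation (fun f => Phi f y).
    split=> [a f g||f g|f]; first by rewrite linP.
    - by rewrite P1.
    - by rewrite PM.
    - by rewrite Padj.
  have [x dx xE] := point_of_representation properT heightT mT rP (tdim_gt0 y).
  by exists x.
have [tau tauP] := choice pt; exists tau.
have PhiE f y : Phi f y = pullback tau f y by exact: (tauP y).2.
by split=> //; apply: (morphism_of_eval (fun y => (tauP y).1) PhiE).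
Qed.

End Morphisms.

Theorem theorem5p3 (R : realType) (T S : tower R)
    (mT : m_tower T) (properT : proper_tower T) (heightT : (height T < +oo)%E)
    (mS : m_tower S) (properS : proper_tower S) (heightS : (height S < +oo)%E) :
  (forall Phi : cstar T -> cstar S, unital_star_hom Phi ->
     exists! tau : S -> T,
       tower_morphism tau /\
       forall (f : cstar T) (y : S), Phi f y = pullback tau f y) /\
  (forall tau : S -> T, tower_morphism tau ->
     exists Phi : cstar T -> cstar S,
       unital_star_hom Phi /\
       forall (f : cstar T) (y : S), Phi f y = pullback tau f y).
Proof.
split=> [Phi homPhi|]; last exact: pullback_unital_star_hom.
have [tau [mtau tauE]] := morphism_of_star_hom properT heightT mT homPhi.
exists tau; split=> // sigma [msigma sigmaE]; apply/funext => y.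
apply: (cstar_eval_inj properT heightT mT (morph_dim mtau y)
  (morph_dim msigma y)) => f.
by rewrite -!pullback_eval// -tauE -sigmaE.
Qed.
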